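(* Let $f:M^n\to\bar{\mathbb{Q}}^{n+p}_c$ be a $k$-umbilical isometric immersion and let $\phi:\bar{\mathbb{Q}}^{n+p}_c\to\bar{\mathbb{Q}}^{n+p}_{\tilde c}$ be a conformal diffeomorphism. Then the composition $\tilde f=\phi\circ f:M^n\to\bar{\mathbb{Q}}^{n+p}_{\tilde c}$ (with $M^n$ carrying the metric induced by $\tilde f$) is also $k$-umbilical. Moreover, if $f$ is $k$-Dupin, so is $\tilde f$.
   Context: Manifolds are connected. $\mathbb{Q}^m_c$ is the complete simply connected $m$-dimensional space form of constant curvature $c$ (sphere $\mathbb{S}^m_c$ for $c>0$, $\mathbb{R}^m$ for $c=0$, $\mathbb{H}^m_c$ for $c<0$). $\bar{\mathbb{Q}}^m_c$ denotes $\mathbb{S}^m_c\setminus\{\sigma\}$ if $c>0$, where $\sigma$ is the pole of stereographic projection (the point $(-1,0,\dots,0)$ when $c=1$), and $\bar{\mathbb{Q}}^m_c=\mathbb{Q}^m_c$ if $c\leq0$. For an isometric immersion $f:M^n\to\tilde M^m$, $N_fM(x)$ is the normal space at $x$, $A_\xi$ is the shape operator in the normal direction $\xi$, and $UN_f^{m-1}$ is the unit normal bundle of pairs $(x,\xi)$, $\xi\in N_fM(x)$, $\|\xi\|=1$ (for an oriented hypersurface, just one of its two connected components). Tangent vectors to $UN_f$ at $(x,\xi)$ are identified with pairs $(X,-f_*A_\xi X+\eta)$, $X\in T_xM$, $\eta\in N_fM(x)$, $\eta\perp\xi$, by sending the velocity of a curve $(x(t),\xi(t))$ to $(x',\tilde\nabla_{x'}\xi)$,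 with $\tilde\nabla$ the Levi-Civita connection of $\tilde M$. $f$ is $k$-umbilical if $A_\xi$ has exactly $k$ distinct eigenvalues for every $(x,\xi)\in UN_f$. Then these principal curvatures define smooth functions $\kappa_1,\dots,\kappa_k:UN_f\to\mathbb{R}$ of constant multiplicities; put $E_i(x,\xi)=\{X\in T_xM:A_\xi X=\kappa_iX\}$ and $T_i=\{(X,-f_*A_\xi X):X\in E_i\}$. A $k$-umbilical $f$ is $k$-Dupin if, for each $i$, $\kappa_i$ is constant along $T_i$, i.e. $d\kappa_i$ vanishes on $T_i$. *)

(* Defs.v *)
(* MathComp-Analysis; R is an arbitrary realType. *)
From HB Require Import structures.
From mathcomp Require Import all_boot all_order all_algebra.
From mathcomp Require Import all_classical all_reals all_analysis.

Set Implicit Arguments.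
Unset Strict Implicit.
Unset Printing Implicit Defensive.

Import Order.TTheory GRing.Theory Num.Theory numFieldNormedType.Exports.

Local Open Scope classical_set_scope.
Local Open Scope ring_scope.

(* C^k and C^infinity on an open set of a finite-dimensional space. In finite
   dimension, C^(k+1) means: differentiable, with C^k directional derivatives
   in every (constant) direction. Only used for open U. *)
Fixpoint Ck (R : realType) (V W : normedModType R) (k : nat) (U : set V)
    (f : V -> W) : Prop :=
  match k with
  | 0 => forall x, U x -> {for x, continuous f}
  | k'.+1 => (forall x, U x -> differentiable f x) /\
             (forall v : V, Ck k' U (fun x => 'D_v f x))
  end.

Definition smooth (R : realType) (V W : normedModType R) (U : set V)
  (f : V -> W) : Prop := forall k, Ck k U f.

(* Smoothness of a map on an arbitrary subset A: near each point of A it is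
   the restriction of a smooth map defined on an open set. *)
Definition local_extension (R : realType) (V W : normedModType R) (A : set V)
    (phi : V -> W) (x : V) (Phi : V -> W) : Prop :=
  exists U : set V, [/\ open U, U x, smooth U Phi &
    forall y, U y -> A y -> Phi y = phi y].

Definition smooth_on_subset (R : realType) (V W : normedModType R) (A : set V)
  (phi : V -> W) : Prop :=
  forall x, A x -> exists Phi : V -> W, local_extension A phi x Phi.

Section Manifold.

Variables (R : realType) (n : nat).

(* chart_map and chart_inv are total functions; they only matter on
   chart_dom and on chart_codom respectively. *)
Record chart (M : Type) := Chart {
  chart_dom : set M;
  chart_map : M -> 'rV[R]_n;
  chart_inv : 'rV[R]_n -> M }.

Definition chart_codom (M : Type) (a : chart M) : set 'rV[R]_n :=
  chart_map a @` chart_dom a.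

Definition is_chart (M : topologicalType) (a : chart M) : Prop :=
  [/\ open (chart_dom a), open (chart_codom a),
      (forall x, chart_dom a x -> chart_inv a (chart_map a x) = x),
      (forall x, chart_dom a x -> {for x, continuous (chart_map a)}) &
      (forall u, chart_codom a u -> {for u, continuous (chart_inv a)})].

Definition transition (M : Type) (a b : chart M) : 'rV[R]_n -> 'rV[R]_n :=
  chart_map b \o chart_inv a.

Definition overlap (M : Type) (a b : chart M) : set 'rV[R]_n :=
  chart_map a @` (chart_dom a `&` chart_dom b).

(* Connected smooth n-manifolds; the atlas need not be maximal. *)
Record smooth_manifold := SmoothManifold {
  mf_space :> topologicalType;
  mf_connected : connected [set: mf_space];
  mf_hausdorff : hausdorff_space mf_space;
  mf_second_countable : @second_countable mf_space;
  atlas : set (chart mf_space);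
  atlas_chart : forall a, atlas a -> is_chart a;
  atlas_cover : forall x : mf_space, exists2 a, atlas a & chart_dom a x;
  atlas_smooth : forall a b, atlas a -> atlas b ->
    smooth (overlap a b) (transition a b) }.

(* A Riemannian metric given by its Gram matrices in the charts; tangent
   vectors in a chart are row vectors, so g(X, Y) = X *m G *m Y^T. *)
Definition gram_pair (G : 'M[R]_n) (X Y : 'rV[R]_n) : R :=
  (X *m G *m Y^T) ord0 ord0.

Record riemannian_metric (M : smooth_manifold) := RiemannianMetric {
  gram : chart M -> 'rV[R]_n -> 'M[R]_n;
  gram_smooth : forall a, atlas a -> smooth (chart_codom a) (gram a);
  gram_sym : forall a u, atlas a -> chart_codom a u ->
    (gram a u)^T = gram a u;
  gram_pos : forall a u (X : 'rV[R]_n), atlas a -> chart_codom a u ->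
    X != 0 -> 0 < gram_pair (gram a u) X X;
  gram_compat : forall a b u (X Y : 'rV[R]_n), atlas a -> atlas b ->
    overlap a b u ->
    gram_pair (gram a u) X Y =
    gram_pair (gram b (transition a b u))
      ('D_X (transition a b) u) ('D_Y (transition a b) u) }.

End Manifold.

Arguments atlas {R n} M : rename.
Arguments gram {R n M} g : rename.

Section SpaceForm.

Variables (R : realType) (m : nat) (c : R).

Local Notation V := 'rV[R]_m.+1.

(* The inner product of R^(m+1) for c >= 0; for c < 0, the Lorentzian one,
   the coordinate of index 0 being timelike. *)
Definition ambient_form (x y : V) : R :=
  (if c < 0 then -1 else 1) * x ord0 ord0 * y ord0 ord0
  + \sum_(j < m) x ord0 (lift ord0 j) * y ord0 (lift ord0 j).

(* The round sphere of radius 1 / sqrt c in R^(m+1) for c > 0, the upper sheet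
   of the hyperboloid in R^(1,m) for c < 0, and R^m = {x_0 = 0} for c = 0. *)
Definition space_form : set V :=
  [set x : V | if c == 0 then x ord0 ord0 = 0
           else ambient_form x x = c^-1 /\ (c < 0 -> 0 < x ord0 ord0)].

Definition pole : V := - (Num.sqrt c)^-1 *: delta_mx ord0 ord0.

Definition bar_space_form : set V :=
  [set x : V | space_form x /\ (0 < c -> x <> pole)].

Definition space_form_tangent (x : V) : set V :=
  [set v : V | if c == 0 then v ord0 ord0 = 0 else ambient_form v x = 0].

(* For c <> 0 this is the orthogonal projection onto the tangent space at the
   point x (recall <x, x> = 1/c); for c = 0 it is the identity. The
   Levi-Civita connection of the space form is the flat ambient derivative
   followed by this projection: (D/dt) xi = tangential_part (x t) (xi' t) for a
   tangent field xi along a curve x. *)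
Definition tangential_part (x w : V) : V := w - (c * ambient_form w x) *: x.

End SpaceForm.

(* Conformal diffeomorphisms; phi is a total function of which only the
   restriction to bar_space_form c1 matters. Its differential on tangent
   vectors does not depend on the local extension Phi. *)
Definition conformal_diffeo (R : realType) (m : nat) (c1 c2 : R)
    (phi : 'rV[R]_m.+1 -> 'rV[R]_m.+1) : Prop :=
  (exists psi : 'rV[R]_m.+1 -> 'rV[R]_m.+1,
    [/\ (forall x, bar_space_form c1 x ->
           bar_space_form c2 (phi x) /\ psi (phi x) = x),
        (forall y, bar_space_form c2 y ->
           bar_space_form c1 (psi y) /\ phi (psi y) = y),
        smooth_on_subset (bar_space_form c1) phi &
        smooth_on_subset (bar_space_form c2) psi]) /\
  (exists lambda : 'rV[R]_m.+1 -> R,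
    forall x, bar_space_form c1 x -> 0 < lambda x /\
      forall (Phi : 'rV[R]_m.+1 -> 'rV[R]_m.+1) (v w : 'rV[R]_m.+1),
        local_extension (bar_space_form c1) phi x Phi ->
        space_form_tangent c1 x v -> space_form_tangent c1 x w ->
        ambient_form c2 ('D_v Phi x) ('D_w Phi x) =
        lambda x ^+ 2 * ambient_form c1 v w).

Section Immersion.

Variables (R : realType) (n p : nat) (M : smooth_manifold R n) (c : R).
Variables (g : riemannian_metric M) (f : M -> 'rV[R]_(n + p).+1).

Local Notation V := 'rV[R]_(n + p).+1.

Definition local_repr (a : chart R n M) : 'rV[R]_n -> V := f \o chart_inv a.

(* f_* X at x, where X is read in the chart a. *)
Definition pushforward (a : chart R n M) (x : M) (X : 'rV[R]_n) : V :=
  'D_X (local_repr a) (chart_map a x).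

Definition isometric_immersion : Prop :=
  (forall x, bar_space_form c (f x)) /\
  (forall a, atlas M a ->
    smooth (chart_codom a) (local_repr a) /\
    forall x, chart_dom a x ->
      (forall X, pushforward a x X = 0 -> X = 0) /\
      (forall X Y, ambient_form c (pushforward a x X) (pushforward a x Y) =
                   gram_pair (gram g a (chart_map a x)) X Y)).

Definition normal_space (x : M) : set V :=
  [set xi : V | space_form_tangent c (f x) xi /\
    forall a X, atlas M a -> chart_dom a x ->
      ambient_form c (pushforward a x X) xi = 0].

Definition unit_normals : set (M * V) :=
  [set z : M * V | normal_space z.1 z.2 /\ ambient_form c z.2 z.2 = 1].

(* The unit normal bundle: the set of all unit normals or, for an oriented
   hypersurface, only the component consisting of the values of the chosen
   unit normal field nu. *)
Definition unit_normal_bundle (UN : set (M * V)) : Prop :=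
  UN = unit_normals \/
  (p = 1%N /\ exists nu : M -> V,
    [/\ continuous nu, (forall x, unit_normals (x, nu x)) &
        UN = [set (x, nu x) | x in [set: M]]]).

(* Entry (i, j) is <alpha(e_i, e_j), xi>, computed from the ambient
   Levi-Civita derivative of f_* e_j in the direction e_i; xi being normal, it
   does not see the component tangent to f. *)
Definition second_fundamental_form (a : chart R n M) (x : M) (xi : V) :
    'M[R]_n :=
  \matrix_(i, j) ambient_form c
    (tangential_part c (f x)
       ('D_(delta_mx ord0 i)
          (fun u => 'D_(delta_mx ord0 j) (local_repr a) u) (chart_map a x)))
    xi.

(* The matrix of A_xi in the chart a, acting on row vectors on the right:
   g(A_xi X, Y) = <alpha(X, Y), xi>. *)
Definition shape_operator (a : chart R n M) (x : M) (xi : V) : 'M[R]_n :=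
  second_fundamental_form a x xi *m invmx (gram g a (chart_map a x)).

Definition k_umbilical (UN : set (M * V)) (k : nat) : Prop :=
  forall z, UN z -> forall a, atlas M a -> chart_dom a z.1 ->
    ([set r | eigenvalue (shape_operator a z.1 z.2) r] #= `I_k)%card.

(* The principal curvature functions, numbered increasingly. *)
Definition principal_curvatures (UN : set (M * V)) (k : nat)
    (kappa : 'I_k -> M * V -> R) : Prop :=
  forall z, UN z ->
    (forall i j : 'I_k, (i < j)%N -> kappa i z < kappa j z) /\
    (forall a, atlas M a -> chart_dom a z.1 ->
      forall r, eigenvalue (shape_operator a z.1 z.2) r <->
                exists i, r = kappa i z).

(* A smooth curve (x t, xi t) in UN defined for t near 0. *)
Definition bundle_curve (UN : set (M * V)) (x : R -> M) (xi : R -> V) : Prop :=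
  exists U : set R, [/\ open U, U 0,
    (forall t, U t -> UN (x t, xi t) /\ {for t, continuous x}),
    smooth U (xi : R^o -> V) &
    forall a, atlas M a ->
      smooth (U `&` x @^-1` chart_dom a) (chart_map a \o x : R^o -> _)].

Definition curve_velocity (a : chart R n M) (x : R -> M) : 'rV[R]_n :=
  derive1 (chart_map a \o x) 0.

(* The velocity (x', nabla_{x'} xi) of the curve at t = 0 has the form
   (X, - f_* A_xi X) with A_xi X = r X; for r = kappa_i this says that the
   velocity lies in T_i. *)
Definition velocity_in_T (a : chart R n M) (x : R -> M) (xi : R -> V) (r : R) :
    Prop :=
  let A := shape_operator a (x 0) (xi 0) in
  let X := curve_velocity a x in
  (X <= eigenspace A r)%MS /\
  tangential_part c (f (x 0)) (derive1 xi 0) = - pushforward a (x 0) (X *m A).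

(* d kappa_i vanishes on T_i, d kappa_i (v) being the derivative of kappa_i
   along any curve in UN with velocity v. *)
Definition k_dupin (UN : set (M * V)) (k : nat) : Prop :=
  k_umbilical UN k /\
  forall kappa : 'I_k -> M * V -> R, principal_curvatures UN kappa ->
  forall (i : 'I_k) (x : R -> M) (xi : R -> V) (a : chart R n M),
    bundle_curve UN x xi -> atlas M a -> chart_dom a (x 0) ->
    velocity_in_T a x xi (kappa i (x 0, xi 0)) ->
    is_derive (0 : R^o) (1 : R^o)
      ((fun t => kappa i (x t, xi t)) : R^o -> R^o) (0 : R^o).

End Immersion.

(* Main.v *)
Require Import Defs.
From HB Require Import structures.
From mathcomp Require Import all_boot all_order all_algebra.
From mathcomp Require Import all_classical all_reals all_analysis.
From mathcomp Require Import ring lra.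

(** Everything is pulled back to open sets of R^m, m = n + p.  Stereographic
    projection is a diffeomorphism from an open set U of R^m (a ball for c < 0,
    R^m otherwise) to the space form, without its pole for c > 0.  Its inverse
    turns f into a map f0 from M to U, and f and phi o f are the compositions of
    f0 with stereographic projection and with h = phi o stereographic projection.
    Both are instances of conformal_param: maps h from U to a space form which induce
    the metric tau^-2 |dx|^2 for a positive function tau.  The theorem compares
    two such maps composed with the same f0.

    If xi0 is a unit normal of f0, then xi = tau D_xi0 h is one of h o f0, and
    all are obtained so.  The Koszul formula (cp_koszul) gives the second
    fundamental form, and the result is A_xi = tau A0_xi0 + (D_xi0 tau) Id
    (lift_shape), where A0 is the shape operator of f0.  So the eigenspaces do not
    depend on h, and the principal curvatures for two maps h are related by affine
    bijections: the number of distinct ones is the same (k_umbilical_transfer).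

    For the Dupin condition, a curve of unit normals is tangent to T_i if and only
    if X0 = x0' satisfies A0 X0 = k0 X0 and xi0' = - k0 X0 for a number k0,
    which does not depend on h either (velocity_param).  Along such a curve the
    derivative of the principal curvature tau k0 + D_xi0 tau is
    tau k0' + Hess tau (X0, xi0), as the other terms cancel.  Since X0 is
    orthogonal to xi0, the last term vanishes if the Hessian of tau is a multiple
    of the identity, and then the condition on kappa_i is just k0' = 0
    (k_dupin_transfer).

    It remains to see that the Hessian of tau is a multiple of the identity.  For
    stereographic projection tau is an explicit quadratic polynomial.  For its
    composition with phi it is the local theorem of Liouville when m is at least 3
    (cp_liouville), and there is nothing to prove when m is at most 1.  When m = 2
    the claim is false for locally defined conformal maps, and one uses that phi is
    a global diffeomorphism (planar_hessian).  In stereographic coordinates it is a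
    conformal diffeomorphism between two planes, which is a similarity, or between
    two discs, which is an isometry of the hyperbolic metrics up to scale by the
    Schwarz-Pick lemma for phi and its inverse; a plane and a disc are not
    conformally equivalent.  These three facts are obtained in real terms, whatever
    the orientation: the logarithms of certain quadratic polynomials, such as
    squared distances, are harmonic in the plane, remain so when composed with a
    conformal map, and a maximum principle with two punctures applies to their
    combinations (punctured_maximum).

    For hypersurfaces, the components of the unit normal bundles chosen for f and
    for phi o f need not correspond to each other.  Replacing xi by - xi changes
    the signs of the principal curvatures and reverses their order, and the sign
    relating the two choices is constant along a short curve
    (unit_bundle_sign_near). *)

Set Implicit Arguments.
Unset Strict Implicit.
Unset Printing Implicit Defensive.

Import Order.TTheory GRing.Theory Num.Theory numFieldNormedType.Exports.
Local Open Scope classical_set_scope.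
Local Open Scope ring_scope.

(** * Calculus *)

Section DirectionalDerivative.
Context {R : realType}.

Lemma derive_comp (U V W : normedModType R) (f : U -> V) (g : V -> W) x v :
  differentiable f x -> differentiable g (f x) ->
  'D_v (g \o f) x = 'D_('D_v f x) g (f x).
Proof.
move=> df dg; rewrite !deriveE//; last exact: differentiable_comp.
by rewrite diff_comp.
Qed.

Lemma derive_dirZ (V W : normedModType R) (f : V -> W) x a v :
  differentiable f x -> 'D_(a *: v) f x = a *: 'D_v f x.
Proof. by move=> df; rewrite !deriveE// linearZ. Qed.

Lemma derive_dir_coord (W : normedModType R) q (f : 'rV[R]_q -> W) x v :
  differentiable f x ->
  'D_v f x = \sum_j v ord0 j *: 'D_(delta_mx ord0 j) f x.
Proof.
move=> df; rewrite deriveE// [v in LHS]row_sum_delta linear_sum.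
by apply: eq_bigr => j _; rewrite linearZ deriveE.
Qed.

Lemma differentiable_mxP (V : normedModType R) p q (f : V -> 'M[R]_(p, q)) x :
  differentiable f x <->
  forall i j, differentiable (fun y => f y i j : R^o) x.
Proof.
split=> [df i j|df].
  exact: (@differentiable_comp _ _ _ _ f (fun N : 'M[R]_(p, q) => N i j))
    (differentiable_coord _ _ _).
have -> : f = \sum_i \sum_j (fun y => (f y i j : R^o) *: delta_mx i j).
  by apply/funext => y; rewrite fct_sumE [LHS]matrix_sum_delta;
    apply: eq_bigr => i _; rewrite fct_sumE.
apply: differentiable_sum => i; apply: differentiable_sum => j.
exact: differentiableZl.
Qed.

Lemma derive_coord (V : normedModType R) p q (f : V -> 'M[R]_(p, q)) x v i j :
  differentiable f x -> 'D_v f x i j = 'D_v (fun y => f y i j : R^o) x.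
Proof.
by move=> df; rewrite derive_mx ?mxE//; exact: diff_derivable.
Qed.

(** The differential of f is also one of g, by uniqueness of little-o
    expansions; the differential being a total function, this must be spelled
    out. *)
Lemma near_eq_differentiable (V W : normedModType R) (f g : V -> W) x :
  (\near x, f x = g x) -> differentiable f x -> differentiable g x.
Proof.
move=> fg df.
have dg : g \o shift x = cst (g x) + 'd f x +o_ 0 id.
  apply/eqaddoP => e e0; have := diff_locally df => /eqaddoP /(_ e e0).
  have fgx : f x = g x by exact: nbhs_singleton fg.
  have : \forall h \near (0 : V), f (h + x) = g (h + x).
    by move: fg; rewrite (near_shift 0 x) /= subr0.
  apply: filterS2 => h.
  by rewrite /= -![(_ - _ : _ -> _) _]/(_ - _) -![(_ + _ : _ -> _) _]/(_ + _) /= fgx => ->.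
have E := diff_unique (diff_continuous df) dg.
by apply/diff_locallyP; rewrite E; split => //; exact: diff_continuous.
Qed.

Lemma continuous_mxP (T : topologicalType) p q (f : T -> 'M[R]_(p, q)) x :
  {for x, continuous f} <->
  forall i j, {for x, continuous (fun y => f y i j : R^o)}.
Proof.
split=> [cf i j|cf].
  exact: (@continuous_comp _ _ _ f (fun N : 'M[R]_(p, q) => N i j : R^o) x cf
            (@coord_continuous _ _ _ _ _ _)).
apply/cvgrPdist_le => e e0; near=> y.
rewrite [leLHS]/Num.Def.normr/= mx_normrE (bigmax_le _ (ltW e0))//= => i _.
rewrite !mxE; move: i; near: y; apply: filter_forall => /= i.
exact: ((cvgrPdist_le _ _).1 (cf i.1 i.2)).
Unshelve. all: by end_near. Qed.

Lemma is_derive_bigsum (V W : normedModType R) (I : Type) (r : seq I) (P : pred I)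
    (f : I -> V -> W) (df : I -> W) x v :
  (forall i, is_derive x v (f i) (df i)) ->
  is_derive x v (fun y => \sum_(i <- r | P i) f i y) (\sum_(i <- r | P i) df i).
Proof.
move=> Hf; elim: r => [|i r IH].
  rewrite big_nil; have -> : (fun y => \sum_(i <- [::] | P i) f i y) = cst 0.
    by apply/funext => y; rewrite big_nil.
  exact: is_derive_cst.
rewrite big_cons; have -> : (fun y => \sum_(i <- i :: r | P i) f i y) =
   fun y => (if P i then f i y + \sum_(j <- r | P j) f j y else \sum_(j <- r | P j) f j y).
  by apply/funext => y; rewrite big_cons.
case: (P i) => //.
exact: is_deriveD.
Qed.

Lemma differentiable_bigsum (V W : normedModType R) (I : Type) (r : seq I) (P : pred I) (f : I -> V -> W) x :
  (forall i, differentiable (f i) x) ->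
  differentiable (fun y => \sum_(i <- r | P i) f i y) x.
Proof.
move=> df; elim: r => [|i r IH].
  have -> : (fun y => \sum_(i <- [::] | P i) f i y) = cst 0.
    by apply/funext => y; rewrite big_nil.
  exact: differentiable_cst.
have -> : (fun y => \sum_(i <- i :: r | P i) f i y) =
   fun y => (if P i then f i y + \sum_(j <- r | P j) f j y else \sum_(j <- r | P j) f j y).
  by apply/funext => y; rewrite big_cons.
case: (P i) => //.
exact: differentiableD.
Qed.

End DirectionalDerivative.

Section WeightedDot.
Context {R : realType}.

(** One bilinear form serves for the Euclidean and for the Lorentzian product;
    the weights are the signs. *)
Definition wdot q (w : 'I_q -> R) (u v : 'rV[R]_q) : R :=
  \sum_j w j * u ord0 j * v ord0 j.

Lemma wdotE q (w : 'I_q -> R) u v :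
  wdot w u v = \sum_j w j * u ord0 j * v ord0 j.
Proof. by []. Qed.

Section Bilinear.
Variables (q : nat) (w : 'I_q -> R).
Implicit Types u v : 'rV[R]_q.

Lemma wdotC u v : wdot w u v = wdot w v u.
Proof. by apply: eq_bigr => j _; rewrite mulrAC. Qed.

Lemma wdotDl u1 u2 v : wdot w (u1 + u2) v = wdot w u1 v + wdot w u2 v.
Proof. by rewrite -big_split; apply: eq_bigr => j _; rewrite !mxE mulrDr mulrDl. Qed.

Lemma wdotDr u v1 v2 : wdot w u (v1 + v2) = wdot w u v1 + wdot w u v2.
Proof. by rewrite wdotC wdotDl wdotC [wdot w v2 u]wdotC. Qed.

Lemma wdotZl a u v : wdot w (a *: u) v = a * wdot w u v.
Proof. by rewrite mulr_sumr; apply: eq_bigr => j _; rewrite !mxE; ring. Qed.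

Lemma wdotZr a u v : wdot w u (a *: v) = a * wdot w u v.
Proof. by rewrite wdotC wdotZl wdotC. Qed.

Lemma wdotNl u v : wdot w (- u) v = - wdot w u v.
Proof. by rewrite -scaleN1r wdotZl mulN1r. Qed.

Lemma wdotNr u v : wdot w u (- v) = - wdot w u v.
Proof. by rewrite wdotC wdotNl wdotC. Qed.

Lemma wdot0l v : wdot w 0 v = 0.
Proof. by rewrite -(scale0r (0 : 'rV_q)) wdotZl mul0r. Qed.

Lemma wdot0r v : wdot w v 0 = 0.
Proof. by rewrite wdotC wdot0l. Qed.

Lemma wdot_suml (I : finType) (F : I -> 'rV_q) v :
  wdot w (\sum_i F i) v = \sum_i wdot w (F i) v.
Proof. by elim/big_rec2: _ => [|i x y _ <-]; rewrite ?wdot0l ?wdotDl. Qed.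

Lemma wdot_sumr (I : finType) (F : I -> 'rV_q) v :
  wdot w v (\sum_i F i) = \sum_i wdot w v (F i).
Proof. by rewrite wdotC wdot_suml; apply: eq_bigr => i _; rewrite wdotC. Qed.

Lemma wdot_delta u j : wdot w u (delta_mx ord0 j) = w j * u ord0 j.
Proof.
rewrite /wdot (bigD1 j)//= big1 ?addr0; last first.
  by move=> i ij; rewrite mxE eqxx (negPf ij) mulr0.
by rewrite mxE !eqxx mulr1.
Qed.

Lemma differentiable_wdot (V : normedModType R) (f g : V -> 'rV_q) x :
  differentiable f x -> differentiable g x ->
  differentiable (fun y => wdot w (f y) (g y) : R^o) x.
Proof.
move=> /differentiable_mxP df /differentiable_mxP dg.
apply: differentiable_bigsum => j.
by apply: differentiableM => //; apply: differentiableM => //.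
Qed.

Lemma derive_wdot (V : normedModType R) (f g : V -> 'rV_q) x (v : V) :
  differentiable f x -> differentiable g x ->
  'D_v (fun y => wdot w (f y) (g y) : R^o) x =
    wdot w ('D_v f x) (g x) + wdot w (f x) ('D_v g x).
Proof.
move=> df dg; rewrite -big_split /=.
have /differentiable_mxP df' := df; have /differentiable_mxP dg' := dg.
have D j : is_derive x v (fun y => w j * f y ord0 j * g y ord0 j : R^o)
    (w j * 'D_v f x ord0 j * g x ord0 j + w j * f x ord0 j * 'D_v g x ord0 j).
  rewrite !derive_coord//.
  have /diff_derivable/derivableP Hf := df' ord0 j.
  have /diff_derivable/derivableP Hg := dg' ord0 j.
  have H := is_deriveM (Hf v) (Hg v).
  have -> : (fun y => w j * f y ord0 j * g y ord0 j : R^o) =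
     w j \*: ((fun y => f y ord0 j : R^o) * (fun y => g y ord0 j : R^o)).
    by apply/funext => y /=; rewrite /GRing.scale /= mulrA.
  apply: is_derive_eq; rewrite /GRing.scale /=; ring.
by have [_ ->] := is_derive_bigsum (index_enum 'I_q) predT D.
Qed.

End Bilinear.

Definition dot q : 'rV[R]_q -> 'rV[R]_q -> R := wdot (fun=> 1).

Lemma dot_ge0 q (u : 'rV[R]_q) : 0 <= dot u u.
Proof. by apply: sumr_ge0 => j _; rewrite mul1r -expr2 sqr_ge0. Qed.

Lemma dot_eq0 q (u : 'rV[R]_q) : (dot u u == 0) = (u == 0).
Proof.
apply/idP/eqP => [|->]; last by rewrite /dot wdot0l.
rewrite /dot /wdot psumr_eq0 => [/allP H|j _]; last by rewrite mul1r -expr2 sqr_ge0.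
apply/rowP => j; have /H := mem_index_enum j.
by rewrite /= mul1r -expr2 sqrf_eq0 mxE => /eqP.
Qed.

Lemma dot_gt0 q (u : 'rV[R]_q) : (0 < dot u u) = (u != 0).
Proof. by rewrite lt_def dot_ge0 dot_eq0 andbT. Qed.

Lemma dot_coord q (u : 'rV[R]_q) j : u ord0 j ^+ 2 <= dot u u.
Proof.
rewrite /dot /wdot (bigD1 j)//= mul1r -expr2 lerDl.
by apply: sumr_ge0 => i _; rewrite mul1r -expr2 sqr_ge0.
Qed.

Definition ambient_weight (c : R) m (j : 'I_m.+1) : R :=
  if (c < 0) && (j == ord0) then -1 else 1.

Lemma ambient_formE (c : R) m (u v : 'rV[R]_m.+1) :
  ambient_form c u v = wdot (ambient_weight c (m := m)) u v.
Proof.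
rewrite /ambient_form /wdot big_ord_recl; congr (_ * _ * _ + _).
  by rewrite /ambient_weight eqxx andbT.
by apply: eq_bigr => j _; rewrite /ambient_weight /= andbF mul1r.
Qed.

End WeightedDot.

Section Smoothness.
Context {R : realType}.

Lemma eq_near_open (V : normedModType R) (W : Type) (U : set V) (f g : V -> W) x :
  open U -> U x -> (forall y, U y -> f y = g y) -> \near x, f x = g x.
Proof. by move=> oU Ux fg; apply: filterS (open_nbhs_nbhs (conj oU Ux)). Qed.

Lemma eq_derive_open (V W : normedModType R) (U : set V) (f g : V -> W) x v :
  open U -> U x -> (forall y, U y -> f y = g y) -> 'D_v f x = 'D_v g x.
Proof. by move=> oU Ux fg; apply/near_eq_derive/(eq_near_open oU Ux fg). Qed.

Section Ck_general.
Variables V W : normedModType R.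
Implicit Types (U : set V) (f g : V -> W).

Lemma eq_Ck k U f g : open U -> (forall x, U x -> f x = g x) ->
  Ck k U f -> Ck k U g.
Proof.
elim: k f g => [|k IH] f g oU fg /= Hf.
  move=> x Ux; rewrite /prop_for /continuous_at -(fg _ Ux).
  exact: (cvg_trans (near_eq_cvg (eq_near_open oU Ux fg)) (Hf x Ux)).
case: Hf => df Df; split=> [x Ux|v].
  exact: near_eq_differentiable (eq_near_open oU Ux fg) (df _ Ux).
by apply: IH (Df v) => // x Ux; exact: eq_derive_open oU Ux fg.
Qed.

Lemma sub_Ck k U U' f : U' `<=` U -> Ck k U f -> Ck k U' f.
Proof.
elim: k f => [|k IH] f UU' /=; first by move=> H x /UU'; exact: H.
by move=> [df Df]; split=> [x /UU'|v]; [exact: df|exact: IH].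
Qed.

(** Smoothness can be checked on sets chosen after the point, such as the domains
    of charts or of local extensions. *)
Lemma Ck_local k U f :
  (forall x, U x -> exists U', U' x /\ Ck k U' f) -> Ck k U f.
Proof.
elim: k f => [|k IH] f H /=.
  by move=> x /H [U' [/[swap] ]]; exact.
split=> [x /H [U' [U'x [+ _]]]|v]; first exact.
by apply: IH => x /H [U' [U'x [_ /(_ v)]]]; exists U'.
Qed.

Lemma CkW k U f : Ck k.+1 U f -> Ck k U f.
Proof.
elim: k f => [|k IH] f /=; first by move=> [df _] x Ux; exact/differentiable_continuous/df.
by move=> [df Df]; split=> // v; apply: IH; exact: Df.
Qed.

Lemma Ck_cst k U (a : W) : Ck k U (fun=> a).
Proof.
elim: k a => [|k IH] a /=; first by move=> x _; exact: cvg_cst.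
split=> [x _|v]; first exact: differentiable_cst.
by have -> : (fun x => 'D_v (fun=> a) x) = (fun=> 0 : W) by apply/funext => x; exact: derive_cst.
Qed.

Lemma CkD k U f g : open U -> Ck k U f -> Ck k U g -> Ck k U (fun x => f x + g x).
Proof.
move=> oU; elim: k f g => [|k IH] f g /=.
  by move=> cf cg x Ux; apply: cvgD; [exact: cf|exact: cg].
move=> [df Df] [dg Dg]; split=> [x Ux|v].
  by apply: differentiableD; [exact: df|exact: dg].
apply: eq_Ck (IH _ _ (Df v) (Dg v)) => // x Ux.
by rewrite -deriveD//; apply: diff_derivable; [exact: df|exact: dg].
Qed.

Lemma Ck_sum k U (I : Type) (r : seq I) (P : pred I) (F : I -> V -> W) :
  open U -> (forall i, Ck k U (F i)) -> Ck k U (fun x => \sum_(i <- r | P i) F i x).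
Proof.
move=> oU HF; elim: r => [|i r IH].
  by apply: (@eq_Ck _ _ (fun=> 0)) => //; [move=> x _; rewrite big_nil|exact: Ck_cst].
case Pi : (P i).
  apply: (@eq_Ck _ _ (fun x => F i x + \sum_(j <- r | P j) F j x)) => //; last exact: CkD.
  by move=> x _; rewrite big_cons Pi.
by apply: eq_Ck IH => // x _; rewrite big_cons Pi.
Qed.

End Ck_general.

Lemma Ck_id (V : normedModType R) k (U : set V) : Ck k U (fun x => x).
Proof.
case: k => [|k] /=; first by move=> x _; exact: cvg_id.
split=> [x _|v]; first exact: (@ex_diff _ _ _ _ _ _ _ (is_diff_id x)).
have -> : (fun x => 'D_v id x) = (fun=> v) by apply/funext => x; exact: derive_id.
exact: Ck_cst.
Qed.

Section Ck_scalar.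
Variable V : normedModType R.
Implicit Types (U : set V) (f g : V -> R^o).

Lemma CkM k U f g : open U -> Ck k U f -> Ck k U g -> Ck k U (fun x => f x * g x : R^o).
Proof.
move=> oU; elim: k f g => [|k IH] f g.
  by move=> cf cg x Ux; apply: cvgM; [exact: cf|exact: cg].
move=> Hf Hg; have [df Df] := Hf; have [dg Dg] := Hg; split=> [x Ux|v].
  by apply: differentiableM; [exact: df|exact: dg].
apply: (@eq_Ck _ _ _ _ (fun x => f x * 'D_v g x + g x * 'D_v f x : R^o)) => //.
  move=> x Ux; apply/esym/deriveM; apply: diff_derivable; [exact: df|exact: dg].
by apply: CkD => //; apply: IH; [exact: CkW|exact: Dg|exact: CkW|exact: Df].
Qed.

End Ck_scalar.

Lemma Ck_mxP (V : normedModType R) k U p q (f : V -> 'M[R]_(p, q)) : open U ->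
  Ck k U f <-> forall i j, Ck k U (fun x => f x i j : R^o).
Proof.
move=> oU; elim: k f => [|k IH] f /=.
  split=> [cf i j x Ux|cf x Ux]; first exact: (continuous_mxP _ _).1 (cf x Ux) i j.
  by apply/continuous_mxP => i j; exact: cf.
split=> [[df Df] i j|H].
  split=> [x Ux|v]; first exact: (differentiable_mxP _ _).1 (df x Ux) i j.
  apply: (@eq_Ck _ _ _ _ (fun x => 'D_v f x i j : R^o)) => //.
    by move=> x Ux; rewrite derive_coord//; exact: df.
  exact: (IH _).1 (Df v) i j.
have df x : U x -> differentiable f x.
  by move=> Ux; apply/differentiable_mxP => i j; have [d _] := H i j; exact: d.
split=> // v; apply/IH => i j.
have [_ Df] := H i j.
apply: eq_Ck (Df v) => // x Ux.
by rewrite derive_coord//; exact: df.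
Qed.

(** By induction on k, the chain rule expressing the derivatives of g o f by
    sums of products of derivatives of f with compositions of lower order. *)
Lemma Ck_comp_scalar (V : normedModType R) q k (U : set V) (U' : set 'rV[R]_q)
    (f : V -> 'rV[R]_q) (g : 'rV[R]_q -> R^o) :
  open U -> (forall x, U x -> U' (f x)) -> Ck k U f -> Ck k U' g ->
  Ck k U (fun x => g (f x)).
Proof.
move=> oU ff; elim: k f g ff => [|k IH] f g ff.
  move=> cf cg x Ux.
  exact: (@continuous_comp _ _ _ f g x (cf x Ux) (cg _ (ff x Ux))).
move=> Hf Hg; have [df Df] := Hf; have [dg Dg] := Hg.
split=> [x Ux|v].
  by apply: (differentiable_comp (df x Ux)); exact/dg/ff.
apply: (@eq_Ck _ _ _ _ (fun x => \sum_j ('D_v f x ord0 j : R^o) * 'D_(delta_mx ord0 j) g (f x))) => //.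
  move=> x Ux; rewrite (derive_comp v (df x Ux) (dg _ (ff x Ux))).
  by rewrite [RHS]derive_dir_coord//; exact/dg/ff.
apply: Ck_sum => // j; apply: CkM => //; first exact: (Ck_mxP _ _ _).1 (Df v) ord0 j.
by apply: (IH f ('D_(delta_mx ord0 j) g)) => //; [exact: CkW|exact: Dg].
Qed.

Lemma Ck_comp (V : normedModType R) q p1 p2 k (U : set V) (U' : set 'rV[R]_q)
    (f : V -> 'rV[R]_q) (g : 'rV[R]_q -> 'M[R]_(p1, p2)) :
  open U -> open U' -> (forall x, U x -> U' (f x)) -> Ck k U f -> Ck k U' g ->
  Ck k U (fun x => g (f x)).
Proof.
move=> oU oU' ff Hf Hg; apply/Ck_mxP => // i j.
apply: (@Ck_comp_scalar _ _ _ _ U' f (fun y => g y i j : R^o)) => //.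
exact: (Ck_mxP _ _ _).1 Hg i j.
Qed.

End Smoothness.

Section SmoothTheory.
Context {R : realType}.

Section General.
Variables V W : normedModType R.
Implicit Types (U : set V) (f g : V -> W).

Lemma smooth_differentiable U f x : smooth U f -> U x -> differentiable f x.
Proof. by move=> /(_ 1%N) [df _]; exact: df. Qed.

Lemma smooth_derive U f v : smooth U f -> smooth U ('D_v f).
Proof. by move=> Hf k; have [_] := Hf k.+1; exact. Qed.

Lemma smooth_continuous U f x : smooth U f -> U x -> {for x, continuous f}.
Proof. by move=> Hf Ux; exact/differentiable_continuous/(smooth_differentiable Hf Ux). Qed.

Lemma eq_smooth U f g : open U -> (forall x, U x -> f x = g x) ->
  smooth U f -> smooth U g.
Proof. by move=> oU fg Hf k; exact: eq_Ck oU fg (Hf k). Qed.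

Lemma sub_smooth U U' f : U' `<=` U -> smooth U f -> smooth U' f.
Proof. by move=> UU' Hf k; exact: sub_Ck UU' (Hf k). Qed.

Lemma smooth_local U f :
  (forall x, U x -> exists U', U' x /\ smooth U' f) -> smooth U f.
Proof. by move=> H k; apply: Ck_local => x /H [U' [U'x Hf]]; exists U'; split. Qed.

Lemma smooth_cst U (a : W) : smooth U (fun=> a).
Proof. by move=> k; exact: Ck_cst. Qed.

Lemma smoothD U f g : open U -> smooth U f -> smooth U g ->
  smooth U (fun x => f x + g x).
Proof. by move=> oU Hf Hg k; exact: CkD. Qed.

Lemma smooth_sum U (I : Type) (r : seq I) (P : pred I) (F : I -> V -> W) :
  open U -> (forall i, smooth U (F i)) ->
  smooth U (fun x => \sum_(i <- r | P i) F i x).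
Proof. by move=> oU HF k; apply: Ck_sum => // i; exact: HF. Qed.

End General.

Lemma smooth_id (V : normedModType R) (U : set V) : smooth U (fun x => x).
Proof. by move=> k; exact: Ck_id. Qed.

Lemma smooth_mxP (V : normedModType R) U p q (f : V -> 'M[R]_(p, q)) : open U ->
  smooth U f <-> forall i j, smooth U (fun x => f x i j : R^o).
Proof.
move=> oU; split=> [Hf i j k|Hf k]; first exact: (Ck_mxP _ _ oU).1 (Hf k) i j.
by apply/Ck_mxP => // i j; exact: Hf.
Qed.

Lemma smooth_comp (V : normedModType R) q p1 p2 (U : set V) (U' : set 'rV[R]_q)
    (f : V -> 'rV[R]_q) (g : 'rV[R]_q -> 'M[R]_(p1, p2)) :
  open U -> open U' -> (forall x, U x -> U' (f x)) -> smooth U f -> smooth U' g ->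
  smooth U (fun x => g (f x)).
Proof. by move=> oU oU' ff Hf Hg k; exact: (@Ck_comp _ _ _ _ _ k U U' f g). Qed.

Lemma smooth_comp_scalar (V : normedModType R) q (U : set V) (U' : set 'rV[R]_q)
    (f : V -> 'rV[R]_q) (g : 'rV[R]_q -> R^o) :
  open U -> (forall x, U x -> U' (f x)) -> smooth U f -> smooth U' g ->
  smooth U (fun x => g (f x)).
Proof. by move=> oU ff Hf Hg k; exact: (@Ck_comp_scalar _ _ _ k U U' f g). Qed.

Section Scalar.
Variable V : normedModType R.
Implicit Types (U : set V) (f g : V -> R^o).

Lemma smoothM U f g : open U -> smooth U f -> smooth U g ->
  smooth U (fun x => f x * g x : R^o).
Proof. by move=> oU Hf Hg k; exact: CkM. Qed.

Lemma smoothX U f j : open U -> smooth U f -> smooth U (fun x => f x ^+ j : R^o).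
Proof.
move=> oU Hf; elim: j => [|j IH].
  exact: smooth_cst.
by apply: (eq_smooth oU _ (smoothM oU Hf IH)) => x _; rewrite exprS.
Qed.

Lemma smooth_wdot q (w : 'I_q -> R) U (f g : V -> 'rV[R]_q) : open U ->
  smooth U f -> smooth U g -> smooth U (fun x => wdot w (f x) (g x) : R^o).
Proof.
move=> oU /(smooth_mxP _ oU) Hf /(smooth_mxP _ oU) Hg.
apply: smooth_sum => // j; do 2 (apply: smoothM => //).
exact: smooth_cst.
Qed.

Lemma smoothZ p q U f (F : V -> 'M[R]_(p, q)) : open U ->
  smooth U f -> smooth U F -> smooth U (fun x => f x *: F x).
Proof.
move=> oU Hf /(smooth_mxP _ oU) HF; apply/smooth_mxP => // i j.
apply: (eq_smooth oU _ (smoothM oU Hf (HF i j))) => x _; by rewrite mxE.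
Qed.

End Scalar.

Lemma derive_realdir (W : normedModType R) (f : R^o -> W) (x v : R^o) :
  differentiable f x -> 'D_v f x = v *: 'D_(1 : R^o) f x.
Proof. by move=> df; rewrite -derive_dirZ//; congr ('D_ _ f x); rewrite /GRing.scale /= mulr1. Qed.

Lemma is_derive_invsqrt (y : R) : 0 < y ->
  is_derive y 1 (fun y : R => (Num.sqrt y)^-1) (- 2^-1 * (Num.sqrt y)^-1 ^+ 3).
Proof.
move=> y0; have s0 : Num.sqrt y != 0 by rewrite gt_eqF// sqrtr_gt0.
have H := is_deriveV s0 (is_derive1_sqrt y0).
apply: is_derive_eq; rewrite /GRing.scale /=; field.
by rewrite s0.
Qed.

Lemma differentiable_invsqrt (y : R) : 0 < y ->
  differentiable (fun y : R^o => (Num.sqrt y)^-1 : R^o) y.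
Proof. by move=> y0; apply/derivable1_diffP; have [] := is_derive_invsqrt y0. Qed.

Lemma derive_invsqrt (V : normedModType R) (f : V -> R^o) x v :
  differentiable f x -> 0 < f x ->
  'D_v (fun x => (Num.sqrt (f x))^-1 : R^o) x =
    - 2^-1 * (Num.sqrt (f x))^-1 ^+ 3 * 'D_v f x.
Proof.
move=> df f0; have dq := differentiable_invsqrt f0.
rewrite (derive_comp v df dq) derive_realdir//.
have H := is_derive_invsqrt f0.
by rewrite [X in _ *: X](@derive_val _ _ _ _ _ _ _ H) /GRing.scale /= mulrC.
Qed.

(** The derivative of 1 / sqrt f is a polynomial in 1 / sqrt f and f', which
    makes the induction on the order of differentiability go through. *)
Lemma smooth_invsqrt (V : normedModType R) U (f : V -> R^o) : open U ->
  smooth U f -> (forall x, U x -> 0 < f x) ->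
  smooth U (fun x => (Num.sqrt (f x))^-1 : R^o).
Proof.
move=> oU Hf f0.
have dq x : U x -> differentiable (fun x => (Num.sqrt (f x))^-1 : R^o) x.
  move=> Ux; exact: (differentiable_comp (smooth_differentiable Hf Ux)
                       (differentiable_invsqrt (f0 _ Ux))).
elim=> [|k IH]; first by move=> x /dq; exact: differentiable_continuous.
split=> // v.
apply: (@eq_Ck _ _ _ _ _ (fun x => - 2^-1 * (Num.sqrt (f x))^-1 ^+ 3 * 'D_v f x : R^o)) => //.
  by move=> x Ux; rewrite derive_invsqrt//; [exact: smooth_differentiable Hf Ux|exact: f0].
apply: CkM => //; last exact: smooth_derive Hf k.
apply: CkM => //; first exact: Ck_cst.
apply: (@eq_Ck _ _ _ _ _ (fun x => (Num.sqrt (f x))^-1 * ((Num.sqrt (f x))^-1 * (Num.sqrt (f x))^-1) : R^o)) => //.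
by do 2 (apply: CkM => //).
Qed.

Lemma smoothV (V : normedModType R) U (f : V -> R^o) : open U ->
  smooth U f -> (forall x, U x -> 0 < f x) -> smooth U (fun x => (f x)^-1 : R^o).
Proof.
move=> oU Hf f0; have Hs := smooth_invsqrt oU Hf f0.
apply: (eq_smooth oU _ (smoothM oU Hs Hs)) => x Ux.
by rewrite -invfM -expr2 sqr_sqrtr// ltW// f0.
Qed.

Lemma is_derive_line (V W : normedModType R) (f : V -> W) y v (s : R^o) :
  differentiable f (y + s *: v) ->
  is_derive s (1 : R^o) (fun s : R^o => f (y + s *: v)) ('D_v f (y + s *: v)).
Proof.
move=> df.
have Hl : is_diff s (fun s : R^o => y + s *: v) (0 + ( *:%R ^~ v)).
  have H0 := is_diff_cst y s; have H1 := is_diff_scalel s v.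
  exact: (is_diffD H0 H1).
have dl := @ex_diff _ _ _ _ _ _ _ Hl.
split; first by apply: diff_derivable; exact: (differentiable_comp dl df).
rewrite (derive_comp (1 : R^o) dl df) (deriveE _ dl) (@diff_val _ _ _ _ _ _ _ Hl).
by congr ('D_ _ f _); rewrite /= add0r scale1r.
Qed.

End SmoothTheory.

Section Schwarz.
Context {R : realType}.
Variables (V : normedModType R).

Lemma ler_dist_common_value (e a b a' b' : R) :
  `|a - a'| < e / 2 -> `|b - b'| < e / 2 -> b' = a' -> `|a - b| <= e.
Proof.
move=> Ha Hb Eb; rewrite -(subrKA a') (le_trans (ler_normD _ _))//.
by rewrite (splitr e) lerD//; [exact: ltW|rewrite -Eb distrC; exact: ltW].
Qed.

Lemma MVT_from0 (f df : R -> R) (h : R) : 0 < h ->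
  (forall s : R, 0 <= s <= h -> is_derive s 1 f (df s)) ->
  exists s : R, 0 <= s <= h /\ f h - f 0 = df s * h.
Proof.
move=> h0 Hf.
have [s sI E] : exists2 s, s \in `]0, h[%R & f h - f 0 = df s * (h - 0).
  apply: MVT => // [s /itvP sI|]; first by apply: Hf; rewrite !sI.
  apply: derivable_within_continuous => s /itvP sI.
  by have [] := Hf s _; rewrite ?sI.
by exists s; rewrite !(itvP sI) E subr0.
Qed.

(** The mean value theorem is applied first in the direction v, to the increment
    of f by h w, and then in the direction w. *)
Lemma second_difference_MVT (f : V -> R^o) (x v w : V) (h : R) : 0 < h ->
  (forall s t : R, 0 <= s <= h -> 0 <= t <= h ->
     differentiable f (x + s *: v + t *: w)) ->
  (forall s t : R, 0 <= s <= h -> 0 <= t <= h ->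
     differentiable ('D_v f) (x + s *: v + t *: w)) ->
  exists s t : R, [/\ 0 <= s <= h, 0 <= t <= h &
    f (x + h *: v + h *: w) - f (x + h *: v) - (f (x + h *: w) - f x) =
    'D_w ('D_v f) (x + s *: v + t *: w) * h * h].
Proof.
move=> h0 df ddf.
have hh : 0 <= h <= h by rewrite lexx ltW.
have zh : (0 : R) <= 0 <= h by rewrite lexx ltW.
have df0 s : 0 <= s <= h -> differentiable f (x + s *: v).
  by move=> sh; have := df s 0 sh zh; rewrite scale0r addr0.
have ddf0 s : 0 <= s <= h -> differentiable ('D_v f) (x + s *: v).
  by move=> sh; have := ddf s 0 sh zh; rewrite scale0r addr0.
pose ph (s : R) : R := f (x + s *: v + h *: w) - f (x + s *: v).
have dph (s : R) : 0 <= s <= h -> is_derive s 1 ph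
    ('D_v f (x + s *: v + h *: w) - 'D_v f (x + s *: v)).
  move=> sh; have d1 := is_derive_line (df0 s sh).
  have E : x + h *: w + s *: v = x + s *: v + h *: w by rewrite addrAC.
  have d2' : differentiable f (x + h *: w + s *: v) by rewrite E; exact: df.
  have d2 := is_derive_line d2'.
  rewrite E in d2.
  have -> : ph = (fun s : R^o => f (x + h *: w + s *: v)) - (fun s => f (x + s *: v)).
    by apply/funext => z; rewrite /ph /= addrAC.
  exact: is_deriveB.
have [s [sh Es]] := MVT_from0 h0 dph.
pose ps (t : R) : R := 'D_v f (x + s *: v + t *: w).
have dps (t : R) : 0 <= t <= h -> is_derive t 1 ps ('D_w ('D_v f) (x + s *: v + t *: w)).
  by move=> th; apply: is_derive_line; exact: ddf.
have [t [th Et]] := MVT_from0 h0 dps.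
exists s, t; split => //; move: Es Et; rewrite /ph /ps !scale0r !addr0 => -> ->.
by [].
Qed.

(** Schwarz's theorem: the second difference quotient along the parallelogram
    spanned by h v and h w is a value of each of the two mixed derivatives. *)
Lemma derive_swap_scalar (U : set V) (f : V -> R^o) x v w : open U -> smooth U f -> U x ->
  'D_v ('D_w f) x = 'D_w ('D_v f) x.
Proof.
move=> oU Hf Ux.
have cA : {for x, continuous ('D_v ('D_w f))}.
  by apply: smooth_continuous Ux; do 2 apply: smooth_derive.
have cB : {for x, continuous ('D_w ('D_v f))}.
  by apply: smooth_continuous Ux; do 2 apply: smooth_derive.
apply/eqP; rewrite -subr_eq0 -normr_le0; apply/ler_addgt0Pl => e e0; rewrite addr0.
have e20 : 0 < e / 2 by rewrite divr_gt0.
have : \forall y \near x, [/\ U y, `|'D_v ('D_w f) x - 'D_v ('D_w f) y| < e / 2 &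
    `|'D_w ('D_v f) x - 'D_w ('D_v f) y| < e / 2].
  have nU : nbhs x U := open_nbhs_nbhs (conj oU Ux).
  have nA : nbhs x [set y | `|'D_v ('D_w f) x - 'D_v ('D_w f) y| < e / 2].
    exact: (cvgrPdist_lt _ _).1 cA _ e20.
  have nB : nbhs x [set y | `|'D_w ('D_v f) x - 'D_w ('D_v f) y| < e / 2].
    exact: (cvgrPdist_lt _ _).1 cB _ e20.
  have := @filterI _ _ (nbhs_filter x) _ _ nU (@filterI _ _ (nbhs_filter x) _ _ nA nB).
  apply: (@filterS _ _ (nbhs_filter x)) => y [Uy [Ay By]].
  exact: (And3 Uy Ay By).
move=> /nbhs_ballP [d /= d0 Hd].
(* Small enough for the parallelogram spanned by h v and h w to lie in the ball. *)
pose h := d / 2 / (`|v| + `|w| + 1).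
have p0 : 0 < `|v| + `|w| + 1 by rewrite ltr_wpDl// addr_ge0.
have h0 : 0 < h by rewrite /h !divr_gt0.
have Hin (s t : R) : 0 <= s <= h -> 0 <= t <= h -> ball x d (x + s *: v + t *: w).
  move=> /andP[s0 sh] /andP[t0 th]; rewrite -ball_normE /ball_ /= -addrA opprD addNKr normrN.
  apply: (le_lt_trans (ler_normD _ _)); rewrite !normrZ !ger0_norm//.
  have L : s * `|v| + t * `|w| <= h * (`|v| + `|w| + 1).
    rewrite !mulrDr mulr1 -[X in X <= _]addr0; apply: lerD; last exact: ltW.
    by apply: lerD; apply: ler_wpM2r.
  apply: (le_lt_trans L); rewrite /h divfK ?gt_eqF//.
  by rewrite ltr_pdivrMr// mulr_natr mulr2n ltrDl.
have Hin' (s t : R) : 0 <= s <= h -> 0 <= t <= h -> ball x d (x + s *: w + t *: v).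
  by move=> sh th; rewrite addrAC; exact: Hin.
have smD (y : V) : ball x d y -> forall u, differentiable f y /\ differentiable ('D_u f) y.
  move=> /Hd [Uy _ _] u; split; first exact: smooth_differentiable Hf Uy.
  exact: smooth_differentiable (smooth_derive _ Hf) Uy.
have [s [t [sh th E1]]] := second_difference_MVT h0
  (fun s t sh th => (smD _ (Hin s t sh th) v).1) (fun s t sh th => (smD _ (Hin s t sh th) v).2).
have [s' [t' [sh' th' E2]]] := second_difference_MVT h0
  (fun s t sh th => (smD _ (Hin' s t sh th) w).1) (fun s t sh th => (smD _ (Hin' s t sh th) w).2).
have aux (a b : R) :
    f (x + h *: v + h *: w) - f (x + h *: v) - (f (x + h *: w) - f x) = a * h * h ->
    f (x + h *: w + h *: v) - f (x + h *: w) - (f (x + h *: v) - f x) = b * h * h ->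
    a = b.
  have hn : h != 0 by rewrite gt_eqF.
  move=> Ea Eb; apply: (mulIf hn); apply: (mulIf hn); rewrite -Ea -Eb [x + h *: w + h *: v]addrAC; ring.
have E := aux _ _ E1 E2.
have [_ _ B2] := Hd _ (Hin _ _ sh th).
have [_ B1 _] := Hd _ (Hin' _ _ sh' th').
exact: ler_dist_common_value B1 B2 E.
Qed.

Lemma derive_swap p q (U : set V) (f : V -> 'M[R]_(p, q)) x v w :
  open U -> smooth U f -> U x -> 'D_v ('D_w f) x = 'D_w ('D_v f) x.
Proof.
move=> oU Hf Ux; apply/matrixP => i j.
have df y u : U y -> 'D_u f y i j = 'D_u (fun z => f z i j : R^o) y.
  by move=> Uy; rewrite derive_coord//; exact: smooth_differentiable Hf Uy.
have H u u' : 'D_u ('D_u' f) x i j = 'D_u ('D_u' (fun z => f z i j : R^o)) x.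
  rewrite derive_coord; last exact: smooth_differentiable (smooth_derive _ Hf) Ux.
  by apply: eq_derive_open oU Ux _ => y Uy; rewrite df.
apply: (etrans (H v w)); apply: (etrans _ (esym (H w v))).
exact: (@derive_swap_scalar U (fun z => f z i j) x v w oU ((smooth_mxP _ oU).1 Hf i j) Ux).
Qed.

End Schwarz.

Local Opaque derive wdot.

(** * Conformal parametrizations of space forms by flat domains *)

Section ConformalParam.
Context {R : realType}.

Lemma differentiable_scale (V : normedModType R) p q (a : V -> R^o) (F : V -> 'M[R]_(p, q)) x :
  differentiable a x -> differentiable F x -> differentiable (fun y => a y *: F y) x.
Proof.
move=> da /(differentiable_mxP _ _).1 dF; apply/differentiable_mxP => i j.
have -> : (fun y => (a y *: F y) i j : R^o) = a * (fun y => F y i j : R^o).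
  by apply/funext => y; rewrite mxE.
exact: differentiableM (dF i j).
Qed.

Lemma derive_scale (V : normedModType R) p q (a : V -> R^o) (F : V -> 'M[R]_(p, q)) x v :
  differentiable a x -> differentiable F x ->
  'D_v (fun y => a y *: F y) x = 'D_v a x *: F x + a x *: 'D_v F x.
Proof.
move=> da dF; have dF' := (differentiable_mxP _ _).1 dF.
have E i j : (fun y => (a y *: F y) i j : R^o) = a * (fun y => F y i j : R^o).
  by apply/funext => y; rewrite mxE.
have daF := differentiable_scale da dF.
apply/matrixP => i j; rewrite derive_coord// E deriveM; try exact: diff_derivable.
by rewrite !mxE -derive_coord// addrC; congr (_ + _); rewrite /GRing.scale /= mulrC.
Qed.

Lemma koszul_combination (k a b d p q r al be ga : R) :
  k * (a + b) = - 2 * p * al -> k * (a + d) = - 2 * q * be ->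
  k * (b + d) = - 2 * r * ga -> k * a = r * ga - p * al - q * be.
Proof.
move=> E1 E2 E3; have : k * (a + b) + k * (a + d) - k * (b + d) = 2 * (k * a) by ring.
by rewrite E1 E2 E3 => E; apply: (@mulfI _ 2); rewrite ?pnatr_eq0// -E; ring.
Qed.

Lemma wdot_lin3 q (om : 'I_q -> R) a1 a2 a3 u1 u2 u3 z :
  wdot om (a1 *: u1 + a2 *: u2 + a3 *: u3) z =
  a1 * wdot om u1 z + a2 * wdot om u2 z + a3 * wdot om u3 z.
Proof. by rewrite !wdotDl !wdotZl. Qed.

Lemma derive_mulr (V : normedModType R) (a b : V -> R^o) x v :
  differentiable a x -> differentiable b x ->
  'D_v (fun y => a y * b y : R^o) x = 'D_v a x * b x + a x * 'D_v b x.
Proof.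
move=> da db; have -> : (fun y => a y * b y : R^o) = a * b by [].
rewrite deriveM; try exact: diff_derivable.
by rewrite addrC; congr (_ + _); rewrite /GRing.scale /= mulrC.
Qed.

Lemma derive_add (V W : normedModType R) (a b : V -> W) x v :
  differentiable a x -> differentiable b x ->
  'D_v (fun y => a y + b y) x = 'D_v a x + 'D_v b x.
Proof. by move=> da db; apply: deriveD; exact: diff_derivable. Qed.

Lemma derive_zero_open (V W : normedModType R) (U : set V) (a : W) (f : V -> W) x v :
  open U -> U x -> (forall y, U y -> f y = a) -> 'D_v f x = 0.
Proof.
by move=> oU Ux H; rewrite (eq_derive_open v oU Ux H); exact: derive_cst.
Qed.

Lemma derive_inv (V : normedModType R) (f : V -> R^o) x v :
  differentiable f x -> f x != 0 ->
  'D_v (fun y => (f y)^-1 : R^o) x = - 'D_v f x * (f x) ^- 2.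
Proof.
move=> df f0; rewrite deriveV//; last exact: diff_derivable.
by rewrite /GRing.scale /= mulrC mulrN mulNr.
Qed.

Section Frame.
Variables (m : nat) (om : 'I_m.+1 -> R).

(** An orthogonal frame of non-null vectors is a basis, whatever the signature:
    its Gram matrix is diagonal and invertible. *)
Lemma orthogonal_frame_nondegenerate (b : 'I_m -> 'rV[R]_m.+1) (N u : 'rV[R]_m.+1)
    (rho nu : R) :
  (forall j, om j != 0) -> rho != 0 -> nu != 0 ->
  (forall i j, wdot om (b i) (b j) = rho *+ (i == j)) ->
  (forall i, wdot om (b i) N = 0) -> wdot om N N = nu ->
  (forall i, wdot om u (b i) = 0) -> wdot om u N = 0 -> u = 0.
Proof.
move=> om0 rho0 nu0 bb bN NN ub uN.
pose r (i : 'I_m.+1) := oapp b N (unlift ord0 i).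
pose B := \matrix_(i, j) r i ord0 j.
pose J := diag_mx (\row_j om j).
have pair p (A : 'M[R]_(p, m.+1)) i j : (A *m J *m B^T) i j = wdot om (row i A) (r j).
  rewrite mxE wdotE; apply: eq_bigr => l _; rewrite mul_mx_diag !mxE; ring.
have rB i : row i B = r i by apply/rowP => j; rewrite !mxE.
pose d := \row_i (if i == ord0 then nu else rho) : 'rV[R]_m.+1.
have G : B *m J *m B^T = diag_mx d.
  apply/matrixP => i j; rewrite pair rB !mxE /r.
  case: (unliftP ord0 i) => [i' ->|->]; case: (unliftP ord0 j) => [j' ->|->] /=.
  - by rewrite bb (inj_eq lift_inj).
  - by rewrite bN.
  - by rewrite wdotC bN.
  - by rewrite NN.
have uG : B *m J *m B^T \in unitmx.
  rewrite G unitmxE det_diag unitfE; apply/prodf_neq0 => i _; rewrite !mxE.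
  by case: ifP.
have u0 : u *m (J *m B^T) = 0.
  apply/rowP => j; rewrite mulmxA -[u]/(u) pair mxE.
  have -> : row ord0 u = u by apply/rowP => l; rewrite mxE.
  by rewrite /r; case: (unliftP ord0 j) => [j' _|_] /=.
have uJB : J *m B^T \in unitmx by move: uG; rewrite -mulmxA unitmx_mul => /andP[].
by rewrite -(mulmxK uJB u) u0 mul0mx.
Qed.

End Frame.

Section Normal.
Variables (m : nat) (c : R).
Local Notation om := (ambient_weight c (m := m)).

Lemma ambient_weight_neq0 j : om j != 0.
Proof. by rewrite /ambient_weight; case: ifP => _; rewrite ?oppr_eq0 oner_neq0. Qed.

(** Normal to the space form in the ambient space; in the flat case the position
    vector is not, hence the case distinction. *)
Definition position_normal (y : 'rV[R]_m.+1) : 'rV[R]_m.+1 :=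
  if c == 0 then delta_mx ord0 ord0 else y.

Lemma space_form_tangentE y v :
  space_form_tangent c y v <-> wdot om v (position_normal y) = 0.
Proof.
rewrite /space_form_tangent /position_normal /=; case: eqP => [->|_].
  by rewrite wdot_delta /ambient_weight ltxx mul1r.
by rewrite ambient_formE.
Qed.

Lemma position_normal_norm y : space_form c y ->
  wdot om (position_normal y) (position_normal y) != 0.
Proof.
rewrite /space_form /position_normal /=; case: eqP => [->|/eqP c0].
  by rewrite wdot_delta /ambient_weight ltxx mxE !eqxx mul1r oner_neq0.
by rewrite ambient_formE => -[-> _]; rewrite invr_neq0.
Qed.

End Normal.

(** The metric induced by h is tau^-2 |dx|^2; using tau instead of tau^-2 makes
    the second derivatives of tau the obstruction met below. *)
Record conformal_param m (c : R) (U : set 'rV[R]_m) (h : 'rV[R]_m -> 'rV[R]_m.+1)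
    (tau : 'rV[R]_m -> R^o) : Prop := ConformalParam {
  cp_open : open U;
  cp_smooth : smooth U h;
  cp_tau_smooth : smooth U tau;
  cp_tau_gt0 : forall x, U x -> 0 < tau x;
  cp_space_form : forall x, U x -> space_form c (h x);
  cp_conformal : forall x v w, U x ->
    tau x ^+ 2 * wdot (ambient_weight c (m := m)) ('D_v h x) ('D_w h x) = dot v w }.

Section Theory.
Variables (m : nat) (c : R) (U : set 'rV[R]_m) (h : 'rV[R]_m -> 'rV[R]_m.+1)
  (tau : 'rV[R]_m -> R^o).
Hypothesis cp : conformal_param c U h tau.

Local Notation om := (ambient_weight c (m := m)).
Local Notation "<< u , v >>" := (wdot om u v).
Local Notation N := (position_normal c).

Let oU := cp_open cp.
Let dh x (Ux : U x) : differentiable h x := smooth_differentiable (cp_smooth cp) Ux.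
Let ddh x v (Ux : U x) : differentiable ('D_v h) x :=
  smooth_differentiable (smooth_derive v (cp_smooth cp)) Ux.
Let dt x (Ux : U x) : differentiable tau x := smooth_differentiable (cp_tau_smooth cp) Ux.

Lemma cp_tau_neq0 x : U x -> tau x != 0.
Proof. by move=> /(cp_tau_gt0 cp); rewrite lt_def => /andP[]. Qed.

Lemma cp_dot x v w : U x -> << 'D_v h x, 'D_w h x >> = (tau x) ^- 2 * dot v w.
Proof.
by move=> Ux; rewrite -(cp_conformal cp v w Ux) mulKf// expf_neq0// cp_tau_neq0.
Qed.

Lemma cp_normal x v : U x -> << 'D_v h x, N (h x) >> = 0.
Proof.
move=> Ux; rewrite /position_normal; have [c0|c0] := eqVneq c 0.
  rewrite wdot_delta derive_coord; last exact: dh.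
  rewrite (derive_zero_open (U := U) (a := 0)) ?mulr0//.
  by move=> y /(cp_space_form cp); rewrite /space_form /= c0 eqxx.
have := derive_wdot om v (dh Ux) (dh Ux).
rewrite (derive_zero_open (U := U) (a := c^-1))//; last first.
  by move=> y /(cp_space_form cp); rewrite /space_form /= (negPf c0) ambient_formE => -[].
rewrite [X in _ + X]wdotC => /esym/eqP; rewrite -mulr2n mulrn_eq0 /= => /eqP.
exact.
Qed.

(** The derivatives of h in the coordinate directions and the normal to the space
    form are an orthogonal frame of the ambient space. *)
Lemma cp_nondegenerate x u : U x -> << u, N (h x) >> = 0 ->
  (forall z, << u, 'D_z h x >> = 0) -> u = 0.
Proof.
move=> Ux uN uh.
apply: (@orthogonal_frame_nondegenerate m om (fun i => 'D_(delta_mx ord0 i) h x) (N (h x))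
  u (tau x ^- 2) << N (h x), N (h x) >>) => //.
- exact: ambient_weight_neq0.
- by rewrite invr_neq0// expf_neq0// cp_tau_neq0.
- exact/position_normal_norm/(cp_space_form cp).
- move=> i j; rewrite cp_dot// /dot wdot_delta mul1r mxE eqxx /= eq_sym.
  by case: (i == j); rewrite ?mulr1 ?mulr0.
- by move=> i; exact: cp_normal.
Qed.

(** The derivative of the relation that defines the conformal factor. *)
Lemma cp_dconformal x u v w : U x ->
  tau x ^+ 3 * (<< 'D_u ('D_v h) x, 'D_w h x >> + << 'D_v h x, 'D_u ('D_w h) x >>) =
  - 2 * 'D_u tau x * dot v w.
Proof.
move=> Ux.
have E : 'D_u (fun y => tau y * tau y * << 'D_v h y, 'D_w h y >> : R^o) x = 0.
  apply: (derive_zero_open u oU Ux (a := dot v w)) => y Uy.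
  by rewrite -expr2; exact: (cp_conformal cp v w Uy).
have dd : differentiable (fun y => << 'D_v h y, 'D_w h y >> : R^o) x.
  by apply: differentiable_wdot; exact: ddh.
have dtt : differentiable (fun y => tau y * tau y : R^o) x.
  exact: (differentiableM (dt Ux) (dt Ux)).
move: E; rewrite (derive_mulr u dtt dd) (derive_mulr u (dt Ux) (dt Ux)).
rewrite (derive_wdot om u (ddh v Ux) (ddh w Ux)) cp_dot//.
have t0 := cp_tau_neq0 Ux.
move: (wdot _ _ _) (wdot _ _ _) ('D_u tau x) => a b d E.
have -> : - 2 * d * dot v w = tau x ^+ 3 * (a + b) - tau x *
   ((d * tau x + tau x * d) * (tau x ^- 2 * dot v w) + tau x * tau x * (a + b)).
  by field.
by rewrite [a + b]addrC E mulr0 subr0.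
Qed.

(** The Koszul formula for the conformally flat metric tau^-2 |dx|^2: as second
    derivatives commute, the derivatives of the three products of first
    derivatives of h determine the products of its second derivatives with its
    first ones. *)
Lemma cp_koszul x v w z : U x ->
  tau x ^+ 3 * << 'D_v ('D_w h) x, 'D_z h x >> =
  'D_z tau x * dot v w - 'D_v tau x * dot w z - 'D_w tau x * dot v z.
Proof.
move=> Ux.
have E1 := cp_dconformal v w z Ux.
have E2 := cp_dconformal w v z Ux.
have E3 := cp_dconformal z v w Ux.
have S1 := derive_swap w v oU (cp_smooth cp) Ux.
have S2 := derive_swap z v oU (cp_smooth cp) Ux.
have S3 := derive_swap z w oU (cp_smooth cp) Ux.
rewrite S1 in E2; rewrite S2 in E3; rewrite S3 in E3.
rewrite [<< 'D_v ('D_z h) x, _ >>]wdotC in E3.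
exact: koszul_combination E1 E2 E3.
Qed.

Lemma cp_second_normal x v w : U x -> dot v w = 0 ->
  << 'D_v ('D_w h) x, N (h x) >> = 0.
Proof.
move=> Ux vw; have E y : U y -> << 'D_w h y, N (h y) >> = 0 by exact: cp_normal.
have := derive_zero_open v oU Ux (a := 0 : R^o) E.
rewrite /position_normal; case: eqP => _.
  move: (delta_mx ord0 ord0) => e.
  by rewrite (derive_wdot om v (ddh w Ux) (differentiable_cst e x)) derive_cst wdot0r addr0.
rewrite (derive_wdot om v (ddh w Ux) (dh Ux)) cp_dot//.
by rewrite [dot w v]wdotC -/(dot v w) vw mulr0 addr0.
Qed.

Lemma second_orthogonal_combination (t a p q r al be ga : R) : t != 0 -> ga = 0 ->
  t ^+ 3 * a = r * ga - p * al - q * be ->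
  t * a + q * (t ^- 2 * be) + p * (t ^- 2 * al) = 0.
Proof.
move=> t0 -> E; apply: (mulfI (expf_neq0 2 t0)); rewrite mulr0.
have -> : t ^+ 2 * (t * a + q * (t ^- 2 * be) + p * (t ^- 2 * al)) =
  t ^+ 3 * a + q * be + p * al by field.
rewrite E; ring.
Qed.

(** For orthogonal v and w this says that (tau h)_vw = tau_vw h.  By the Koszul
    formula the left-hand side has no tangential component; it has no normal one
    either as the second derivative of h in orthogonal directions is tangent. *)
Lemma cp_second_orthogonal x v w : U x -> dot v w = 0 ->
  tau x *: 'D_v ('D_w h) x + 'D_w tau x *: 'D_v h x + 'D_v tau x *: 'D_w h x = 0.
Proof.
move=> Ux vw; apply: (cp_nondegenerate Ux) => [|z]; rewrite wdot_lin3.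
  rewrite (cp_second_normal Ux vw) (cp_normal v Ux) (cp_normal w Ux).
  by rewrite !mulr0 !addr0.
rewrite (cp_dot v z Ux) (cp_dot w z Ux).
exact: second_orthogonal_combination (cp_tau_neq0 Ux) vw (cp_koszul v w z Ux).
Qed.

End Theory.
End ConformalParam.

Section Liouville.
Context {R : realType}.

Lemma exists_orthogonal m (v w : 'rV[R]_m) : (3 <= m)%N ->
  exists z : 'rV[R]_m, [/\ z != 0, dot z v = 0 & dot z w = 0].
Proof.
move=> m3; pose A := row_mx v^T w^T.
have kn : kermx A != 0.
  rewrite -mxrank_eq0 mxrank_ker subn_eq0 -ltnNge.
  by apply: leq_ltn_trans (rank_leq_col A) _.
pose z := nz_row (kermx A); have zA : z *m A = 0 by apply/sub_kermxP/nz_row_sub.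
have dotE (u : 'rV[R]_m) : dot z u = (z *m u^T) ord0 ord0.
  by rewrite mxE /dot wdotE; apply: eq_bigr => j _; rewrite mul1r !mxE.
rewrite mul_mx_row -[RHS]row_mx0 in zA; have [zv zw] := eq_row_mx zA.
by exists z; split; rewrite ?nz_row_eq0// dotE ?zv ?zw mxE.
Qed.

Lemma third_derivative_combination q (a b d s t p r : R) (X Y Z W hv hw hz : 'rV[R]_q) :
  (a *: X + t *: Y) + (s *: hv + b *: Z) + (p *: hw + d *: W) = 0 ->
  (b *: Z + t *: Y) + (s *: hv + a *: X) + (r *: hz + d *: W) = 0 ->
  p *: hw = r *: hz.
Proof.
move=> E1 E2; apply/eqP; rewrite -subr_eq0; apply/eqP.
have <- : a *: X + t *: Y + (s *: hv + b *: Z) + (p *: hw + d *: W) -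
          (b *: Z + t *: Y + (s *: hv + a *: X) + (r *: hz + d *: W)) = p *: hw - r *: hz.
  by apply/rowP => j; rewrite !mxE; ring.
by rewrite E1 E2 subr0.
Qed.

Lemma parallel_orthogonal q (om : 'I_q -> R) p r u v :
  p *: u = r *: v -> wdot om u v = 0 -> wdot om v v != 0 -> r = 0.
Proof.
move=> /(congr1 (fun y => wdot om y v)); rewrite !wdotZl => E uv vv.
by apply/eqP; move/esym/eqP: E; rewrite uv mulr0 mulf_eq0 (negPf vv) orbF.
Qed.

Variables (m : nat) (c : R) (U : set 'rV[R]_m) (h : 'rV[R]_m -> 'rV[R]_m.+1)
  (tau : 'rV[R]_m -> R^o).
Hypothesis cp : conformal_param c U h tau.
Local Notation om := (ambient_weight c (m := m)).

Lemma cp_immersion x z : U x -> z != 0 -> wdot om ('D_z h x) ('D_z h x) != 0.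
Proof.
move=> Ux z0; rewrite (cp_dot cp z z Ux); apply: mulf_neq0; last by rewrite dot_eq0.
by rewrite invr_neq0// expf_neq0// (cp_tau_neq0 cp Ux).
Qed.

Lemma cp_third x v w z : U x -> dot v w = 0 ->
  ('D_z tau x *: 'D_v ('D_w h) x + tau x *: 'D_z ('D_v ('D_w h)) x) +
  ('D_z ('D_w tau) x *: 'D_v h x + 'D_w tau x *: 'D_z ('D_v h) x) +
  ('D_z ('D_v tau) x *: 'D_w h x + 'D_v tau x *: 'D_z ('D_w h) x) = 0.
Proof.
move=> Ux vw; have E y : U y -> _ := fun Uy => cp_second_orthogonal cp Uy vw.
have sh := cp_smooth cp; have st := cp_tau_smooth cp.
have dh u := smooth_differentiable (smooth_derive u sh) Ux.
have dhh u u' := smooth_differentiable (smooth_derive u (smooth_derive u' sh)) Ux.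
have dt := smooth_differentiable st Ux.
have dtt u := smooth_differentiable (smooth_derive u st) Ux.
have d1 := differentiable_scale dt (dhh v w).
have d2 := differentiable_scale (dtt w) (dh v).
have d3 := differentiable_scale (dtt v) (dh w).
have := derive_zero_open z (cp_open cp) Ux E.
rewrite (derive_add z (differentiableD d1 d2) d3) (derive_add z d1 d2).
rewrite [X in X + _ + _](derive_scale z dt (dhh v w)).
rewrite [X in _ + X + _](derive_scale z (dtt w) (dh v)).
by rewrite [X in _ + _ + X](derive_scale z (dtt v) (dh w)) => ->.
Qed.

(** Liouville: for h conformal in dimension at least 3, the Hessian of tau is a
    multiple of the identity.  Indeed (tau h)_vw = tau_vw h for orthogonal v and
    w by cp_second_orthogonal; differentiating in a third orthogonal direction z
    and exchanging w and z gives tau_vz h_w = tau_vw h_z, although h_w and h_z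
    are independent. *)
Lemma cp_liouville x v w : (3 <= m)%N -> U x -> dot v w = 0 ->
  'D_w ('D_v tau) x = 0.
Proof.
move=> m3 Ux vw; have [z [z0 zv zw]] := exists_orthogonal v w m3.
have sh := cp_smooth cp; have st := cp_tau_smooth cp; have oU := cp_open cp.
have vz : dot v z = 0 by rewrite /dot wdotC.
(* Both relations contain the same third derivative of h. *)
have E1 := cp_third z Ux vw; have E2 := cp_third w Ux vz.
rewrite (derive_swap_scalar z w oU st Ux) in E1.
rewrite (derive_swap w v oU sh Ux) in E2.
rewrite (derive_swap v z oU sh Ux) in E2.
rewrite (derive_swap w z oU sh Ux) in E2.
have S : 'D_w ('D_v ('D_z h)) x = 'D_z ('D_v ('D_w h)) x.
  have S1 : 'D_w ('D_v ('D_z h)) x = 'D_w ('D_z ('D_v h)) x.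
    by apply: (eq_derive_open _ oU Ux) => y Uy; exact: (derive_swap _ _ oU sh Uy).
  have S2 : 'D_z ('D_v ('D_w h)) x = 'D_z ('D_w ('D_v h)) x.
    by apply: (eq_derive_open _ oU Ux) => y Uy; exact: (derive_swap _ _ oU sh Uy).
  exact: (etrans S1 (etrans (derive_swap w z oU (smooth_derive v sh) Ux) (esym S2))).
rewrite S in E2.
have H1 : wdot om ('D_w h x) ('D_z h x) = 0.
  by rewrite (cp_dot cp w z Ux) /dot wdotC -/(dot z w) zw mulr0.
exact: parallel_orthogonal (third_derivative_combination E1 E2) H1 (cp_immersion Ux z0).
Qed.

End Liouville.

(** * Stereographic projection *)

Section Stereographic.
Context {R : realType}.

Section Embedding.
Variable m : nat.

Definition embed_tail (x : 'rV[R]_m) : 'rV[R]_m.+1 :=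
  \row_j oapp (fun i => x ord0 i) 0 (unlift ord0 j).
Definition tail (y : 'rV[R]_m.+1) : 'rV[R]_m := \row_j y ord0 (lift ord0 j).
Local Notation e0 := (delta_mx ord0 ord0 : 'rV[R]_m.+1).

Lemma embed_tail0 x : embed_tail x ord0 ord0 = 0.
Proof. by rewrite mxE unlift_none. Qed.

Lemma embed_tail_lift x j : embed_tail x ord0 (lift ord0 j) = x ord0 j.
Proof. by rewrite mxE liftK. Qed.

Lemma row_head_tail (y : 'rV[R]_m.+1) :
  y = y ord0 ord0 *: e0 + embed_tail (tail y).
Proof.
apply/rowP => j; case: (unliftP ord0 j) => [i ->|->]; rewrite !mxE.
  by rewrite liftK andbF mulr0 add0r /= /tail mxE (ord1 0).
by rewrite unlift_none !eqxx mulr1 addr0 (ord1 0).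
Qed.

Lemma smooth_coord (U : set 'rV[R]_m) j : open U ->
  smooth U (fun x : 'rV[R]_m => x ord0 j : R^o).
Proof. by move=> oU; exact: (smooth_mxP _ oU).1 (smooth_id U) ord0 j. Qed.

Lemma smooth_embed_tail (U : set 'rV[R]_m) : open U -> smooth U embed_tail.
Proof.
move=> oU; apply/smooth_mxP => // i j; have -> : i = ord0 by exact: ord1.
case: (unliftP ord0 j) => [l ->|->].
  apply: (eq_smooth oU _ (smooth_coord l oU)) => x _.
  by rewrite embed_tail_lift.
by apply: (eq_smooth oU _ (smooth_cst U (0 : R^o))) => x _; rewrite embed_tail0.
Qed.

Lemma derive_embed_tail x v : 'D_v embed_tail x = embed_tail v.
Proof.
have dE := smooth_differentiable (smooth_embed_tail (openT)) (I : setT x).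
apply/rowP => j; rewrite (derive_coord _ _ _ dE).
case: (unliftP ord0 j) => [l ->|->].
  have -> : (fun y => embed_tail y ord0 (lift ord0 l) : R^o) =
            (fun y : 'rV[R]_m => y ord0 l).
    by apply/funext => y; rewrite embed_tail_lift.
  rewrite -(derive_coord v ord0 l (smooth_differentiable (smooth_id setT) (I : setT x))).
  by rewrite derive_id embed_tail_lift.
have -> : (fun y => embed_tail y ord0 ord0 : R^o) = cst 0.
  by apply/funext => y; rewrite embed_tail0.
by rewrite derive_cst embed_tail0.
Qed.

Lemma wdot_e0_e0 (om : 'I_m.+1 -> R) : wdot om e0 e0 = om ord0.
Proof. by rewrite wdot_delta mxE !eqxx mulr1. Qed.

Lemma wdot_embed_e0 (om : 'I_m.+1 -> R) x : wdot om (embed_tail x) e0 = 0.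
Proof. by rewrite wdot_delta embed_tail0 mulr0. Qed.

Lemma wdot_embed c x y :
  wdot (ambient_weight c (m := m)) (embed_tail x) (embed_tail y) = dot x y.
Proof.
rewrite /dot !wdotE big_ord_recl embed_tail0 mulr0 mul0r add0r.
by apply: eq_bigr => j _; rewrite /ambient_weight /= andbF !embed_tail_lift.
Qed.

End Embedding.

Section Projection.
Variables (m : nat) (c : R).
Local Notation om := (ambient_weight c (m := m)).
Local Notation e0 := (delta_mx ord0 ord0 : 'rV[R]_m.+1).

(** The conformal factor of stereographic projection, in the normalization that is
    uniform in the sign of c. *)
Definition stereo_tau (x : 'rV[R]_m) : R^o := 1 + c / 4 * dot x x.
Definition stereo_dom : set 'rV[R]_m := [set x | 0 < stereo_tau x].

(** For c = 0 the radius evaluates to 0, as the inverse of 0 is 0, and stereo is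
   the inclusion of the hyperplane. *)
Definition radius : R := (Num.sqrt `|c|)^-1.

Definition stereo (x : 'rV[R]_m) : 'rV[R]_m.+1 :=
  (radius * (2 * (stereo_tau x)^-1 - 1)) *: e0 + (stereo_tau x)^-1 *: embed_tail x.

Definition stereo_scale (y : 'rV[R]_m.+1) : R :=
  if c == 0 then 1 else 2 * (1 + Num.sqrt `|c| * y ord0 ord0)^-1.
Definition stereo_inv (y : 'rV[R]_m.+1) : 'rV[R]_m := stereo_scale y *: tail y.

Lemma om0_radius : c != 0 -> om ord0 * radius ^+ 2 = c^-1.
Proof.
move=> c0; rewrite /radius exprVn sqr_sqrtr// /ambient_weight eqxx andbT.
case: (ltrgt0P c) => [c1|c1|E]; last by rewrite E eqxx in c0.
- by rewrite mul1r.
- by rewrite mulN1r invrN opprK.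
Qed.

Lemma smooth_stereo_tau (U : set 'rV[R]_m) : open U -> smooth U stereo_tau.
Proof.
move=> oU; apply: smoothD => //; first exact: smooth_cst.
apply: smoothM => //; first exact: smooth_cst.
by apply: smooth_wdot => //; exact: smooth_id.
Qed.

Lemma derive_stereo_tau x v : 'D_v stereo_tau x = c / 2 * dot x v.
Proof.
have di := smooth_differentiable (smooth_id setT) (I : setT x).
have dd : differentiable (fun y => dot y y : R^o) x by exact: differentiable_wdot.
have dc (a : R^o) := differentiable_cst a x.
rewrite (derive_add v (dc 1) (differentiableM (dc (c / 4)) dd)).
rewrite (derive_mulr v (dc (c / 4)) dd) !derive_cst (derive_wdot _ v di di).
rewrite derive_id [wdot _ v x]wdotC mul0r !add0r /cst -/(dot x v).
by move: (dot x v) => d; field.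
Qed.

Lemma open_stereo_dom : open stereo_dom.
Proof.
have ct : continuous stereo_tau.
  by move=> x; apply: (smooth_continuous (smooth_stereo_tau openT) (I : setT x)).
have -> : stereo_dom = stereo_tau @^-1` [set y | 0 < y] by [].
apply: open_comp; first by move=> x _; exact: ct.
exact: open_gt.
Qed.

Lemma smooth_stereo : smooth stereo_dom stereo.
Proof.
have oU := open_stereo_dom.
have st := smooth_stereo_tau oU.
have si : smooth stereo_dom (fun x => (stereo_tau x)^-1 : R^o) by apply: smoothV.
apply: smoothD => //; apply: smoothZ => //; last exact: smooth_embed_tail.
  apply: smoothM => //; first exact: smooth_cst.
  apply: smoothD => //; last exact: smooth_cst.
  by apply: smoothM => //; exact: smooth_cst.
exact: smooth_cst.
Qed.

Lemma derive_stereo x v : stereo_dom x -> 'D_v stereo x =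
  (- (2 * radius * (c / 2 * dot x v) * stereo_tau x ^- 2)) *: e0 +
  ((stereo_tau x)^-1 *: embed_tail v - (c / 2 * dot x v * stereo_tau x ^- 2) *: embed_tail x).
Proof.
move=> Ux; have oU := open_stereo_dom; have st := smooth_stereo_tau oU.
have t0 : stereo_tau x != 0 by rewrite gt_eqF.
have dt := smooth_differentiable st Ux.
have di : differentiable (fun y => (stereo_tau y)^-1 : R^o) x by exact: differentiableV.
have dc (a : R^o) := differentiable_cst a x.
have d2 : differentiable (fun y => 2 * (stereo_tau y)^-1 : R^o) x.
  exact: differentiableM.
have d3 : differentiable (fun y => 2 * (stereo_tau y)^-1 - 1 : R^o) x.
  exact: differentiableD.
have d4 : differentiable (fun y => radius * (2 * (stereo_tau y)^-1 - 1) : R^o) x.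
  exact: differentiableM.
have dE := smooth_differentiable (smooth_embed_tail oU) Ux.
have de : differentiable (fun _ : 'rV[R]_m => e0) x by exact: differentiable_cst.
rewrite (derive_add v (differentiable_scale d4 de) (differentiable_scale di dE)).
rewrite (derive_scale v d4 de) (derive_scale v di dE) derive_embed_tail derive_cst.
rewrite (derive_mulr v (dc radius) d3) (derive_add v d2 (dc (-1))).
rewrite (derive_mulr v (dc 2) di) !derive_cst (derive_inv v dt t0) derive_stereo_tau.
rewrite scaler0 addr0 mul0r add0r mul0r add0r addr0 /cst; congr (_ *: _ + _).
  by ring.
by rewrite addrC mulNr scaleNr.
Qed.

End Projection.
End Stereographic.

Section StereographicGeometry.
Context {R : realType}.
Variables (m : nat) (c : R).
Local Notation om := (ambient_weight c (m := m)).
Local Notation e0 := (delta_mx ord0 ord0 : 'rV[R]_m.+1).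
Local Notation T := (stereo_tau c).
Local Notation U := (stereo_dom (m := m) c).
Local Notation r := (radius c).

Lemma embed_tailZ a (x : 'rV[R]_m) : embed_tail (a *: x) = a *: embed_tail x.
Proof.
by apply/rowP => j; rewrite !mxE; case: (unlift ord0 j) => [i|] /=; rewrite ?mxE ?mulr0.
Qed.

Lemma embed_tailB (x y : 'rV[R]_m) : embed_tail (x - y) = embed_tail x - embed_tail y.
Proof.
by apply/rowP => j; rewrite !mxE; case: (unlift ord0 j) => [i|] /=; rewrite ?mxE ?subr0.
Qed.

Lemma wdot_head_tail a b (x y : 'rV[R]_m) :
  wdot om (a *: e0 + embed_tail x) (b *: e0 + embed_tail y) = om ord0 * a * b + dot x y.
Proof.
rewrite !wdotDl !wdotDr !wdotZl !wdotZr wdot_e0_e0 wdot_embed.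
by rewrite [wdot _ e0 _]wdotC !wdot_embed_e0; ring.
Qed.

Lemma stereo_conformal_algebra (k rr t d e : R) (u v w : R) : t != 0 ->
  d = c / 2 * u -> e = c / 2 * v ->
  (c != 0 -> k * rr ^+ 2 = c^-1) -> (c = 0 -> rr = 0) ->
  forall q, t = 1 + c / 4 * q ->
  t ^+ 2 * (k * - (2 * rr * d * t ^- 2) * - (2 * rr * e * t ^- 2) +
   (t^-1 * (t^-1 * w) - t^-1 * (e * t ^- 2 * u) -
    (d * t ^- 2 * (t^-1 * v) - d * t ^- 2 * (e * t ^- 2 * q)))) = w.
Proof.
move=> t0 dE eE k1 k2 q tE.
have [c0|c0] := eqVneq c 0.
  by rewrite dE eE (k2 c0) c0; field.
have k3 := k1 c0.
have -> : k * - (2 * rr * d * t ^- 2) * - (2 * rr * e * t ^- 2) =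
   4 * (k * rr ^+ 2) * d * e * t ^- 4 by field.
have uE : u = 2 * d / c by rewrite dE; field.
have vE : v = 2 * e / c by rewrite eE; field.
have qE : q = 4 * (t - 1) / c by rewrite tE; field.
by rewrite k3 uE vE qE; field; rewrite t0 c0.
Qed.

Lemma radius0 : c = 0 -> r = 0.
Proof. by move=> c0; rewrite /radius c0 normr0 sqrtr0 invr0. Qed.

Lemma stereo_conformal x v w : U x ->
  T x ^+ 2 * wdot om ('D_v (stereo c) x) ('D_w (stereo c) x) = dot v w.
Proof.
move=> Ux; have t0 : T x != 0 by rewrite gt_eqF.
rewrite (derive_stereo v Ux) (derive_stereo w Ux) -!embed_tailZ -!embed_tailB.
rewrite wdot_head_tail /dot !wdotDl !wdotNl !wdotDr !wdotNr !wdotZl !wdotZr.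
rewrite [wdot _ v x]wdotC -!/(dot _ _).
exact: (@stereo_conformal_algebra (om ord0) r (T x) _ _ (dot x v) (dot x w) (dot v w)
  t0 erefl erefl (@om0_radius R m c) radius0 (dot x x) erefl).
Qed.

Lemma radius_gt0 : c != 0 -> 0 < r.
Proof. by move=> c0; rewrite /radius invr_gt0 sqrtr_gt0 normr_gt0. Qed.

Lemma stereo_head (x : 'rV[R]_m) : stereo c x ord0 ord0 = r * (2 * (T x)^-1 - 1).
Proof. by rewrite /stereo !mxE !eqxx unlift_none mulr1 mulr0 addr0. Qed.

Lemma tail_stereo (x : 'rV[R]_m) : tail (stereo c x) = (T x)^-1 *: x.
Proof.
by apply/rowP => j; rewrite /stereo !mxE liftK /= mulr0 add0r.
Qed.

Lemma stereo_bar (x : 'rV[R]_m) : U x -> bar_space_form c (stereo c x).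
Proof.
move=> Ux; have Tp : 0 < T x := Ux; have t0 : T x != 0 by rewrite gt_eqF.
split.
  rewrite /space_form /=; have [c0|c0] := eqVneq c 0.
    by rewrite stereo_head radius0// mul0r.
  split; last first.
    move=> cn; rewrite stereo_head mulr_gt0 ?radius_gt0// subr_gt0.
    have T1 : T x <= 1.
      by rewrite /stereo_tau gerDl mulr_le0_ge0 ?dot_ge0// pmulr_lle0 ?ltW// invr_gt0.
    by rewrite ltr_pdivlMr// mul1r; lra.
  rewrite ambient_formE /stereo -embed_tailZ wdot_head_tail /dot wdotZl wdotZr -/(dot x x).
  have -> : dot x x = 4 * (T x - 1) / c by rewrite /stereo_tau; field.
  have -> : om ord0 * (r * (2 * (T x)^-1 - 1)) * (r * (2 * (T x)^-1 - 1)) =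
     om ord0 * r ^+ 2 * (2 * (T x)^-1 - 1) ^+ 2 by ring.
  by rewrite om0_radius//; field; rewrite t0 c0.
move=> cp /(congr1 (fun y : 'rV_m.+1 => y ord0 ord0)).
have c0 : c != 0 by rewrite gt_eqF.
rewrite stereo_head /pole !mxE !eqxx mulr1 /radius gtr0_norm//.
have s0 : Num.sqrt c != 0 by rewrite gt_eqF// sqrtr_gt0.
move=> /(congr1 (fun y => Num.sqrt c * y * T x)).
have -> : Num.sqrt c * ((Num.sqrt c)^-1 * (2 * (T x)^-1 - 1)) * T x = 2 - T x.
  by field; rewrite s0 t0.
have -> : Num.sqrt c * - (Num.sqrt c)^-1 * T x = - T x by field.
by move=> /eqP; rewrite addrC -subr_eq0 opprK addrAC addNr add0r pnatr_eq0.
Qed.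

Lemma stereoK (x : 'rV[R]_m) : U x -> stereo_inv c (stereo c x) = x.
Proof.
move=> Ux; have t0 : T x != 0 by rewrite gt_eqF.
rewrite /stereo_inv tail_stereo scalerA; suff -> : stereo_scale c (stereo c x) = T x.
  by rewrite divff// scale1r.
rewrite /stereo_scale; have [c0|c0] := eqVneq c 0.
  by rewrite /stereo_tau c0 mul0r mul0r addr0.
rewrite stereo_head /radius; have s0 : Num.sqrt `|c| != 0.
  by rewrite gt_eqF// sqrtr_gt0 normr_gt0.
by rewrite mulVKf// addrC subrK invfM invrK mulrA divff ?mul1r// pnatr_eq0.
Qed.

Definition stereo_denom (y : 'rV[R]_m.+1) : R^o := 1 + Num.sqrt `|c| * y ord0 ord0.

Lemma dot_tail (y : 'rV[R]_m.+1) : dot (tail y) (tail y) = wdot om y y - om ord0 * y ord0 ord0 ^+ 2.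
Proof.
rewrite [in RHS](row_head_tail y) wdot_head_tail addrAC !mxE !eqxx /=.
by rewrite unlift_none mulr1 addr0; ring.
Qed.

Lemma stereo_denom_gt0 (y : 'rV[R]_m.+1) : bar_space_form c y -> 0 < stereo_denom y.
Proof.
move=> [Sy py]; rewrite /stereo_denom; have [c0|c0] := eqVneq c 0.
  by rewrite c0 normr0 sqrtr0 mul0r addr0.
move: Sy; rewrite /space_form /= (negPf c0) ambient_formE => -[yy y0].
have [cn|cp] := ltP c 0.
  by rewrite addr_gt0// mulr_gt0 ?y0// sqrtr_gt0 normr_gt0.
have {}cp : 0 < c by rewrite lt_def c0.
rewrite (gtr0_norm cp); have s0 : 0 < Num.sqrt c by rewrite sqrtr_gt0.
have dt := dot_tail y; rewrite yy /ambient_weight ltNge (ltW cp) /= mul1r in dt.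
have tge := dot_ge0 (tail y).
have key : (Num.sqrt c * y ord0 ord0) ^+ 2 = 1 - c * dot (tail y) (tail y).
  by rewrite exprMn sqr_sqrtr ?ltW// dt; field.
have ct : 0 <= c * dot (tail y) (tail y) by apply: mulr_ge0 => //; exact: ltW.
have : -1 <= Num.sqrt c * y ord0 ord0.
  have : (Num.sqrt c * y ord0 ord0) ^+ 2 <= 1 by rewrite key gerBl.
  by move: (Num.sqrt c * y ord0 ord0) => b; nra.
rewrite le_eqVlt => /orP[/eqP E|]; last by lra.
(* Equality would force y to be the pole. *)
exfalso; apply: (py cp).
have t0 : tail y = 0.
  apply/eqP; rewrite -dot_eq0; move: key; rewrite -E sqrrN expr1n => /eqP.
  rewrite eq_sym subr_eq -subr_eq0 opprD addrA subrr sub0r oppr_eq0 mulf_eq0 (negPf c0).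
  exact.
rewrite [y]row_head_tail t0 /pole.
have -> : embed_tail (0 : 'rV[R]_m) = 0 by rewrite -(scale0r 0) embed_tailZ scale0r.
rewrite addr0; congr (_ *: _); apply: (mulfI (lt0r_neq0 s0)).
by rewrite -E mulrN mulfV// lt0r_neq0.
Qed.

Lemma stereo_tau_inv (y : 'rV[R]_m.+1) : bar_space_form c y -> T (stereo_inv c y) = stereo_scale c y.
Proof.
move=> By; have D0 := stereo_denom_gt0 By; case: By => Sy _.
rewrite /stereo_tau /stereo_inv /dot wdotZl wdotZr -/(dot (tail y) (tail y)) dot_tail.
rewrite /stereo_scale; have [c0|c0] := eqVneq c 0; first by rewrite c0 !mul0r addr0.
move: Sy; rewrite /space_form /= (negPf c0) ambient_formE => -[-> _].
have E : om ord0 * c = Num.sqrt `|c| ^+ 2.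
  rewrite sqr_sqrtr// /ambient_weight eqxx andbT; case: ltP => [/ltr0_norm ->|/ger0_norm ->].
    by rewrite mulN1r.
  by rewrite mul1r.
move: D0; rewrite /stereo_denom; move: (Num.sqrt _) (y ord0 ord0) E => s y0 E D0.
have Dn : 1 + s * y0 != 0 by rewrite gt_eqF.
set a := _ / (1 + s * y0).
have -> : 1 + c / 4 * (a * (a * (c^-1 - om ord0 * y0 ^+ 2))) =
   1 + a ^+ 2 / 4 * (1 - om ord0 * c * y0 ^+ 2) by field.
by rewrite E /a; field.
Qed.

Lemma stereo_inv_dom (y : 'rV[R]_m.+1) : bar_space_form c y -> U (stereo_inv c y).
Proof.
move=> By; rewrite /stereo_dom /= stereo_tau_inv// /stereo_scale; case: eqP => // _.
by rewrite mulr_gt0// invr_gt0; exact: stereo_denom_gt0.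
Qed.

Lemma stereo_invK (y : 'rV[R]_m.+1) : bar_space_form c y -> stereo c (stereo_inv c y) = y.
Proof.
move=> By; have D0 := stereo_denom_gt0 By.
rewrite /stereo stereo_tau_inv// /stereo_inv embed_tailZ scalerA.
have s0 : stereo_scale c y != 0.
  by rewrite gt_eqF// -stereo_tau_inv//; exact: stereo_inv_dom.
rewrite mulVf// scale1r [RHS]row_head_tail; congr (_ *: _ + _).
rewrite /stereo_scale; case: By => Sy _.
case: eqP => [c0|/eqP c0].
  move: Sy; rewrite /space_form /= c0 eqxx => ->.
  by rewrite -c0 radius0 ?mul0r.
have q0 : Num.sqrt `|c| != 0 by rewrite gt_eqF// sqrtr_gt0 normr_gt0.
move: D0; rewrite /stereo_denom /radius => D0.
by field; rewrite q0 gt_eqF.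
Qed.

Lemma stereo_cp : conformal_param c U (stereo c) T.
Proof.
split=> //.
- exact: open_stereo_dom.
- exact: smooth_stereo.
- exact/smooth_stereo_tau/open_stereo_dom.
- by move=> x /stereo_bar [].
- exact: stereo_conformal.
Qed.

Lemma derive2_stereo_tau (x v w : 'rV[R]_m) : 'D_w ('D_v T) x = c / 2 * dot v w.
Proof.
have -> : 'D_v T = (fun y => c / 2 * wdot (fun=> 1) y v : R^o).
  by apply/funext => y; exact: derive_stereo_tau.
have di := smooth_differentiable (smooth_id setT) (I : setT x).
have dv := differentiable_cst v x.
have dc := differentiable_cst (c / 2 : R^o) x.
have dd : differentiable (fun y => wdot (fun=> 1) y v : R^o) x by exact: differentiable_wdot di dv.
rewrite (derive_mulr w dc dd) derive_cst (derive_wdot _ w di dv) derive_cst derive_id.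
by rewrite mul0r add0r wdot0r addr0 wdotC.
Qed.

(** The inverse projection extends smoothly to a half-space containing the
    space form without its pole. *)
Definition stereo_halfspace : set 'rV[R]_m.+1 := [set y | 0 < stereo_denom y].

Lemma smooth_stereo_denom (W : set 'rV[R]_m.+1) : open W -> smooth W stereo_denom.
Proof.
move=> oW; apply: smoothD => //; first exact: smooth_cst.
by apply: smoothM => //; [exact: smooth_cst|exact: smooth_coord].
Qed.

Lemma open_stereo_halfspace : open stereo_halfspace.
Proof.
have ct : continuous stereo_denom.
  by move=> x; apply: (smooth_continuous (smooth_stereo_denom openT) (I : setT x)).
have -> : stereo_halfspace = stereo_denom @^-1` [set y | 0 < y] by [].
apply: open_comp; first by move=> x _; exact: ct.
exact: open_gt.
Qed.

Lemma smooth_stereo_inv : smooth stereo_halfspace (stereo_inv c).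
Proof.
have oW := open_stereo_halfspace.
apply: smoothZ => //.
  rewrite /stereo_scale; case: eqP => c0; first exact: smooth_cst.
  apply: smoothM => //; first exact: smooth_cst.
  by apply: smoothV => //; exact: smooth_stereo_denom.
apply/smooth_mxP => // i j.
apply: (eq_smooth oW _ (smooth_coord (lift ord0 j) oW)) => x _.
by rewrite mxE.
Qed.

End StereographicGeometry.

(** * The maximum principle *)

Section MaximumPrinciple.
Context {R : realType}.
Variable m : nat.
Local Notation V := 'rV[R]_m.
Local Notation e i := (delta_mx ord0 i : V).

Definition laplacian (f : V -> R^o) (x : V) : R := \sum_i 'D_(e i) ('D_(e i) f) x.

Lemma laplacianD (U : set V) (f g : V -> R^o) x : open U -> smooth U f -> smooth U g ->
  U x -> laplacian (fun y => f y + g y) x = laplacian f x + laplacian g x.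
Proof.
move=> oU sf sg Ux; rewrite -big_split; apply: eq_bigr => i _ /=.
rewrite -(derive_add (e i) (smooth_differentiable (smooth_derive (e i) sf) Ux)
  (smooth_differentiable (smooth_derive (e i) sg) Ux)).
apply: (eq_derive_open _ oU Ux) => y Uy.
exact: derive_add (smooth_differentiable sf Uy) (smooth_differentiable sg Uy).
Qed.

Lemma laplacianZ (U : set V) (a : R) (f : V -> R^o) x : open U -> smooth U f ->
  U x -> laplacian (fun y => a * f y : R^o) x = a * laplacian f x.
Proof.
move=> oU sf Ux.
have D (g : V -> R^o) i y : differentiable g y ->
    'D_(e i) (fun y => a * g y : R^o) y = a * 'D_(e i) g y.
  move=> dg; rewrite (derive_mulr (e i) (differentiable_cst (a : R^o) y) dg) derive_cst.
  by rewrite mul0r add0r.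
rewrite /laplacian mulr_sumr; apply: eq_bigr => i _.
rewrite -D; last exact: smooth_differentiable (smooth_derive (e i) sf) Ux.
apply: (eq_derive_open _ oU Ux) => y Uy; apply: D.
exact: smooth_differentiable sf Uy.
Qed.

Lemma derive_pos_right (ps : R -> R) (d : R) : ps 0 = 0 -> is_derive (0 : R) 1 ps d ->
  0 < d -> exists2 h : R, 0 < h & forall s : R, 0 < s < h -> 0 < ps s.
Proof.
move=> ps0 [dps Dps] d0.
have : (fun h : R => h^-1 *: (ps (h *: 1 + 0) - ps 0)) @ 0^' --> d.
  by rewrite -Dps; exact: dps.
move=> /cvgrPdist_lt /(_ d d0) [r /= r0 Hr].
exists r => // s /andP[s0 sr]; have := Hr s; rewrite /= sub0r normrN gtr0_norm//.
move=> /(_ sr (lt0r_neq0 s0)); rewrite ps0 subr0 addr0 /GRing.scale /= mulr1.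
move=> H; have : 0 < s^-1 * ps s.
  by have := ler_norm (d - s^-1 * ps s); lra.
by rewrite pmulr_rgt0// invr_gt0.
Qed.

(** If the second derivative along a line were positive at a maximum, the first
    one, which vanishes there, would be positive just after it. *)
Lemma second_derivative_max (U : set V) (f : V -> R^o) x v : open U -> smooth U f ->
  U x -> (forall y, U y -> f y <= f x) -> 'D_v ('D_v f) x <= 0.
Proof.
move=> oU sf Ux fx; rewrite leNgt; apply/negP => D0.
have cl : {for (0 : R^o), continuous (fun s : R^o => x + s *: v)}.
  by apply: cvgD; [exact: cvg_cst|exact: (@scalel_continuous _ _ v 0)].
have : nbhs (0 : R^o) (fun s : R^o => U (x + s *: v)).
  by apply: cl; rewrite scale0r addr0; exact: open_nbhs_nbhs.
move=> /nbhs_ballP [r /= r0 Hr].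
have Us (s : R) : - r < s < r -> U (x + s *: v).
  by move=> sr; apply: Hr; rewrite -ball_normE /ball_ /= sub0r normrN ltr_norml.
have r00 : - r < 0 < r by rewrite oppr_lt0 r0.
pose ph (s : R) : R := f (x + s *: v).
pose ps (s : R) : R := 'D_v f (x + s *: v).
have dph (s : R) : - r < s < r -> is_derive s 1 ph (ps s).
  by move=> /Us Uxs; exact: is_derive_line (smooth_differentiable sf Uxs).
have dps : is_derive (0 : R) 1 ps ('D_v ('D_v f) x).
  have E : x + 0 *: v = x by rewrite scale0r addr0.
  have d0 : differentiable ('D_v f) (x + (0 : R^o) *: v).
    by rewrite E; exact: smooth_differentiable (smooth_derive v sf) Ux.
  by have := is_derive_line d0; rewrite E.
have ps0 : ps 0 = 0.
  have : is_derive (0 : R) 1 ph 0.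
    apply: (@derive1_at_max _ _ (- r) r).
    - by rewrite ge0_cp// ltW.
    - by move=> t; rewrite in_itv /= => /dph [].
    - by rewrite in_itv.
    - by move=> t; rewrite in_itv /= => /Us Ut; rewrite /ph scale0r addr0; exact: fx.
  move=> H0; have H1 := dph 0 r00.
  by rewrite -(@derive_val _ _ _ _ _ _ _ H1) (@derive_val _ _ _ _ _ _ _ H0).
have [h h0 Hh] := derive_pos_right ps0 dps D0.
pose t := Num.min (h / 2) (r / 2).
have t0 : 0 < t by rewrite lt_min !divr_gt0.
have th : t < h by rewrite gt_min; apply/orP; left; lra.
have tr : t < r by rewrite gt_min; apply/orP; right; lra.
have [s sI E] : exists2 s, s \in `]0, t[%R & ph t - ph 0 = ps s * (t - 0).
  apply: (MVT t0).
    by move=> s; rewrite in_itv /= => /andP[s0 st]; apply: dph; apply/andP; split; lra.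
  apply: derivable_within_continuous => s; rewrite in_itv /= => /andP[s0 st].
  by have [] := dph s _ => //; apply/andP; split; lra.
move: sI; rewrite in_itv /= => /andP[s0 st].
have pss : 0 < ps s by apply: Hh; rewrite s0 (lt_trans st th).
have : ph t <= ph 0.
  rewrite /ph scale0r addr0; apply/fx/Us; apply/andP; split; lra.
rewrite -subr_le0 E subr0 pmulr_lle0//; lra.
Qed.

Lemma laplacian_max (U : set V) (f : V -> R^o) x : open U -> smooth U f ->
  U x -> (forall y, U y -> f y <= f x) -> laplacian f x <= 0.
Proof.
by move=> oU sf Ux fx; apply: sumr_le0 => i _; exact: second_derivative_max oU sf Ux fx.
Qed.

Lemma derive_ln (W : normedModType R) (f : W -> R^o) x v :
  differentiable f x -> 0 < f x ->
  'D_v (fun x => ln (f x) : R^o) x = 'D_v f x * (f x)^-1.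
Proof.
move=> df f0; have Hl := is_derive1_ln f0.
have dl : differentiable (@ln R : R^o -> R^o) (f x) by apply/derivable1_diffP; case: Hl.
rewrite (derive_comp v df dl) derive_realdir//.
by rewrite [X in _ *: X](@derive_val _ _ _ _ _ _ _ Hl).
Qed.

Lemma differentiable_ln (W : normedModType R) (f : W -> R^o) x :
  differentiable f x -> 0 < f x -> differentiable (fun x => ln (f x) : R^o) x.
Proof.
move=> df f0; have Hl := is_derive1_ln f0.
have dl : differentiable (@ln R : R^o -> R^o) (f x) by apply/derivable1_diffP; case: Hl.
exact: differentiable_comp df dl.
Qed.

Lemma smooth_ln (W : normedModType R) (U : set W) (f : W -> R^o) : open U ->
  smooth U f -> (forall x, U x -> 0 < f x) -> smooth U (fun x => ln (f x) : R^o).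
Proof.
move=> oU sf f0 [|k].
  move=> x Ux; apply: differentiable_continuous.
  exact: differentiable_ln (smooth_differentiable sf Ux) (f0 _ Ux).
split=> [x Ux|v]; first exact: differentiable_ln (smooth_differentiable sf Ux) (f0 _ Ux).
have sD : smooth U (fun x => 'D_v f x * (f x)^-1 : R^o).
  by apply: smoothM => //; [exact: smooth_derive|exact: smoothV].
apply: (eq_Ck oU _ (sD k)) => x Ux.
by rewrite (derive_ln v (smooth_differentiable sf Ux) (f0 _ Ux)).
Qed.

(** In this form it is the Laplacian of f times f minus the squared gradient that
    has to vanish for ln f to be harmonic. *)
Lemma laplacian_ln (U : set V) (f : V -> R^o) x : open U -> smooth U f ->
  (forall x, U x -> 0 < f x) -> U x ->
  laplacian (fun x => ln (f x) : R^o) x =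
  (f x * laplacian f x - \sum_i 'D_(e i) f x ^+ 2) * (f x) ^- 2.
Proof.
move=> oU sf f0 Ux; rewrite /laplacian mulr_sumr -sumrB mulr_suml.
apply: eq_bigr => i _.
have df := smooth_differentiable sf Ux.
have ddf := smooth_differentiable (smooth_derive (e i) sf) Ux.
have fn : f x != 0 by rewrite gt_eqF// f0.
have -> : 'D_(e i) ('D_(e i) (fun x => ln (f x) : R^o)) x =
          'D_(e i) (fun x => 'D_(e i) f x * (f x)^-1 : R^o) x.
  apply: (eq_derive_open _ oU Ux) => y Uy.
  exact: derive_ln (smooth_differentiable sf Uy) (f0 _ Uy).
rewrite (derive_mulr (e i) ddf (differentiableV df fn)) (derive_inv (e i) df fn).
move: ('D_(e i) ('D_(e i) f) x) ('D_(e i) f x) => a b.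
by field.
Qed.

End MaximumPrinciple.

Section FlatConformal.
Context {R : realType}.

Section AnyDimension.
Variables (m : nat) (U : set 'rV[R]_m) (H : 'rV[R]_m -> 'rV[R]_m) (tau : 'rV[R]_m -> R^o).
Hypothesis cp : conformal_param 0 U (fun x => embed_tail (H x)) tau.
Local Notation e i := (delta_mx ord0 i : 'rV[R]_m).
Local Notation h := (fun x => embed_tail (H x)).
Local Notation om := (ambient_weight 0 (m := m)).

Let oU := cp_open cp.

Lemma flat_smooth : smooth U H.
Proof.
apply/smooth_mxP => // i j; have -> : i = ord0 by exact: ord1.
apply: (eq_smooth oU _ ((smooth_mxP _ oU).1 (cp_smooth cp) ord0 (lift ord0 j))) => x _.
by rewrite embed_tail_lift.
Qed.

Lemma derive_embed_comp (W : normedModType R) (F : W -> 'rV[R]_m) x v : differentiable F x ->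
  'D_v (fun y => embed_tail (F y)) x = embed_tail ('D_v F x).
Proof.
move=> dF; have dE := smooth_differentiable (smooth_embed_tail openT) (I : setT (F x)).
have -> : (fun y => embed_tail (F y)) = @embed_tail R m \o F by [].
by rewrite (derive_comp v dF dE) derive_embed_tail.
Qed.

Let dH x (Ux : U x) : differentiable H x := smooth_differentiable flat_smooth Ux.
Let ddH v x (Ux : U x) : differentiable ('D_v H) x :=
  smooth_differentiable (smooth_derive v flat_smooth) Ux.

Lemma flat_derive x v : U x -> 'D_v h x = embed_tail ('D_v H x).
Proof. by move=> Ux; apply/derive_embed_comp/dH. Qed.

Lemma flat_derive2 x v w : U x -> 'D_v ('D_w h) x = embed_tail ('D_v ('D_w H) x).
Proof.
move=> Ux; rewrite -(derive_embed_comp v (ddH w Ux)).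
by apply: (eq_derive_open _ oU Ux) => y; exact: flat_derive.
Qed.

Lemma flat_dot x v w : U x -> dot ('D_v H x) ('D_w H x) = tau x ^- 2 * dot v w.
Proof.
by move=> Ux; rewrite -(cp_dot cp v w Ux) (flat_derive v Ux) (flat_derive w Ux) wdot_embed.
Qed.

Lemma embed_tail_eq0 (u : 'rV[R]_m) : embed_tail u = 0 -> u = 0.
Proof.
by move=> E; apply/rowP => j; rewrite -embed_tail_lift E !mxE.
Qed.

Lemma flat_nondegenerate x u : U x -> (forall i, dot u ('D_(e i) H x) = 0) -> u = 0.
Proof.
move=> Ux uH; apply: embed_tail_eq0; apply: (cp_nondegenerate cp Ux).
  by rewrite /position_normal eqxx wdot_embed_e0.
move=> z; rewrite (flat_derive z Ux) wdot_embed (derive_dir_coord z (dH Ux)).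
by rewrite /dot wdot_sumr big1// => i _; rewrite wdotZr -/(dot _ _) uH mulr0.
Qed.

(** The derivatives of H in the coordinate directions are an orthogonal basis of
    vectors of squared length tau^-2. *)
Lemma flat_parseval x p : U x -> dot p p = tau x ^+ 2 * \sum_i dot p ('D_(e i) H x) ^+ 2.
Proof.
move=> Ux; have t0 := cp_tau_neq0 cp Ux.
pose q := tau x ^+ 2 *: \sum_i dot p ('D_(e i) H x) *: 'D_(e i) H x.
have qE : p - q = 0.
  apply: (flat_nondegenerate Ux) => j.
  rewrite /dot wdotDl wdotNl wdotZl wdot_suml -!/(dot _ _) (bigD1 j)//= big1 => [|i ij].
    rewrite addr0 wdotZl -!/(dot _ _) (flat_dot _ _ Ux) /dot wdot_delta mxE !eqxx !mulr1.
    by rewrite mulrCA divff ?expf_neq0// mulr1 subrr.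
  rewrite wdotZl -/(dot ('D_(e i) H x) ('D_(e j) H x)) (flat_dot _ _ Ux) /dot wdot_delta.
  by rewrite mxE eqxx eq_sym (negPf ij) !mulr0.
have -> : dot p p = dot p q by congr (dot p _); apply/eqP; rewrite -subr_eq0 qE.
rewrite /q /dot wdotZr wdot_sumr; congr (_ * _); apply: eq_bigr => i _.
by rewrite wdotZr expr2.
Qed.

End AnyDimension.

Section Plane.
Variables (U : set 'rV[R]_2) (H : 'rV[R]_2 -> 'rV[R]_2) (tau : 'rV[R]_2 -> R^o).
Hypothesis cp : conformal_param 0 U (fun x => embed_tail (H x)) tau.
Local Notation e i := (delta_mx ord0 i : 'rV[R]_2).
Let oU := cp_open cp.
Let sH := flat_smooth cp.

(** Specific to the plane: in dimension m, the Koszul formula gives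
    (m - 2) tau^-3 D_j tau for the product of the Laplacian of H with D_j H. *)
Lemma flat_harmonic x : U x -> \sum_i 'D_(e i) ('D_(e i) H) x = 0.
Proof.
move=> Ux; have t0 := cp_tau_neq0 cp Ux.
have dt := smooth_differentiable (cp_tau_smooth cp) Ux.
apply: (flat_nondegenerate cp Ux) => j; rewrite /dot wdot_suml -/(dot _ _).
apply: (mulfI (expf_neq0 3 t0)); rewrite mulr0 mulr_sumr.
have K i : tau x ^+ 3 * wdot (fun=> 1) ('D_(e i) ('D_(e i) H) x) ('D_(e j) H x) =
    'D_(e j) tau x - 2 * ((i == j)%:R * 'D_(e i) tau x).
  have := cp_koszul cp (e i) (e i) (e j) Ux.
  rewrite (flat_derive2 cp _ _ Ux) (flat_derive cp _ Ux) wdot_embed => ->.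
  rewrite /dot !wdot_delta !mxE !eqxx /= eq_sym.
  by move: ('D_(e j) tau x) ('D_(e i) tau x) => a b; case: (i == j) => /=; ring.
rewrite (eq_bigr _ (fun i _ => K i)) !big_ord_recl big_ord0.
have -> : lift ord0 ord0 = ord_max :> 'I_2 by apply/val_inj.
move: j {K} => j; case: (unliftP ord0 j) => [j' ->|->] /=; last first.
  by move: ('D_(e ord0) tau x) ('D_(e ord_max) tau x) => a b; ring.
rewrite (ord1 j') (_ : lift ord0 0 = ord_max); last by apply/val_inj.
by move: ('D_(e ord0) tau x) ('D_(e ord_max) tau x) => a b; rewrite eqxx /=; ring.
Qed.

(** The quadratic polynomials A + b.y + C |y|^2 with |b|^2 = 4 A C are the
    multiples of the squared distances to a point, their limits included; in
    the plane their logarithm is harmonic, a property that conformal maps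
    transport. *)
Definition quadratic (A : R) (b : 'rV[R]_2) (C : R) (y : 'rV[R]_2) : R^o :=
  A + dot b y + C * dot y y.

Lemma smooth_quadratic A b C : smooth U (fun x => quadratic A b C (H x)).
Proof.
apply: smoothD => //.
  apply: smoothD => //; first exact: smooth_cst.
  by apply: smooth_wdot => //; exact: smooth_cst.
by apply: smoothM => //; [exact: smooth_cst|exact: smooth_wdot].
Qed.

Lemma derive_quadratic A b C (F : 'rV[R]_2 -> 'rV[R]_2) x v : differentiable F x ->
  'D_v (fun x => quadratic A b C (F x)) x = dot (b + (2 * C) *: F x) ('D_v F x).
Proof.
move=> dF; have dc (k : R^o) := differentiable_cst k x.
have db := differentiable_cst b x.
have d1 : differentiable (fun x => dot b (F x) : R^o) x by exact: differentiable_wdot db dF.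
have d2 : differentiable (fun x => dot (F x) (F x) : R^o) x by exact: (differentiable_wdot _ dF dF).
have d3 : differentiable (fun x => C * dot (F x) (F x) : R^o) x.
  exact: differentiableM (dc C) d2.
rewrite (derive_add v (differentiableD (dc A) d1) d3) (derive_add v (dc A) d1).
rewrite (derive_mulr v (dc C) d2) !derive_cst (derive_wdot _ v db dF) (derive_wdot _ v dF dF).
rewrite derive_cst wdot0l !add0r mul0r add0r /cst /dot wdotDl wdotZl.
rewrite [wdot _ ('D_v F x) _]wdotC.
by move: (wdot _ _ _) (wdot _ _ _) => p q; ring.
Qed.

Lemma laplacian_ln_quadratic A b C (U' : set 'rV[R]_2) x : dot b b = 4 * A * C ->
  open U' -> U' `<=` U -> (forall y, U' y -> 0 < quadratic A b C (H y)) -> U' x ->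
  laplacian (fun y => ln (quadratic A b C (H y)) : R^o) x = 0.
Proof.
move=> bb oU' UU' Q0 U'x; have Ux := UU' _ U'x; have t0 := cp_tau_neq0 cp Ux.
have sQ := sub_smooth UU' (smooth_quadratic A b C).
have dH := smooth_differentiable sH Ux.
rewrite (laplacian_ln oU' sQ Q0 U'x).
have E1 : \sum_i 'D_(e i) (fun x => quadratic A b C (H x)) x ^+ 2 =
    tau x ^- 2 * dot (b + (2 * C) *: H x) (b + (2 * C) *: H x).
  rewrite (flat_parseval cp _ Ux) mulrA mulVf ?expf_neq0// mul1r.
  by apply: eq_bigr => i _; rewrite (derive_quadratic A b C (e i) dH).
have E2 : laplacian (fun x => quadratic A b C (H x)) x = 4 * C * tau x ^- 2.
  have L i : 'D_(e i) ('D_(e i) (fun x => quadratic A b C (H x))) x =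
      2 * C * tau x ^- 2 + dot (b + (2 * C) *: H x) ('D_(e i) ('D_(e i) H) x).
    have -> : 'D_(e i) ('D_(e i) (fun x => quadratic A b C (H x))) x =
       'D_(e i) (fun y => dot (b + (2 * C) *: H y) ('D_(e i) H y) : R^o) x.
      apply: (eq_derive_open _ oU Ux) => y Uy.
      exact: derive_quadratic (smooth_differentiable sH Uy).
    have dd := smooth_differentiable (smooth_derive (e i) sH) Ux.
    have db := differentiable_cst b x.
    have dcH : differentiable (fun y => (2 * C) *: H y) x by exact: differentiableZ.
    rewrite (derive_wdot _ (e i) (differentiableD db dcH) dd) (derive_add (e i) db dcH).
    have -> : 'D_(e i) (fun y => (2 * C) *: H y) x = (2 * C) *: 'D_(e i) H x.
      by apply: deriveZ; exact: diff_derivable.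
    rewrite derive_cst add0r -!/(dot _ _) /dot wdotZl -!/(dot _ _) (flat_dot cp _ _ Ux).
    by rewrite /dot wdot_delta mxE !eqxx !mulr1.
  rewrite /laplacian (eq_bigr _ (fun i _ => L i)) big_split /=.
  rewrite -wdot_sumr (flat_harmonic Ux) wdot0r addr0 sumr_const card_ord.
  by rewrite -mulr_natl; ring.
rewrite E1 E2 /quadratic /dot !wdotDl !wdotDr !wdotZl !wdotZr -!/(dot _ _) bb.
rewrite [dot (H x) b]wdotC -/(dot b (H x)).
move: (dot b (H x)) (dot (H x) (H x)) => p q.
by rewrite (_ : _ - _ = 0) ?mul0r//; ring.
Qed.

End Plane.
End FlatConformal.

Section PuncturedMaximum.
Context {R : realType}.
Local Notation V := 'rV[R]_2.
Local Notation e i := (delta_mx ord0 i : V).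

Lemma flat_id_cp : conformal_param (0 : R) [set: V] (fun x => embed_tail x) (fun=> 1).
Proof.
split.
- exact: openT.
- exact/smooth_embed_tail/openT.
- exact: smooth_cst.
- by move=> x _; exact: ltr01.
- by move=> x _; rewrite /space_form /= eqxx embed_tail0.
- by move=> x v w _; rewrite !derive_embed_tail wdot_embed expr1n mul1r.
Qed.

Lemma dist2E (a y : V) : dot (y - a) (y - a) = quadratic (dot a a) (- 2 *: a) 1 y.
Proof.
rewrite /quadratic /dot wdotDl !wdotDr !wdotNl !wdotNr wdotZl [wdot _ y a]wdotC mul1r.
by move: (wdot _ a y) (wdot _ a a) (wdot _ y y) => p q r; ring.
Qed.

Lemma dist2_null (a : V) : dot (- 2 *: a) (- 2 *: a) = 4 * dot a a * 1.
Proof. by rewrite /dot wdotZl wdotZr; move: (wdot _ a a) => p; ring. Qed.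

Lemma smooth_dist2 (U : set V) (a : V) : open U -> smooth U (fun y => dot (y - a) (y - a) : R^o).
Proof.
move=> oU; apply: smooth_wdot => //; apply: smoothD => //; try exact: smooth_id; exact: smooth_cst.
Qed.

Lemma laplacian_ln_dist2 (U : set V) (a x : V) : open U -> (forall y, U y -> y != a) -> U x ->
  laplacian (fun y => ln (dot (y - a) (y - a)) : R^o) x = 0.
Proof.
move=> oU Ua Ux; under eq_fun do rewrite dist2E.
apply: (laplacian_ln_quadratic flat_id_cp (dist2_null a) oU (@subsetT _ _) _ Ux) => y Uy.
by rewrite -dist2E dot_gt0 subr_eq0 Ua.
Qed.

Lemma laplacian_dot (x : V) : laplacian (fun y => dot y y : R^o) x = 4.
Proof.
have D (v : V) : 'D_v (fun y => dot y y : R^o) = (fun x => 2 * dot x v : R^o).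
  apply/funext => y; have di := smooth_differentiable (smooth_id setT) (I : setT y).
  rewrite (derive_wdot _ v di di) derive_id [wdot _ v y]wdotC -/(dot y v).
  by move: (dot y v) => p; ring.
have D2 (v : V) : 'D_v ('D_v (fun y => dot y y : R^o)) x = 2 * dot v v.
  rewrite D; have di := smooth_differentiable (smooth_id setT) (I : setT x).
  have dv := differentiable_cst v x; have dc := differentiable_cst (2 : R^o) x.
  have dd : differentiable (fun y => dot y v : R^o) x by exact: differentiable_wdot di dv.
  rewrite (derive_mulr v dc dd) derive_cst (derive_wdot _ v di dv) derive_cst derive_id.
  by rewrite wdot0r mul0r add0r addr0.
rewrite /laplacian (eq_bigr _ (fun i _ => D2 (e i))) !big_ord_recl big_ord0.
by rewrite /dot !wdot_delta !mxE !eqxx !mulr1 addr0 -natrD.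
Qed.

Lemma ln_le_self (x : R) : 0 < x -> ln x <= x.
Proof. by move=> x0; apply/ltW/ln_sublinear. Qed.

Lemma continuous_dot (a : V) : continuous (fun y : V => dot (y - a) (y - a) : R^o).
Proof.
by move=> x; exact: (smooth_continuous (smooth_dist2 a openT) (I : setT x)).
Qed.

Lemma compact_dist2_bounded (D : set V) (a : V) : compact D ->
  exists2 T : R, 0 <= T & forall y, D y -> dot (y - a) (y - a) <= T.
Proof.
move=> cD; have [->|/set0P D0] := eqVneq D set0; first by exists 0.
have cf : {within D, continuous (fun y => dot (y - a) (y - a) : R^o)}.
  by apply: continuous_subspaceT; exact: continuous_dot.
have [z _ Hz] := EVT_max_rV D0 cD cf.
by exists (dot (z - a) (z - a)); [exact: dot_ge0|move=> y Dy; apply: Hz; rewrite inE].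
Qed.

(** The maximum principle for a harmonic function with two punctures at which it
    is bounded above: adding small multiples of the logarithms of the distances
    to the punctures, which tend to minus infinity there, and of |z|^2, which
    makes the function strictly subharmonic, does not increase it once a constant
    has been subtracted. *)
Lemma punctured_maximum (D Om : set V) (L : V -> R^o) (a b : V) (B : R) :
  compact D -> open Om -> smooth Om L -> (forall z, Om z -> z != a /\ z != b) ->
  (forall z, Om z -> laplacian L z = 0) ->
  (forall z, D z -> z != a -> z != b -> Om z) ->
  (forall z, D z -> z != a -> z != b -> L z <= B \/ nbhs z D) ->
  (forall p, p = a \/ p = b -> exists d C : R, 0 < d /\
     forall z, D z -> z != a -> z != b -> dot (z - p) (z - p) < d -> L z <= C) ->
  forall z, D z -> z != a -> z != b -> L z <= B.
Proof.
move=> cD oOm sL Omab LL DOm bD nab z0 Dz0 z0a z0b.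
rewrite leNgt; apply/negP => LB.
have [Ta Ta0 HTa] := compact_dist2_bounded a cD.
have [Tb Tb0 HTb] := compact_dist2_bounded b cD.
have [T0 T00 HT0] := compact_dist2_bounded 0 cD.
(* P tends to minus infinity at the punctures and has Laplacian 4. *)
pose P (z : V) : R^o := dot z z + (ln (dot (z - a) (z - a)) + ln (dot (z - b) (z - b))).
pose T := T0 + Ta + Tb.
have dpos (z p : V) : z != p -> 0 < dot (z - p) (z - p) by rewrite dot_gt0 subr_eq0.
have dot0 (z : V) : dot z z = dot (z - 0) (z - 0) by rewrite subr0.
have PT z : D z -> z != a -> z != b -> P z <= T.
  move=> Dz za zb; rewrite /P /T -addrA; apply: lerD; first by rewrite dot0; exact: HT0.
  apply: lerD; first exact: le_trans (ln_le_self (dpos _ _ za)) (HTa _ Dz).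
  exact: le_trans (ln_le_self (dpos _ _ zb)) (HTb _ Dz).
pose K := T - P z0; have K0 : 0 <= K by rewrite subr_ge0; exact: PT.
(* Small enough for w to remain larger than B at z0. *)
pose ep := (L z0 - B) / (2 * (K + 1)).
have ep0 : 0 < ep by rewrite divr_gt0 ?subr_gt0// mulr_gt0// ltr_wpDl.
pose w (z : V) : R^o := L z + ep * (P z + (- T)).
have wz0 : B < w z0.
  have epK : ep * (2 * (K + 1)) = L z0 - B by rewrite divfK// gt_eqF// mulr_gt0// ltr_wpDl.
  have -> : w z0 = L z0 - ep * K by rewrite /w /K; ring.
  nra.
have near_p p : p = a \/ p = b -> exists2 d : R, 0 < d &
    forall z, D z -> z != a -> z != b -> dot (z - p) (z - p) < d -> w z <= B.
  move=> pab; have [d [C [d0 HC]]] := nab p pab.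
  pose N := (C - B) / ep.
  exists (Num.min d (expR (- `|N|))); first by rewrite lt_min d0 expR_gt0.
  move=> z Dz za zb; rewrite lt_min => /andP[zd zN].
  have zp : z != p by case: pab => ->.
  have lnN : ln (dot (z - p) (z - p)) <= - `|N|.
    by rewrite -[leRHS]expRK ler_ln ?posrE ?expR_gt0 ?dpos// ltW.
  have PN : P z - T <= - `|N|.
    have H0 := HT0 _ Dz; rewrite subr0 in H0.
    have Ha := le_trans (ln_le_self (dpos _ _ za)) (HTa _ Dz).
    have Hb := le_trans (ln_le_self (dpos _ _ zb)) (HTb _ Dz).
    by rewrite /P /T; case: pab lnN => -> lnN; lra.
  have LC := HC z Dz za zb zd.
  have : ep * (P z - T) <= ep * - `|N| by rewrite ler_pM2l.
  have : ep * - `|N| <= ep * - N by rewrite ler_pM2l// lerN2 ler_norm.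
  have -> : ep * - N = B - C by rewrite /N; field; rewrite gt_eqF.
  by rewrite /w; lra.
have [da da0 Hda] := near_p a (or_introl erefl).
have [db db0 Hdb] := near_p b (or_intror erefl).
pose D' := D `&` ([set z | da <= dot (z - a) (z - a)] `&` [set z | db <= dot (z - b) (z - b)]).
have D'in z : D' z -> [/\ D z, z != a & z != b].
  move=> [Dz [/= za zb]]; split => //; apply/eqP => E.
    by move: za; rewrite E subrr /dot wdot0l leNgt da0.
  by move: zb; rewrite E subrr /dot wdot0l leNgt db0.
have in_D' z : D z -> z != a -> z != b -> B < w z -> D' z.
  move=> Dz za zb wB; split => //; split; rewrite /= leNgt; apply/negP => H.
    by have := Hda z Dz za zb H; rewrite leNgt wB.
  by have := Hdb z Dz za zb H; rewrite leNgt wB.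
have cD' : compact D'.
  apply: compact_closedI => //; apply: closedI.
    have -> : [set z | da <= dot (z - a) (z - a)] =
      (fun y => dot (y - a) (y - a) : R^o) @^-1` [set y | da <= y] by [].
    by apply: closed_comp; [move=> x _; exact: continuous_dot|exact: closed_ge].
  have -> : [set z | db <= dot (z - b) (z - b)] =
    (fun y => dot (y - b) (y - b) : R^o) @^-1` [set y | db <= y] by [].
  by apply: closed_comp; [move=> x _; exact: continuous_dot|exact: closed_ge].
have sln p : (forall z, Om z -> z != p) -> smooth Om (fun z => ln (dot (z - p) (z - p)) : R^o).
  move=> Hp; apply: smooth_ln => //; first exact: smooth_dist2.
  by move=> x /Hp /dpos.
have sla := sln a (fun z Oz => (Omab z Oz).1).
have slb := sln b (fun z Oz => (Omab z Oz).2).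
have sdd : smooth Om (fun z => dot z z : R^o) by apply: smooth_wdot => //; exact: smooth_id.
have slab := smoothD oOm sla slb.
have sP : smooth Om P := smoothD oOm sdd slab.
have sPT : smooth Om (fun z => P z + (- T)) := smoothD oOm sP (smooth_cst _ _).
have sePT : smooth Om (fun z => ep * (P z + (- T)) : R^o) := smoothM oOm (smooth_cst _ _) sPT.
have sw : smooth Om w := smoothD oOm sL sePT.
have cw : {within D', continuous w}.
  apply: continuous_in_subspaceT => z; rewrite inE => /D'in [Dz za zb].
  exact: (smooth_continuous sw (DOm _ Dz za zb)).
have D'0 : D' !=set0 by exists z0; exact: in_D'.
have [z1 D'z1 Hz1] := EVT_max_rV D'0 cD' cw.
rewrite inE in D'z1; have [Dz1 z1a z1b] := D'in _ D'z1.
have wz1 : B < w z1 by apply: (lt_le_trans wz0); apply: Hz1; rewrite inE; exact: in_D'.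
have LwP : w z1 <= L z1.
  by rewrite /w gerDl pmulr_rle0// subr_le0; exact: PT.
have nD : nbhs z1 D.
  by case: (bD z1 Dz1 z1a z1b) => // H; move: (le_trans LwP H); rewrite leNgt wz1.
have Oz1 := DOm _ Dz1 z1a z1b.
pose U1 := D^° `&` Om.
have oU1 : open U1 by apply: openI => //; exact: open_interior.
have U1z1 : U1 z1 by split.
have U1Om : U1 `<=` Om by move=> y [].
have wmax y : U1 y -> w y <= w z1.
  move=> [/interior_subset Dy Oy]; have [ya yb] := Omab _ Oy.
  have [wyB|wyB] := leP (w y) B; first exact: ltW (le_lt_trans wyB wz1).
  by apply: Hz1; rewrite inE; exact: in_D'.
have := laplacian_max oU1 (sub_smooth U1Om sw) U1z1 wmax.
rewrite (laplacianD oOm sL sePT Oz1) (LL _ Oz1) add0r (laplacianZ ep oOm sPT Oz1).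
rewrite (laplacianD oOm sP (smooth_cst _ _) Oz1) (laplacianD oOm sdd slab Oz1).
rewrite (laplacianD oOm sla slb Oz1) laplacian_dot.
rewrite (laplacian_ln_dist2 oOm (fun z Oz => (Omab z Oz).1) Oz1).
rewrite (laplacian_ln_dist2 oOm (fun z Oz => (Omab z Oz).2) Oz1).
have -> : laplacian (fun=> - T : R^o) z1 = 0.
  rewrite /laplacian big1// => i _; have -> : 'D_(e i) (fun=> - T : R^o) = fun=> 0.
    by apply/funext => y; exact: derive_cst.
  exact: derive_cst.
by rewrite !addr0 leNgt mulr_gt0.
Qed.

End PuncturedMaximum.

(** * Global conformal maps of the plane and of the disc *)

Section PlanarRigidity.
Context {R : realType}.
Local Notation V := 'rV[R]_2.
Local Notation e i := (delta_mx ord0 i : V).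

Lemma sqr_norm_le_dot q (u : 'rV[R]_q) : `|u| ^+ 2 <= dot u u.
Proof.
have [->|] := eqVneq u 0; first by rewrite normr0 expr0n /= dot_ge0.
rewrite -normr_eq0 => /mx_norm_neq0 [[i j] /= E].
have -> : `|u| = `|u ord0 j| by rewrite [LHS]E (ord1 i).
by rewrite real_normK ?num_real// dot_coord.
Qed.

Lemma dot_le_sqr_norm q (u : 'rV[R]_q) : dot u u <= q%:R * `|u| ^+ 2.
Proof.
have -> : q%:R * `|u| ^+ 2 = \sum_(j < q) `|u| ^+ 2.
  by rewrite sumr_const card_ord mulr_natl.
rewrite /dot wdotE.
apply: ler_sum => j _; rewrite mul1r -expr2 -[_ ^+ 2]real_normK ?num_real//.
rewrite ler_sqr ?nnegrE// [leRHS]/Num.Def.normr/= mx_normrE.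
exact: (le_bigmax _ (fun ij => `|u ij.1 ij.2|) (ord0, j)).
Qed.

(** With squared distances, to be compared with the conformal factor near a
    puncture. *)
Lemma local_lipschitz (F : V -> V) (a : V) : differentiable F a ->
  exists d C : R, [/\ 0 < d, 0 < C & forall z, dot (z - a) (z - a) < d ->
    dot (F z - F a) (F z - F a) <= C * dot (z - a) (z - a)].
Proof.
move=> dF; have [k k0 Hk] := linear_lipschitz (diff_continuous dF).
have := diff_locally dF => /eqaddoP /(_ 1 ltr01) /nbhs_ballP [r /= r0 Hr].
exists (r ^+ 2), (2 * (k + 1) ^+ 2); split.
- by rewrite exprn_gt0.
- by rewrite mulr_gt0// exprn_gt0// addr_gt0.
move=> z zr; have zr' : `|z - a| < r.
  by rewrite -ltr_sqr ?nnegrE ?(ltW r0)//; exact: le_lt_trans (sqr_norm_le_dot _) zr.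
have := Hr (z - a); rewrite -ball_normE /ball_ /= sub0r normrN => /(_ zr').
rewrite -![(_ - _ : _ -> _) _]/(_ - _) -![(_ + _ : _ -> _) _]/(_ + _) /= subrK mul1r => H1.
have H2 : `|F z - F a| <= (k + 1) * `|z - a|.
  have -> : F z - F a = (F z - (cst (F a) (z - a) + 'd F a (z - a))) + 'd F a (z - a).
    by rewrite opprD addrA subrK.
  by rewrite mulrDl mul1r addrC (le_trans (ler_normD _ _))// lerD.
apply: (le_trans (dot_le_sqr_norm _)); rewrite -mulrA ler_pM2l//.
apply: (@le_trans _ _ (((k + 1) * `|z - a|) ^+ 2)).
  by rewrite ler_sqr ?nnegrE// mulr_ge0// ltW// addr_gt0.
by rewrite exprMn ler_pM2l ?exprn_gt0 ?addr_gt0// sqr_norm_le_dot.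
Qed.

Lemma near_line_open (U : set V) a v : open U -> U a ->
  \forall t \near (0 : R^o), U (t *: v + a).
Proof.
move=> oU Ua; have cl : {for (0 : R^o), continuous (fun t : R^o => t *: v + a)}.
  by apply: cvgD; [exact: (@scalel_continuous _ _ v 0)|exact: cvg_cst].
by apply: cl; rewrite scale0r add0r; exact: open_nbhs_nbhs.
Qed.

(** A function that relates the squared distances to the images and to the points
    near a is a squared difference quotient, whose limit is the conformal
    factor. *)
Lemma conformal_factor_limit U (H : V -> V) tau (a : V) (F : V -> R^o) :
  conformal_param 0 U (fun x => embed_tail (H x)) tau -> U a ->
  {for a, continuous F} ->
  (forall z, U z -> dot (H z - H a) (H z - H a) = F z * dot (z - a) (z - a)) ->
  F a = tau a ^- 2.
Proof.
move=> cp Ua cF HF; pose v := e ord0.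
have vv : dot v v = 1 by rewrite /dot wdot_delta mxE !eqxx mulr1.
have dH := smooth_differentiable (flat_smooth cp) Ua.
have E : dot ('D_v H a) ('D_v H a) = tau a ^- 2 by rewrite (flat_dot cp _ _ Ua) vv mulr1.
have cv : (fun t : R^o => t^-1 *: (H (t *: v + a) - H a)) @ 0^' --> 'D_v H a.
  exact: diff_derivable.
have cd : (fun t : R^o => dot (t^-1 *: (H (t *: v + a) - H a)) (t^-1 *: (H (t *: v + a) - H a)) : R^o) @ 0^'
    --> (tau a ^- 2 : R^o).
  have sdot : smooth [set: V] (fun y => dot y y : R^o).
    by apply: smooth_wdot; [exact: openT|exact: smooth_id|exact: smooth_id].
  have cdot := smooth_continuous sdot (I : setT ('D_v H a)).
  by rewrite -E; exact: (cvg_comp _ _ cv cdot).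
have cFl : (fun t : R^o => F (t *: v + a)) @ 0^' --> F a.
  have cl : {for (0 : R^o), continuous (fun t : R^o => t *: v + a)}.
    by apply: cvgD; [exact: (@scalel_continuous _ _ v 0)|exact: cvg_cst].
  have : {for (0 : R^o), continuous (fun t : R^o => F (t *: v + a))}.
    by apply: continuous_comp => //; rewrite scale0r add0r.
  rewrite /prop_for /continuous_at scale0r add0r => H0.
  exact: cvg_within_filter H0.
have Ee : \forall t \near (0 : R^o)^', dot (t^-1 *: (H (t *: v + a) - H a))
     (t^-1 *: (H (t *: v + a) - H a)) = F (t *: v + a).
  have nU : \forall t \near (0 : R^o)^', U (t *: v + a).
    by apply: cvg_within; exact: near_line_open (cp_open cp) Ua.
  have n0 : \forall t \near (0 : R^o)^', t != 0 := nbhs_dnbhs_neq (0 : R^o).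
  near=> t.
  have Ut : U (t *: v + a) by near: t; exact: nU.
  have t0 : t != 0 by near: t; exact: n0.
  rewrite /dot wdotZl wdotZr -!/(dot _ _) (HF _ Ut) addrK.
  by rewrite /dot wdotZl wdotZr -!/(dot _ _) vv; field.
have := cvg_trans (near_eq_cvg Ee) cd.
move=> cF2.
have uq := @norm_cvg_unique R R^o (fmap (fun t : R^o => F (t *: v + a)) (0 : R^o)^').
have PF : ProperFilter (fmap (fun t : R^o => F (t *: v + a)) (0 : R^o)^').
  by apply: fmap_proper_filter; exact: (Proper_dnbhs_numFieldType (0 : R)).
exact: (uq PF _ _ cFl (cF2 _)).
Unshelve. all: by end_near. Qed.

End PlanarRigidity.

Section SchwarzPick.
Context {R : realType}.
Local Notation V := 'rV[R]_2.
Local Notation dist2 x y := (dot (x - y) (x - y)).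

Lemma open_setneq (a : V) : open [set z | z != a].
Proof.
have -> : [set z | z != a] = ~` [set a].
  by apply/seteqP; split => z /=; [move/eqP|move=> ?; apply/eqP].
apply: closed_openC; apply: accessible_closed_set1.
exact/hausdorff_accessible/norm_hausdorff.
Qed.

(** For c < 0, the quotient of dist2 z a by green_denom c a z is, up to the
    factor - c / 4, the square of the modulus of the automorphism of the disc
    that takes a to 0: the logarithm of this modulus is the Green function.
    It is a quadratic of the kind whose logarithm is harmonic. *)
Definition green_denom (c : R) (a : V) : V -> R^o :=
  quadratic 1 ((c / 2) *: a) (c ^+ 2 / 16 * dot a a).

(** The classical identity that compares the modulus of a disc automorphism with
    the hyperbolic conformal factors at the two points. *)
Lemma green_denomE c (a z : V) :
  stereo_tau c a * stereo_tau c z = green_denom c a z + c / 4 * dist2 z a.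
Proof.
rewrite /stereo_tau /green_denom /quadratic /dot wdotDl !wdotDr !wdotNl !wdotNr wdotZl.
rewrite [wdot _ z a]wdotC.
by move: (wdot _ a z) (wdot _ a a) (wdot _ z z) => p q r; field.
Qed.

Lemma green_denom_null c (a : V) :
  dot ((c / 2) *: a) ((c / 2) *: a) = 4 * 1 * (c ^+ 2 / 16 * dot a a).
Proof. by rewrite /dot wdotZl wdotZr; move: (wdot _ a a) => p; field. Qed.

Lemma green_denom_gt0 c (a z : V) : c <= 0 -> stereo_dom c a -> stereo_dom c z ->
  0 < green_denom c a z.
Proof.
move=> c0 Ua Uz; have := green_denomE c a z.
have : 0 < stereo_tau c a * stereo_tau c z by rewrite mulr_gt0.
have := dot_ge0 (z - a).
move: (_ * stereo_tau c z) (green_denom c a z) (dist2 z a) => p q r r0 p0 E.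
nra.
Qed.

Lemma green_denom_diag c (a : V) : green_denom c a a = stereo_tau c a ^+ 2.
Proof. by have := green_denomE c a a; rewrite subrr /dot wdot0l mulr0 addr0 expr2. Qed.

Lemma stereo_tau_le1 c (z : V) : c <= 0 -> stereo_tau c z <= 1.
Proof. by move=> c0; rewrite /stereo_tau gerDl; have := dot_ge0 z; nra. Qed.

Lemma smooth_green_denom c a U (H : V -> V) tau :
  conformal_param 0 U (fun x => embed_tail (H x)) tau ->
  smooth U (fun x => green_denom c a (H x)).
Proof. by move=> cp; exact: smooth_quadratic cp _ _ _. Qed.

(** By green_denomE, stereo_tau c z is at least a positive multiple of dist2 z a on
    the sublevel set, which keeps z inside the domain and near a. *)
Lemma compact_green_sublevel c (a : V) (s : R) : c <= 0 -> stereo_dom c a -> 0 < s ->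
  0 < 1 + s * c / 4 ->
  compact [set z | dist2 z a <= s * green_denom c a z] /\
  (forall z, dist2 z a <= s * green_denom c a z -> stereo_dom c z).
Proof.
move=> c0 Ua s0 sc.
have key z : dist2 z a <= s * green_denom c a z ->
    (1 + s * c / 4) * dist2 z a <= s * (stereo_tau c a * stereo_tau c z).
  rewrite (green_denomE c a z); move: (dist2 z a) (green_denom c a z) => p q H.
  have -> : s * (q + c / 4 * p) = s * q + s * c / 4 * p by field.
  by rewrite mulrDl mul1r lerD2r.
have dom z : dist2 z a <= s * green_denom c a z -> stereo_dom c z.
  move=> /key H; have [->//|za] := eqVneq z a.
  have : 0 < s * (stereo_tau c a * stereo_tau c z).
    by apply: lt_le_trans H; rewrite mulr_gt0// dot_gt0 subr_eq0.
  by rewrite pmulr_rgt0// pmulr_rgt0.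
split=> //; apply: bounded_closed_compact.
  pose r := s / (1 + s * c / 4).
  exists (`|a| + (r + 1)); split; first exact: num_real.
  move=> x xM z /= Hz; have Uz := dom _ Hz; apply: le_trans (ltW xM).
  rewrite -(subrK a z) addrC (le_trans (ler_normD _ _))// lerD2l.
  have r0 : 0 < r by rewrite divr_gt0.
  have dr : dist2 z a <= r.
    rewrite ler_pdivlMr// mulrC; apply: (le_trans (key _ Hz)).
    rewrite -[leRHS]mulr1 ler_pM2l//.
    have := stereo_tau_le1 a c0; have := stereo_tau_le1 z c0.
    have ta : 0 < stereo_tau c a := Ua; have tz : 0 < stereo_tau c z := Uz.
    by move: (stereo_tau c a) (stereo_tau c z) ta tz => p q; nra.
  have : `|z - a| ^+ 2 <= r := le_trans (sqr_norm_le_dot _) dr.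
  by have := normr_ge0 (z - a); move: `|z - a| => n; nra.
have sm : smooth [set: V] (fun z => s * green_denom c a z + - dist2 z a : R^o).
  apply: smoothD; first exact: openT.
    by apply: smoothM; [exact: openT|exact: smooth_cst|exact: smooth_green_denom flat_id_cp].
  apply: (eq_smooth openT _ (smoothM openT (smooth_cst setT (-1 : R^o)) (smooth_dist2 a openT))).
  by move=> x _; rewrite mulN1r.
have -> : [set z | dist2 z a <= s * green_denom c a z] =
   (fun z => s * green_denom c a z + - dist2 z a : R^o) @^-1` [set y | 0 <= y].
  by apply/seteqP; split => z /=; rewrite subr_ge0.
apply: closed_comp; last exact: closed_ge.
by move=> x _; exact: (smooth_continuous sm (I : setT x)).
Qed.

Lemma ler_ln_exp (x y : R) : 0 < x -> 0 < y -> ln x <= ln y -> x <= y.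
Proof. by move=> x0 y0; rewrite ler_ln. Qed.

(** The Schwarz-Pick lemma, on the sublevel sets of the Green function: the
    difference of the Green functions of the target, composed with H, and of the
    source is harmonic off a and bounded near a. *)
Lemma schwarz_pick_level c c' (H : V -> V) tau (a z0 : V) (s : R) :
  c <= 0 -> c' < 0 ->
  conformal_param 0 (stereo_dom c) (fun x => embed_tail (H x)) tau ->
  (forall z, stereo_dom c z -> stereo_dom c' (H z)) ->
  (forall z w, stereo_dom c z -> stereo_dom c w -> H z = H w -> z = w) ->
  stereo_dom c a -> 0 < s -> 0 < 1 + s * c / 4 -> z0 != a ->
  dist2 z0 a <= s * green_denom c a z0 ->
  s * (- c' / 4 * (dist2 (H z0) (H a) * green_denom c a z0)) <=
  dist2 z0 a * green_denom c' (H a) (H z0).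
Proof.
move=> c0 c'0 cp HU Hinj Ua s0 sc z0a z0s.
have [cD domD] := compact_green_sublevel c0 Ua s0 sc.
set D := [set z | _] in cD.
pose Om : set V := stereo_dom c `&` [set z | z != a].
have oU := cp_open cp.
have oOm : open Om by apply: openI => //; exact: open_setneq.
have OmU : Om `<=` stereo_dom c by move=> z [].
pose D1 (z : V) : R^o := dist2 (H z) (H a).
pose Q1 (z : V) : R^o := green_denom c a z.
pose D0 (z : V) : R^o := dist2 z a.
pose Q0 (z : V) : R^o := green_denom c' (H a) (H z).
have sH : smooth Om H := sub_smooth OmU (flat_smooth cp).
have D1E : D1 = fun z => quadratic (dot (H a) (H a)) (- 2 *: H a) 1 (H z).
  by apply/funext => z; exact: dist2E.
have sD1 : smooth Om D1.
  by rewrite D1E; exact: sub_smooth OmU (smooth_quadratic cp _ _ _).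
have sQ1 : smooth Om Q1.
  exact: sub_smooth (@subsetT _ _) (smooth_green_denom c a flat_id_cp).
have sD0 : smooth Om D0 := smooth_dist2 a oOm.
have sQ0 : smooth Om Q0 := sub_smooth OmU (smooth_green_denom c' (H a) cp).
have D1p z : Om z -> 0 < D1 z.
  move=> [Uz za]; rewrite dot_gt0 subr_eq0; apply/eqP => E.
  by move/eqP: za; apply; exact: Hinj.
have Q1p z : Om z -> 0 < Q1 z by move=> [Uz _]; exact: green_denom_gt0.
have D0p z : Om z -> 0 < D0 z by move=> [_ za]; rewrite dot_gt0 subr_eq0.
have Q0p z : Om z -> 0 < Q0 z.
  by move=> [Uz _]; apply: green_denom_gt0; [exact: ltW|exact: HU|exact: HU].
have slD1 := smooth_ln oOm sD1 D1p; have slQ1 := smooth_ln oOm sQ1 Q1p.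
have slD0 := smooth_ln oOm sD0 D0p; have slQ0 := smooth_ln oOm sQ0 Q0p.
pose L (z : V) : R^o := (ln (D1 z) + ln (Q1 z)) + -1 * (ln (D0 z) + ln (Q0 z)).
have s1 := smoothD oOm slD1 slQ1; have s2 := smoothD oOm slD0 slQ0.
have s3 : smooth Om (fun z => -1 * (ln (D0 z) + ln (Q0 z)) : R^o).
  by apply: smoothM => //; exact: smooth_cst.
have sL : smooth Om L := smoothD oOm s1 s3.
have LL z : Om z -> laplacian L z = 0.
  move=> Oz; rewrite (laplacianD oOm s1 s3 Oz) (laplacianZ (-1) oOm s2 Oz).
  rewrite (laplacianD oOm slD1 slQ1 Oz) (laplacianD oOm slD0 slQ0 Oz).
  have l1 : laplacian (fun z => ln (D1 z) : R^o) z = 0.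
    rewrite D1E; apply: (laplacian_ln_quadratic cp (dist2_null (H a)) oOm OmU _ Oz) => y Oy.
    by rewrite -dist2E; exact: D1p.
  have l2 : laplacian (fun z => ln (Q1 z) : R^o) z = 0.
    exact: (laplacian_ln_quadratic flat_id_cp (green_denom_null c a) oOm (@subsetT _ _) Q1p Oz).
  have l3 : laplacian (fun z => ln (D0 z) : R^o) z = 0.
    by apply: laplacian_ln_dist2 oOm _ Oz => y [].
  have l4 : laplacian (fun z => ln (Q0 z) : R^o) z = 0.
    exact: (laplacian_ln_quadratic cp (green_denom_null c' (H a)) oOm OmU Q0p Oz).
  by rewrite l1 l2 l3 l4; ring.
have DOm z : D z -> z != a -> z != a -> Om z by move=> Dz za _; split => //; exact: domD.
have nc' : 0 < - c' by rewrite oppr_gt0.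
have c'4 : 0 < - c' / 4 by rewrite divr_gt0.
have LE z : Om z -> L z = ln (D1 z * Q1 z / (D0 z * Q0 z)).
  move=> Oz; rewrite ln_div ?posrE ?mulr_gt0 ?D1p ?Q1p ?D0p ?Q0p//.
  by rewrite !lnM ?posrE ?D1p ?Q1p ?D0p ?Q0p// /L mulN1r.
(* On the boundary of D, the bound is the positivity of stereo_tau c' at the
   images of z and a, read through green_denomE. *)
have bD z : D z -> z != a -> z != a -> L z <= ln (s * (- c' / 4))^-1 \/ nbhs z D.
  move=> Dz za _; have Oz := DOm z Dz za za.
  have [lt|ge] := ltP (D0 z) (s * Q1 z).
    right; have sm : smooth Om (fun z => s * Q1 z + - 1 * D0 z : R^o).
      by apply: smoothD => //; apply: smoothM => //; exact: smooth_cst.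
    have cs := smooth_continuous sm Oz.
    have : \forall y \near z, 0 < s * Q1 y + - 1 * D0 y.
      by apply: (cs [set y | 0 < y]); apply: open_nbhs_nbhs; split;
        [exact: open_gt|rewrite /= mulN1r subr_gt0].
    apply: filterS => y /=; rewrite mulN1r subr_gt0 => /ltW; exact.
  left; have E : D0 z = s * Q1 z by apply/eqP; rewrite eq_le ge andbT; exact: Dz.
  rewrite (LE _ Oz) ler_ln ?posrE ?divr_gt0 ?invr_gt0 ?mulr_gt0 ?D1p ?Q1p ?D0p ?Q0p//.
  have G := green_denomE c' (H a) (H z).
  have [Uz _] := Oz.
  have T0 : 0 < stereo_tau c' (H a) * stereo_tau c' (H z).
    by apply: mulr_gt0; [exact: (HU _ Ua)|exact: (HU _ Uz)].
  rewrite E ler_pdivrMr ?mulr_gt0 ?Q1p ?Q0p//.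
  have -> : (s * (- c' / 4))^-1 * (s * Q1 z * Q0 z) = Q1 z * Q0 z / (- c' / 4).
    by field; rewrite ?oppr_eq0 (gt_eqF s0) (lt_eqF c'0).
  rewrite ler_pdivlMr// [D1 z * _]mulrC -mulrA ler_pM2l ?Q1p//.
  by move: G T0; rewrite -/(D1 z) -/(Q0 z); move: (D1 z) (Q0 z) => p q -> T0; lra.
have nab p : p = a \/ p = a -> exists d C : R, 0 < d /\
    forall z, D z -> z != a -> z != a -> dist2 z p < d -> L z <= C.
  move=> pa; have {pa}-> : p = a by case: pa.
  have [d [C [d0 C0 HC]]] := local_lipschitz (smooth_differentiable (flat_smooth cp) Ua).
  have cQ : {for a, continuous (fun z => Q1 z * (Q0 z)^-1 : R^o)}.
    have sQ1U : smooth (stereo_dom c) Q1.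
      exact: sub_smooth (@subsetT _ _) (smooth_green_denom c a flat_id_cp).
    have sQ0U := smooth_green_denom c' (H a) cp.
    have Q0pU (y : V) : stereo_dom c y -> 0 < Q0 y.
      by move=> Uy; apply: green_denom_gt0; [exact: ltW|exact: HU|exact: HU].
    have := smoothM oU sQ1U (smoothV oU sQ0U Q0pU).
    by move=> sm; exact: smooth_continuous sm Ua.
  have : nbhs a [set z | `|Q1 a * (Q0 a)^-1 - Q1 z * (Q0 z)^-1| < 1].
    exact: (cvgrPdist_lt _ _).1 cQ 1 ltr01.
  move=> /nbhs_ballP [r /= r0 Hr].
  pose M := Q1 a * (Q0 a)^-1 + 1.
  exists (Num.min d (r ^+ 2)), (ln (C * M)); split; first by rewrite lt_min d0 exprn_gt0.
  move=> z Dz za _; rewrite lt_min => /andP[zd zr]; have Oz := DOm z Dz za za.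
  have QM : Q1 z * (Q0 z)^-1 <= M.
    have zr' : `|z - a| < r.
      by rewrite -ltr_sqr ?nnegrE ?(ltW r0)//; exact: le_lt_trans (sqr_norm_le_dot _) zr.
    have := Hr z; rewrite -ball_normE /ball_ /= distrC => /(_ zr').
    by rewrite /M ltr_norml => /andP[H1 _]; move: H1; lra.
  have Q0z := Q0p _ Oz; have D0z := D0p _ Oz; have Q1z := Q1p _ Oz; have D1z := D1p _ Oz.
  have M0 : 0 < M by apply: lt_le_trans QM; rewrite divr_gt0.
  rewrite (LE _ Oz) ler_ln ?posrE ?divr_gt0 ?mulr_gt0//.
  have -> : D1 z * Q1 z / (D0 z * Q0 z) = (D1 z / D0 z) * (Q1 z * (Q0 z)^-1).
    by field; rewrite !gt_eqF.
  apply: ler_pM => //; try by rewrite divr_ge0// ltW.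
  by rewrite ler_pdivrMr//; exact: HC.
have Dz0 : D z0 by [].
have Oz0 := DOm _ Dz0 z0a z0a.
have := punctured_maximum cD oOm sL (fun z Oz => conj Oz.2 Oz.2) LL DOm bD nab Dz0 z0a z0a.
have D0z := D0p _ Oz0; have Q0z := Q0p _ Oz0; have D1z := D1p _ Oz0; have Q1z := Q1p _ Oz0.
rewrite (LE _ Oz0) => /ler_ln_exp.
rewrite !divr_gt0 ?mulr_gt0// invr_gt0 mulr_gt0// => /(_ isT isT).
move=> H1.
have H2 : D1 z0 * Q1 z0 <= (s * (- c' / 4))^-1 * (D0 z0 * Q0 z0).
  by rewrite -ler_pdivrMr// mulr_gt0.
have H3 : s * (- c' / 4) * (D1 z0 * Q1 z0) <= D0 z0 * Q0 z0.
  by rewrite -ler_pdivlMl// mulr_gt0.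
by rewrite mulrA; exact: H3.
Qed.

End SchwarzPick.

Section DiscRigidity.
Context {R : realType}.
Local Notation V := 'rV[R]_2.
Local Notation dist2 x y := (dot (x - y) (x - y)).

Lemma ler_mul_limit (X Y S s0 : R) : 0 <= X -> 0 < s0 -> s0 < S ->
  (forall s, s0 <= s -> s < S -> s * X <= Y) -> S * X <= Y.
Proof.
move=> X0 s00 s0S H; rewrite leNgt; apply/negP => YS.
have Xp : 0 < X.
  rewrite lt_def X0 andbT; apply/eqP => XE.
  by have := H s0 (lexx _) s0S; move: YS; rewrite XE !mulr0; lra.
pose s := Num.max s0 ((Y / X + S) / 2).
have YX : Y / X < S by rewrite ltr_pdivrMr.
have s0s : s0 <= s by rewrite le_max lexx.
have sS : s < S by rewrite gt_max s0S /=; lra.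
have Ys : Y / X < s by rewrite lt_max; apply/orP; right; lra.
have := H s s0s sS; rewrite leNgt => /negP; apply.
by rewrite -ltr_pdivrMr.
Qed.

(** The bound of schwarz_pick_level holds at every level s above that of z, and
    these s are only bounded by - 4 / c: the limit is the sharp inequality. *)
Lemma schwarz_pick c c' (H : V -> V) tau (a z : V) :
  c < 0 -> c' < 0 ->
  conformal_param 0 (stereo_dom c) (fun x => embed_tail (H x)) tau ->
  (forall z, stereo_dom c z -> stereo_dom c' (H z)) ->
  (forall z w, stereo_dom c z -> stereo_dom c w -> H z = H w -> z = w) ->
  stereo_dom c a -> stereo_dom c z ->
  - c' * (dist2 (H z) (H a) * green_denom c a z) <=
  - c * (dist2 z a * green_denom c' (H a) (H z)).
Proof.
move=> c0 c'0 cp HU Hinj Ua Uz.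
have [->|za] := eqVneq z a; first by rewrite !subrr /dot wdot0l !mul0r !mulr0.
have nc : 0 < - c by rewrite oppr_gt0.
have nc' : 0 < - c' by rewrite oppr_gt0.
have Q1 := green_denom_gt0 (ltW c0) Ua Uz.
have D0 : 0 < dist2 z a by rewrite dot_gt0 subr_eq0.
pose s0 := dist2 z a / green_denom c a z.
have s00 : 0 < s0 by rewrite divr_gt0.
have T0 : 0 < stereo_tau c a * stereo_tau c z by rewrite mulr_gt0.
have s0S : s0 < 4 / (- c).
  rewrite ltr_pdivrMr// mulrAC ltr_pdivlMr//.
  move: T0; rewrite green_denomE; move: (green_denom c a z) (dist2 z a) => q p; lra.
have X0 : 0 <= - c' / 4 * (dist2 (H z) (H a) * green_denom c a z).
  by rewrite mulr_ge0 ?divr_ge0 ?(ltW nc')// mulr_ge0 ?dot_ge0// ltW.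
have := ler_mul_limit X0 s00 s0S (Y := dist2 z a * green_denom c' (H a) (H z)).
have L s : s0 <= s -> s < 4 / (- c) ->
    s * (- c' / 4 * (dist2 (H z) (H a) * green_denom c a z)) <=
    dist2 z a * green_denom c' (H a) (H z).
  move=> ss sS; apply: (schwarz_pick_level (ltW c0) c'0 cp HU Hinj Ua _ _ za).
  - exact: lt_le_trans ss.
  - by move: sS; rewrite ltr_pdivlMr//; lra.
  - by move: ss; rewrite /s0 ler_pdivrMr.
move=> /(_ L); rewrite mulrC.
move: (dist2 (H z) (H a) * _) (dist2 z a * _) => p q E.
have -> : - c' * p = - c * (- c' / 4 * p * (4 / - c)) by field; rewrite lt_eqF.
by rewrite ler_pM2l.
Qed.

(** In the plane every level s is allowed in schwarz_pick_level; letting s tend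
    to infinity forces the image to be a point. *)
Lemma no_conformal_plane_to_disc c' (H : V -> V) tau : c' < 0 ->
  conformal_param 0 (stereo_dom 0) (fun x => embed_tail (H x)) tau ->
  (forall z, stereo_dom 0 z -> stereo_dom c' (H z)) ->
  (forall z w, stereo_dom 0 z -> stereo_dom 0 w -> H z = H w -> z = w) -> False.
Proof.
move=> c'0 cp HU Hinj.
have U0 (z : V) : stereo_dom 0 z by rewrite /stereo_dom /= /stereo_tau !mul0r addr0.
have Q1 (z : V) : green_denom 0 0 z = 1.
  by rewrite /green_denom /quadratic scaler0 /dot wdot0l wdot0l !(mulr0, mul0r, addr0).
pose z : V := delta_mx ord0 ord0.
have zz : dist2 z 0 = 1 by rewrite subr0 /dot wdot_delta mxE !eqxx mulr1.
have z0 : z != 0 by rewrite -dot_eq0 -[z]subr0 zz oner_eq0.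
have nc' : 0 < - c' by rewrite oppr_gt0.
have D1 : 0 < dist2 (H z) (H 0).
  by rewrite dot_gt0 subr_eq0; apply/eqP => /(Hinj _ _ (U0 _) (U0 _)) /eqP; rewrite (negPf z0).
pose X := - c' / 4 * dist2 (H z) (H 0).
have X0 : 0 < X by rewrite mulr_gt0// divr_gt0.
pose Y := green_denom c' (H 0) (H z).
have L s : 1 <= s -> s * X <= Y.
  move=> s1; have s0 : 0 < s by lra.
  have := schwarz_pick_level (lexx 0) c'0 cp HU Hinj (U0 0) s0 _ z0 _.
  by rewrite Q1 mulr0 mul0r addr0 ltr01 zz !mulr1 mul1r; apply.
have Ys : 1 <= `|Y| / X + 1 by rewrite lerDr; apply: divr_ge0 => //; exact: ltW.
by have := L _ Ys; rewrite mulrDl mul1r divfK ?gt_eqF//; have := ler_norm Y; lra.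
Qed.

Section InversePair.
Variables (c c' : R) (H K : V -> V) (tH tK : V -> R^o).
Hypothesis cpH : conformal_param 0 (stereo_dom c) (fun x => embed_tail (H x)) tH.
Hypothesis cpK : conformal_param 0 (stereo_dom c') (fun x => embed_tail (K x)) tK.
Hypothesis HU : forall z, stereo_dom c z -> stereo_dom c' (H z).
Hypothesis KU : forall z, stereo_dom c' z -> stereo_dom c (K z).
Hypothesis HK : forall z, stereo_dom c z -> K (H z) = z.
Hypothesis KH : forall z, stereo_dom c' z -> H (K z) = z.

Let Hinj z w : stereo_dom c z -> stereo_dom c w -> H z = H w -> z = w.
Proof. by move=> Uz Uw E; rewrite -(HK Uz) -(HK Uw) E. Qed.

Let Kinj z w : stereo_dom c' z -> stereo_dom c' w -> K z = K w -> z = w.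
Proof. by move=> Uz Uw E; rewrite -(KH Uz) -(KH Uw) E. Qed.

(** Schwarz-Pick for H and for its inverse is an equality of Green functions;
    their quotient at nearby points gives the conformal factor of H. *)
Lemma disc_factor x : c < 0 -> c' < 0 -> stereo_dom c x ->
  stereo_tau c' (H x) * tH x = Num.sqrt (c' / c) * stereo_tau c x.
Proof.
move=> c0 c'0 Ux; have Ux' := HU Ux.
have nc0 : c != 0 by rewrite lt_eqF.
have nc'0 : c' != 0 by rewrite lt_eqF.
have eqn z : stereo_dom c z -> - c' * (dist2 (H z) (H x) * green_denom c x z) =
    - c * (dist2 z x * green_denom c' (H x) (H z)).
  move=> Uz; apply/eqP; rewrite eq_le (schwarz_pick c0 c'0 cpH HU Hinj Ux Uz) /=.
  have := schwarz_pick c'0 c0 cpK KU Kinj Ux' (HU Uz).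
  by rewrite (HK Ux) (HK Uz).
pose F (z : V) : R^o := c / c' * (green_denom c' (H x) (H z) * (green_denom c x z)^-1).
have Q1 z : stereo_dom c z -> 0 < green_denom c x z.
  by move=> Uz; exact: green_denom_gt0 (ltW c0) Ux Uz.
have oU := cp_open cpH.
have sF : smooth (stereo_dom c) F.
  apply: smoothM => //; first exact: smooth_cst.
  apply: smoothM => //; first exact: smooth_green_denom cpH.
  apply: smoothV => //; exact: sub_smooth (@subsetT _ _) (smooth_green_denom c x flat_id_cp).
have cF : {for x, continuous F} := smooth_continuous sF Ux.
have HF z : stereo_dom c z -> dist2 (H z) (H x) = F z * dist2 z x.
  move=> Uz; have := eqn z Uz; have := lt0r_neq0 (Q1 z Uz); rewrite /F.
  move: (dist2 (H z) (H x)) (green_denom c x z) (dist2 z x) (green_denom c' (H x) (H z)) => p q r u q0 E.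
  have -> : c / c' * (u * q^-1) * r = - c * (r * u) / (- c' * q) by field; rewrite ?oppr_eq0 q0 nc'0.
  by rewrite -E; field; rewrite ?oppr_eq0 q0 nc'0.
have := conformal_factor_limit cpH Ux cF HF.
rewrite /F !green_denom_diag.
have t0 : 0 < tH x := cp_tau_gt0 cpH Ux.
have a0 : 0 < stereo_tau c x := Ux.
have b0 : 0 < stereo_tau c' (H x) := Ux'.
move: (tH x) (stereo_tau c x) (stereo_tau c' (H x)) t0 a0 b0 => t a b t0 a0 b0 E.
have cc : 0 <= c' / c by rewrite -mulrNN -invrN divr_ge0// oppr_ge0 ltW.
apply: (@pexpIrn _ 2) => //.
- by rewrite nnegrE mulr_ge0// ltW.
- by rewrite nnegrE mulr_ge0 ?sqrtr_ge0// ltW.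
rewrite !exprMn sqr_sqrtr//.
have -> : b ^+ 2 * t ^+ 2 = c' / c * a ^+ 2 * (c / c' * (b ^+ 2 / a ^+ 2)) * t ^+ 2.
  by field; rewrite nc0 nc'0 gt_eqF.
by rewrite E; field; rewrite nc0 gt_eqF.
Qed.

End InversePair.
End DiscRigidity.

Section PlaneRigidity.
Context {R : realType}.
Local Notation V := 'rV[R]_2.
Local Notation dist2 x y := (dot (x - y) (x - y)).

Lemma conformal_param_restrict m c (U U' : set 'rV[R]_m) h tau :
  conformal_param c U h tau -> open U' -> U' `<=` U -> conformal_param c U' h tau.
Proof.
move=> [_ sh st t0 sf cf] oU' UU'; split => //.
- exact: sub_smooth UU' sh.
- exact: sub_smooth UU' st.
- by move=> x /UU'; exact: t0.
- by move=> x /UU'; exact: sf.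
- by move=> x v w /UU'; exact: cf.
Qed.

Lemma continuous_local_bound (f : V -> R^o) (a : V) : {for a, continuous f} ->
  exists r M : R, [/\ 0 < r, 0 < M & forall z, dist2 z a < r -> f z <= M].
Proof.
move=> cf; have : nbhs a [set z | `|f a - f z| < 1] by exact: (cvgrPdist_lt _ _).1 cf 1 ltr01.
move=> /nbhs_ballP [r /= r0 Hr].
exists (r ^+ 2), (`|f a| + 1); split; rewrite ?exprn_gt0 ?ltr_wpDl// => z zr.
have zr' : `|z - a| < r.
  by rewrite -ltr_sqr ?nnegrE ?(ltW r0)//; exact: le_lt_trans (sqr_norm_le_dot _) zr.
have := Hr z; rewrite -ball_normE /ball_ /= distrC => /(_ zr').
by rewrite ltr_norml => /andP[H1 _]; have := ler_norm (f a); lra.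
Qed.

(** Seen from far away, a and b are almost at the same distance. *)
Lemma far_ratio (a b : V) (eta : R) : 0 < eta -> exists rho : R, 0 < rho /\
  forall y, rho <= dot y y -> dist2 y a <= (1 + eta) * dist2 y b.
Proof.
move=> e0; (* |y - a|^2 <= (1 + eta / 2) |y - b|^2 + (1 + 2 / eta) |b - a|^2, and the last
   term is at most eta / 2 |y - b|^2 when M <= |y - b|^2. *)
pose M := (1 + 2 / eta) * dist2 b a / (eta / 2).
have M0 : 0 <= M.
  by rewrite !mulr_ge0 ?dot_ge0 ?invr_ge0// ?addr_ge0 ?mulr_ge0 ?invr_ge0// ltW// divr_gt0.
have amgm (u v : V) (th : R) : 0 < th -> 2 * dot u v <= th * dot u u + th^-1 * dot v v.
  move=> t0; have := dot_ge0 (th *: u - v).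
  rewrite /dot wdotDl !wdotDr !wdotNl !wdotNr !wdotZl !wdotZr [wdot _ v u]wdotC.
  move: (wdot _ u u) (wdot _ u v) (wdot _ v v) => p q r H.
  rewrite -(ler_pM2l t0) mulrDr mulrA mulrA mulVKf ?gt_eqF//; lra.
have expand (u v : V) : dot (u + v) (u + v) = dot u u + 2 * dot u v + dot v v.
  by rewrite /dot wdotDl !wdotDr [wdot _ v u]wdotC; ring.
exists (2 * (M + dot b b) + 1); split; first by rewrite ltr_wpDl// mulr_ge0// addr_ge0// dot_ge0.
move=> y yM.
have Hyb : M <= dist2 y b.
  have := amgm (y - b) b 1 ltr01; have := expand (y - b) b; rewrite subrK invr1.
  by move: (dist2 y b) (dot (y - b) b) (dot b b) (dot y y) yM => p q r s; lra.
have := expand (y - b) (b - a); rewrite addrA subrK => ->.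
have e2 : 0 < eta / 2 by rewrite divr_gt0.
have := amgm (y - b) (b - a) (eta / 2) e2; rewrite invf_div.
have : (1 + 2 / eta) * dist2 b a <= eta / 2 * dist2 y b.
  by rewrite -ler_pdivrMl// mulrC.
by move: (dist2 y b) (dist2 b a) (dot (y - b) (b - a)) => p q r; lra.
Qed.

Lemma compact_ball (rho : R) : compact [set z : V | dot z z <= rho].
Proof.
apply: bounded_closed_compact.
  exists (`|rho| + 1); split; first exact: num_real.
  move=> x xM z /= Hz; apply: le_trans (ltW xM).
  have := sqr_norm_le_dot z; have := normr_ge0 z; have := ler_norm rho.
  by move: `|z| `|rho| (dot z z) Hz => p q r; nra.
have sm : smooth [set: V] (fun z => dot z z : R^o).
  by apply: smooth_wdot; [exact: openT|exact: smooth_id|exact: smooth_id].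
have -> : [set z : V | dot z z <= rho] = (fun z => dot z z : R^o) @^-1` [set y | y <= rho] by [].
apply: closed_comp; last exact: closed_le.
by move=> x _; exact: (smooth_continuous sm (I : setT x)).
Qed.

Section InversePair.
Variables (U U' : set V) (H K : V -> V) (tH tK : V -> R^o).
Hypothesis cpH : conformal_param 0 U (fun x => embed_tail (H x)) tH.
Hypothesis cpK : conformal_param 0 U' (fun x => embed_tail (K x)) tK.
Hypothesis UT : forall z, U z.
Hypothesis U'T : forall z, U' z.
Hypothesis HK : forall z, K (H z) = z.

(** H tends to infinity at infinity, its inverse being bounded on compact sets. *)
Lemma plane_proper (rho' : R) : exists rho : R, 0 < rho /\
  forall z, rho <= dot z z -> rho' <= dot (H z) (H z).
Proof.
pose D := [set z : V | dot z z <= rho'].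
have cD : compact D := @compact_ball rho'.
have [D0|/set0P D0] := eqVneq D set0.
  exists 1; split => // z _; rewrite leNgt; apply/negP => Hz.
  have : D (H z) by apply: ltW.
  by rewrite D0.
have sK := flat_smooth cpK.
have sKK : smooth U' (fun z => dot (K z) (K z) : R^o) by apply: smooth_wdot => //; exact: cp_open cpK.
have cf : {within D, continuous (fun y => dot (K y) (K y) : R^o)}.
  by apply: continuous_subspaceT => y; exact: smooth_continuous sKK (U'T y).
have [z _ Hz] := EVT_max_rV D0 cD cf.
exists (dot (K z) (K z) + 1); split; first by rewrite ltr_wpDl// dot_ge0.
move=> y Hy; rewrite leNgt; apply/negP => Hlt.
have /Hz : H y \in D by rewrite inE; exact: ltW.
by rewrite HK; lra.
Qed.

Lemma plane_Hinj z w : z != w -> H z != H w.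
Proof. by apply: contra => /eqP E; rewrite -(HK z) -(HK w) E. Qed.

(** The maximum principle for the logarithm of the quotient of the two sides: it
    is harmonic off a and b, bounded above near both, and at most 2 ln (1 + eta) far
    away since H is proper, for every eta > 0. *)
Lemma plane_ratio_le (a b z0 : V) : z0 != a -> z0 != b ->
  dist2 (H z0) (H a) * dist2 z0 b <= dist2 (H z0) (H b) * dist2 z0 a.
Proof.
move=> z0a z0b.
pose Om : set V := [set z | z != a] `&` [set z | z != b].
have oOm : open Om by apply: openI; exact: open_setneq.
have OmU : Om `<=` U by move=> z _; exact: UT.
have dp (x y : V) : x != y -> 0 < dist2 x y by rewrite dot_gt0 subr_eq0.
have sD0 (p : V) : smooth Om (fun z => dist2 z p : R^o) := smooth_dist2 p oOm.
have D1E (p : V) : (fun z => dist2 (H z) (H p) : R^o) =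
   fun z => quadratic (dot (H p) (H p)) (- 2 *: H p) 1 (H z).
  by apply/funext => z; exact: dist2E.
have sD1U (p : V) : smooth U (fun z => dist2 (H z) (H p) : R^o).
  by rewrite D1E; exact: smooth_quadratic cpH _ _ _.
have sD1 (p : V) := sub_smooth OmU (sD1U p).
have Oa z : Om z -> z != a by case.
have Ob z : Om z -> z != b by case.
have D1p p z : z != p -> 0 < dist2 (H z) (H p) by move=> /plane_Hinj /dp.
have sl1 p : (forall z, Om z -> z != p) -> smooth Om (fun z => ln (dist2 (H z) (H p)) : R^o).
  by move=> Hp; apply: smooth_ln => // z /Hp; exact: D1p.
have sl0 p : (forall z, Om z -> z != p) -> smooth Om (fun z => ln (dist2 z p) : R^o).
  by move=> Hp; apply: smooth_ln => // z /Hp; exact: dp.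
pose L (z : V) : R^o := (ln (dist2 (H z) (H a)) + ln (dist2 z b)) +
   -1 * (ln (dist2 (H z) (H b)) + ln (dist2 z a)).
have s1 := smoothD oOm (sl1 a Oa) (sl0 b Ob).
have s2 := smoothD oOm (sl1 b Ob) (sl0 a Oa).
have s3 : smooth Om (fun z => -1 * (ln (dist2 (H z) (H b)) + ln (dist2 z a)) : R^o).
  by apply: smoothM => //; exact: smooth_cst.
have sL : smooth Om L := smoothD oOm s1 s3.
have l1 p z : (forall z, Om z -> z != p) -> Om z ->
    laplacian (fun z => ln (dist2 (H z) (H p)) : R^o) z = 0.
  move=> Hp Oz.
  have -> : (fun z => ln (dist2 (H z) (H p)) : R^o) =
     fun z => ln (quadratic (dot (H p) (H p)) (- 2 *: H p) 1 (H z)).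
    by apply/funext => y; rewrite dist2E.
  apply: (laplacian_ln_quadratic cpH (dist2_null (H p)) oOm OmU _ Oz) => y Oy.
  by rewrite -dist2E; exact/D1p/Hp.
have LL z : Om z -> laplacian L z = 0.
  move=> Oz; rewrite (laplacianD oOm s1 s3 Oz) (laplacianZ (-1) oOm s2 Oz).
  rewrite (laplacianD oOm (sl1 a Oa) (sl0 b Ob) Oz) (laplacianD oOm (sl1 b Ob) (sl0 a Oa) Oz).
  rewrite (l1 a z Oa Oz) (l1 b z Ob Oz).
  by rewrite (laplacian_ln_dist2 oOm Oa Oz) (laplacian_ln_dist2 oOm Ob Oz); ring.
(* L is the logarithm of rat; the bounds are proved for rat. *)
pose rat (z : V) : R := dist2 (H z) (H a) * dist2 z b / (dist2 (H z) (H b) * dist2 z a).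
have LE z : Om z -> L z = ln (rat z).
  move=> [za zb]; have d1 := D1p a z za; have d2 := D1p b z zb.
  have d3 := dp z a za; have d4 := dp z b zb.
  by rewrite ln_div ?posrE ?mulr_gt0// !lnM ?posrE// /L mulN1r.
have ratp z : Om z -> 0 < rat z.
  by move=> [za zb]; rewrite divr_gt0// mulr_gt0 ?D1p ?dp.
have bnd (p : V) (q : V -> R) (f : V -> R^o) : {for p, continuous f} -> forall d C : R, 0 < d -> 0 < C ->
    (forall z, dist2 z p < d -> z != a -> z != b -> q z <= C) ->
    (forall z, Om z -> 0 < f z) -> (forall z, Om z -> 0 < q z) ->
    (forall z, Om z -> rat z = q z * f z) ->
    exists d C : R, 0 < d /\ forall z, True -> z != a -> z != b -> dist2 z p < d -> L z <= C.
  move=> cf d C d0 C0 HC f0 q0 E.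
  have [r [M [r0 M0 HM]]] := continuous_local_bound cf.
  exists (Num.min d r), (ln (C * M)); split; first by rewrite lt_min d0.
  move=> z _ za zb; rewrite lt_min => /andP[zd zr]; have Oz : Om z by split.
  rewrite (LE _ Oz) ler_ln ?posrE; [|exact: ratp|exact: mulr_gt0].
  rewrite (E _ Oz); apply: ler_pM; [exact/ltW/q0|exact/ltW/f0|exact: HC|exact: HM].
have nab p : p = a \/ p = b -> exists d C : R, 0 < d /\
    forall z, True -> z != a -> z != b -> dist2 z p < d -> L z <= C.
  have [da [Ca [da0 Ca0 HCa]]] := local_lipschitz (smooth_differentiable (flat_smooth cpH) (UT a)).
  have [db [Cb [db0 Cb0 HCb]]] := local_lipschitz (smooth_differentiable (flat_smooth cpH) (UT b)).
  have [dk [Ck [dk0 Ck0 HCk]]] := local_lipschitz (smooth_differentiable (flat_smooth cpK) (U'T (H b))).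
  have [ab|ab] := eqVneq a b.
    move=> _; exists 1, 0; split => // z _ za zb _.
    have Oz : Om z by split.
    rewrite (LE _ Oz) /rat -ab divff ?ln1// mulf_neq0// gt_eqF//; [exact: D1p|exact: dp].
  case=> ->.
    have oW : open [set z | z != b] by exact: open_setneq.
    have sW : smooth [set z | z != b] (fun z => dist2 z b * (dist2 (H z) (H b))^-1 : R^o).
      apply: smoothM => //; first exact: smooth_dist2.
      apply: smoothV => //; first by apply: sub_smooth (sD1U b) => z _; exact: UT.
      by move=> z zb; exact: D1p.
    apply: (bnd a (fun z => dist2 (H z) (H a) / dist2 z a) _ (smooth_continuous sW ab) _ _ da0 Ca0).
    - by move=> z zd za zb; rewrite ler_pdivrMr ?dp//; exact: HCa.
    - by move=> z [za zb]; apply: divr_gt0; [exact: dp|exact: D1p].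
    - by move=> z [za zb]; apply: divr_gt0; [exact: D1p|exact: dp].
    - move=> z [za zb]; have := D1p b z zb; have := dp z a za; rewrite /rat.
      by move=> /lt0r_neq0 p1 /lt0r_neq0 p2; field; rewrite p1 p2.
  have ba : b != a by rewrite eq_sym.
  have oW : open [set z | z != a] by exact: open_setneq.
  have sW : smooth [set z | z != a] (fun z => dist2 (H z) (H a) * (dist2 z a)^-1 : R^o).
    apply: smoothM => //; first by apply: sub_smooth (sD1U a) => z _; exact: UT.
    apply: smoothV => //; first exact: smooth_dist2.
    by move=> z za; exact: dp.
  have d0 : 0 < Num.min db (dk / Cb) by rewrite lt_min db0 divr_gt0.
  apply: (bnd b (fun z => dist2 z b / dist2 (H z) (H b)) _ (smooth_continuous sW ba) _ _ d0 Ck0).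
  - move=> z; rewrite lt_min => /andP[zd zk] za zb; rewrite ler_pdivrMr ?D1p//.
    have := HCk (H z); rewrite !HK; apply; apply: (le_lt_trans (HCb z zd)).
    by rewrite mulrC -ltr_pdivlMr.
  - by move=> z [za zb]; apply: divr_gt0; [exact: D1p|exact: dp].
  - by move=> z [za zb]; apply: divr_gt0; [exact: dp|exact: D1p].
  - move=> z [za zb]; have := D1p b z zb; have := dp z a za; rewrite /rat.
    by move=> /lt0r_neq0 p1 /lt0r_neq0 p2; field; rewrite p1 p2.
(* Outside a large disc, far_ratio applies both to z and to H z. *)
have main (eta : R) : 0 < eta -> rat z0 <= (1 + eta) ^+ 2.
  move=> e0; have [r1 [r10 Hr1]] := far_ratio (H a) (H b) e0.
  have [r2 [r20 Hr2]] := plane_proper r1.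
  have [r3 [r30 Hr3]] := far_ratio b a e0.
  pose rho := Num.max (Num.max r2 r3) (dot z0 z0).
  pose D := [set z : V | dot z z <= rho].
  have Dz0 : D z0 by rewrite /D /= /rho le_max lexx orbT.
  have cD : compact D := @compact_ball rho.
  have Oz0 : Om z0 by split.
  have e1 : 0 < (1 + eta) ^+ 2 by rewrite exprn_gt0// addr_gt0.
  have bD z : D z -> z != a -> z != b -> L z <= ln ((1 + eta) ^+ 2) \/ nbhs z D.
    move=> Dz za zb; have [lt|ge] := ltP (dot z z) rho.
      right; have sm : smooth [set: V] (fun z => dot z z : R^o).
        by apply: smooth_wdot; [exact: openT|exact: smooth_id|exact: smooth_id].
      have cs := smooth_continuous sm (I : setT z).
      have : \forall y \near z, dot y y < rho.
        by apply: (cs [set y | y < rho]); apply: open_nbhs_nbhs; split; [exact: open_lt|].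
      by apply: filterS => y /ltW.
    left; have Oz : Om z by split.
    rewrite (LE _ Oz) ler_ln ?posrE; [|exact: ratp|by []].
    rewrite ler_pdivrMr; last by rewrite mulr_gt0 ?D1p ?dp.
    have z2 : r2 <= dot z z by apply: le_trans ge; rewrite /rho !le_max lexx.
    have z3 : r3 <= dot z z by apply: le_trans ge; rewrite /rho !le_max lexx orbT.
    have := Hr1 _ (Hr2 z z2); have := Hr3 z z3.
    have := dot_ge0 (H z - H a); have := dot_ge0 (z - b).
    move: (dist2 (H z) (H a)) (dist2 z b) (dist2 (H z) (H b)) (dist2 z a) => p q r t q0 p0 Hq Hp.
    have -> : (1 + eta) ^+ 2 * (r * t) = ((1 + eta) * r) * ((1 + eta) * t) by ring.
    exact: ler_pM.
  have nabD p : p = a \/ p = b -> exists d C : R, 0 < d /\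
      forall z, D z -> z != a -> z != b -> dist2 z p < d -> L z <= C.
    by move=> /nab [d [C [d0 HC]]]; exists d, C; split => // z _; exact: HC.
  have := punctured_maximum cD oOm sL (fun z Oz => conj (Oa z Oz) (Ob z Oz)) LL
    (fun z _ za zb => conj za zb) bD nabD Dz0 z0a z0b.
  by rewrite (LE _ Oz0) => /ler_ln_exp; apply => //; exact: ratp.
have Oz0 : Om z0 by split.
have : rat z0 <= 1.
  rewrite leNgt; apply/negP => r1.
  pose eta := Num.min 1 ((rat z0 - 1) / 4).
  have e0 : 0 < eta by rewrite lt_min ltr01 divr_gt0// subr_gt0.
  have e1 : eta <= 1 by rewrite ge_min lexx.
  have e2 : eta <= (rat z0 - 1) / 4 by rewrite ge_min lexx orbT.
  by have := main eta e0; move: (rat z0) eta e0 e1 e2 r1 => r eta e0 e1 e2 r1; nra.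
by rewrite ler_pdivrMr ?mul1r// mulr_gt0 ?D1p ?dp.
Qed.

Lemma plane_ratio (a b z : V) :
  dist2 (H z) (H a) * dist2 z b = dist2 (H z) (H b) * dist2 z a.
Proof.
have z00 (x : V) : dist2 x x = 0 by rewrite subrr /dot wdot0l.
have [->|za] := eqVneq z a; first by rewrite !z00 mul0r mulr0.
have [->|zb] := eqVneq z b; first by rewrite !z00 mul0r mulr0.
by apply/eqP; rewrite eq_le !plane_ratio_le.
Qed.

Lemma dist2C (x y : V) : dist2 x y = dist2 y x.
Proof. by rewrite -opprB /dot wdotNl wdotNr opprK. Qed.

Lemma plane_factor (a b : V) : a != b -> dist2 (H a) (H b) = tH a ^- 2 * dist2 a b.
Proof.
move=> ab; have dp (x y : V) : x != y -> 0 < dist2 x y by rewrite dot_gt0 subr_eq0.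
have oW : open [set z | z != b] by exact: open_setneq.
have cpW := conformal_param_restrict cpH oW (fun z _ => UT z).
pose F (z : V) : R^o := dist2 (H z) (H b) * (dist2 z b)^-1.
have sF : smooth [set z | z != b] F.
  apply: smoothM => //.
    apply: sub_smooth (fun z _ => UT z) _.
    under eq_fun do rewrite dist2E; exact: smooth_quadratic cpH _ _ _.
  by apply: smoothV => //; [exact: smooth_dist2|move=> z; exact: dp].
have HF z : z != b -> dist2 (H z) (H a) = F z * dist2 z a.
  move=> zb; rewrite /F mulrAC -plane_ratio mulfK// gt_eqF//; exact: dp.
rewrite -(conformal_factor_limit cpW ab (smooth_continuous sF ab) HF) /F divfK//.
by rewrite gt_eqF//; exact: dp.
Qed.

(** The ratio of the squared distances from H z to H a and from z to a does not
    depend on z by plane_ratio, and it tends to tH a ^- 2 as z tends to a. *)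
Lemma plane_similarity : (forall a b, tH a = tH b) /\
  forall a b, dist2 (H a) (H b) = tH 0 ^- 2 * dist2 a b.
Proof.
have tc a b : tH a = tH b.
  have [->//|ab] := eqVneq a b.
  have E1 := plane_factor ab; have ba : b != a by rewrite eq_sym.
  have := plane_factor ba; rewrite [dist2 (H b) _]dist2C [dist2 b a]dist2C E1.
  have d0 : dist2 a b != 0 by rewrite dot_eq0 subr_eq0.
  move=> /(mulIf d0) /invr_inj /(@pexpIrn _ 2 isT) ->//.
    by rewrite nnegrE ltW// (cp_tau_gt0 cpH).
  by rewrite nnegrE ltW// (cp_tau_gt0 cpH).
split=> // a b; have [->|ab] := eqVneq a b.
  by rewrite !subrr /dot !wdot0l mulr0.
by rewrite (tc 0 a); exact: plane_factor.
Qed.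

End InversePair.
End PlaneRigidity.

Section PlanarHessian.
Context {R : realType}.
Local Notation V := 'rV[R]_2.
Local Notation dist2 x y := (dot (x - y) (x - y)).

Lemma stereo_domT c (z : V) : 0 <= c -> stereo_dom c z.
Proof.
by move=> c0; rewrite /stereo_dom /= /stereo_tau ltr_wpDr// mulr_ge0 ?dot_ge0// divr_ge0.
Qed.

Lemma conformal_param_dom m c (U U' : set 'rV[R]_m) h tau :
  conformal_param c U h tau -> (forall z, U z <-> U' z) -> conformal_param c U' h tau.
Proof.
move=> cp UU'; rewrite (_ : U' = U)//.
by apply/seteqP; split => z /UU'.
Qed.

Lemma hessian_dist2 (k l : R) (a x v w : V) : dot v w = 0 ->
  'D_w ('D_v (fun z => k + l * dist2 z a : R^o)) x = 0.
Proof.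
move=> vw.
have sd := smooth_dist2 a (@openT V).
have sid : smooth [set: V] (fun z => z - a).
  by apply: smoothD; [exact: openT|exact: smooth_id|exact: smooth_cst].
have dc (r : R^o) y := differentiable_cst r (y : V).
have Dv y u : 'D_u (fun z => z - a) y = u.
  have di := smooth_differentiable (smooth_id [set: V]) (I : setT y).
  have da := differentiable_cst (- a) y.
  by rewrite (derive_add u di da) derive_id derive_cst addr0.
have D1 : 'D_v (fun z => k + l * dist2 z a : R^o) = (fun y => l * (2 * dot v (y - a)) : R^o).
  apply/funext => y.
  have dd := smooth_differentiable sd (I : setT y).
  have di := smooth_differentiable sid (I : setT y).
  rewrite (derive_add v (dc k y) (differentiableM (dc l y) dd)) (derive_mulr v (dc l y) dd).
  rewrite !derive_cst (derive_wdot _ v di di) !Dv [wdot _ (y - a) v]wdotC /cst -/(dot v (y - a)).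
  by move: (dot v (y - a)) => p; ring.
rewrite D1.
have di := smooth_differentiable sid (I : setT x).
have dv := differentiable_cst v x.
have d1 : differentiable (fun y => dot v (y - a) : R^o) x by exact: differentiable_wdot dv di.
rewrite (derive_mulr w (dc l x) (differentiableM (dc 2 x) d1)).
rewrite (derive_mulr w (dc 2 x) d1) !derive_cst (derive_wdot _ w dv di) Dv derive_cst.
by rewrite wdot0l -/(dot v w) vw !(mul0r, mulr0, addr0).
Qed.

(** Locally defined planar conformal maps do not have this property: it comes
    from the classification of the global ones, the isometries of the disc up
    to scale (disc_factor) and the similarities of the plane
    (plane_similarity). *)
Lemma planar_hessian (c c' : R) (H K : V -> V) (tH tK : V -> R^o) x v w :
  conformal_param 0 (stereo_dom c) (fun x => embed_tail (H x)) tH ->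
  conformal_param 0 (stereo_dom c') (fun x => embed_tail (K x)) tK ->
  (forall z, stereo_dom c z -> stereo_dom c' (H z)) ->
  (forall z, stereo_dom c' z -> stereo_dom c (K z)) ->
  (forall z, stereo_dom c z -> K (H z) = z) ->
  (forall z, stereo_dom c' z -> H (K z) = z) ->
  stereo_dom c x -> dot v w = 0 ->
  'D_w ('D_v (fun y => stereo_tau c' (H y) * tH y : R^o)) x = 0.
Proof.
move=> cpH cpK HU KU HK KH Ux vw.
have [c0|c0] := ltP c 0; have [c'0|c'0] := ltP c' 0.
- have oU := cp_open cpH.
  have E y : stereo_dom c y -> stereo_tau c' (H y) * tH y = Num.sqrt (c' / c) * stereo_tau c y.
    by move=> Uy; exact: (disc_factor cpH cpK HU KU HK KH c0 c'0 Uy).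
  have st := smooth_stereo_tau c oU.
  pose k : R^o := Num.sqrt (c' / c).
  have DZ (g : V -> R^o) u y : differentiable g y -> 'D_u (fun z => k * g z : R^o) y = k * 'D_u g y.
    move=> dg; rewrite (derive_mulr u (differentiable_cst k y) dg) derive_cst.
    by rewrite mul0r add0r.
  have E1 y : stereo_dom c y ->
     'D_v (fun y => stereo_tau c' (H y) * tH y : R^o) y = k * 'D_v (stereo_tau c) y.
    move=> Uy; rewrite -DZ; last exact: smooth_differentiable st Uy.
    exact: eq_derive_open oU Uy E.
  rewrite (eq_derive_open w oU Ux E1) DZ; last first.
    exact: smooth_differentiable (smooth_derive v st) Ux.
  by rewrite derive2_stereo_tau vw !mulr0.
- exfalso.
  have d0 (z : V) : stereo_dom c' z <-> stereo_dom 0 z by split => _; exact: stereo_domT.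
  have cpK0 := conformal_param_dom cpK d0.
  apply: (no_conformal_plane_to_disc c0 cpK0).
    by move=> z _; apply/KU/stereo_domT.
  move=> z z' _ _ E; rewrite -(KH z); last exact: stereo_domT.
  by rewrite E KH//; exact: stereo_domT.
- exfalso.
  have d0 (z : V) : stereo_dom c z <-> stereo_dom 0 z by split => _; exact: stereo_domT.
  have cpH0 := conformal_param_dom cpH d0.
  apply: (no_conformal_plane_to_disc c'0 cpH0).
    by move=> z _; apply/HU/stereo_domT.
  move=> z z' _ _ E; rewrite -(HK z); last exact: stereo_domT.
  by rewrite E HK//; exact: stereo_domT.
- have UT (z : V) : stereo_dom c z by exact: stereo_domT.
  have U'T (z : V) : stereo_dom c' z by exact: stereo_domT.
  have HKT z := HK z (UT z). have KHT z := KH z (U'T z).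
  have [tc dc] := plane_similarity cpH cpK UT U'T HKT.
  have -> : (fun y => stereo_tau c' (H y) * tH y : R^o) =
     (fun y => tH 0 + (tH 0 * (c' / 4) * tH 0 ^- 2) * dist2 y (K 0) : R^o).
    apply/funext => y; rewrite (tc y 0) /stereo_tau.
    have -> : dot (H y) (H y) = tH 0 ^- 2 * dist2 y (K 0) by rewrite -dc KHT subr0.
    by move: (tH 0) (_ ^- 2) (dist2 y (K 0)) => p q r; ring.
  exact: hessian_dist2.
Qed.

End PlanarHessian.

(** * Second derivatives of compositions *)

Section DeriveAlong.
Context {R : realType}.
Variables (W : normedModType R) (q : nat).
Implicit Types (F G : W -> 'rV[R]_q) (U : set 'rV[R]_q).
Local Notation e k := (delta_mx ord0 k : 'rV[R]_q).

Lemma near_comp_open U F x : open U -> differentiable F x -> U (F x) ->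
  \forall y \near x, U (F y).
Proof.
move=> oU dF UFx; apply: (differentiable_continuous dF).
exact: open_nbhs_nbhs.
Qed.

Lemma derive_along_near U (T : 'rV[R]_q -> R^o) F G x : open U -> smooth U T ->
  differentiable F x -> U (F x) ->
  \near x, (\sum_k (G x ord0 k : R^o) * 'D_(e k) T (F x) = 'D_(G x) T (F x)).
Proof.
move=> oU sT dF Ux; apply: filterS (near_comp_open oU dF Ux) => y Uy.
by rewrite [RHS]derive_dir_coord//; exact: smooth_differentiable sT Uy.
Qed.

Let term U (T : 'rV[R]_q -> R^o) F G x k : smooth U T ->
  differentiable F x -> differentiable G x -> U (F x) ->
  differentiable (fun y => G y ord0 k : R^o) x /\
  differentiable (fun y => 'D_(e k) T (F y) : R^o) x.
Proof.
move=> sT dF dG Ux; split; first exact: (differentiable_mxP _ _).1 dG ord0 k.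
exact: differentiable_comp dF (smooth_differentiable (smooth_derive (e k) sT) Ux).
Qed.

Lemma differentiable_along U (T : 'rV[R]_q -> R^o) F G x : open U -> smooth U T ->
  differentiable F x -> differentiable G x -> U (F x) ->
  differentiable (fun y => 'D_(G y) T (F y) : R^o) x.
Proof.
move=> oU sT dF dG Ux.
apply: near_eq_differentiable (derive_along_near G oU sT dF Ux) _.
apply: differentiable_bigsum => k; have [d1 d2] := term k sT dF dG Ux.
exact: differentiableM.
Qed.

Lemma derive_along U (T : 'rV[R]_q -> R^o) F G x u : open U -> smooth U T ->
  differentiable F x -> differentiable G x -> U (F x) ->
  'D_u (fun y => 'D_(G y) T (F y) : R^o) x =
  'D_('D_u G x) T (F x) + 'D_('D_u F x) ('D_(G x) T) (F x).
Proof.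
move=> oU sT dF dG Ux.
have dT := smooth_differentiable sT Ux.
have dDT k := smooth_differentiable (smooth_derive (e k) sT) Ux.
rewrite -(near_eq_derive u (derive_along_near G oU sT dF Ux)).
have D k : is_derive x u (fun y => (G y ord0 k : R^o) * 'D_(e k) T (F y))
    ('D_u G x ord0 k * 'D_(e k) T (F x) + G x ord0 k * 'D_('D_u F x) ('D_(e k) T) (F x)).
  have [d1 d2] := term k sT dF dG Ux.
  apply: DeriveDef; first by apply: diff_derivable; exact: differentiableM.
  rewrite (derive_mulr u d1 d2) -(derive_coord u ord0 k dG).
  by rewrite -(derive_comp u dF (dDT k)).
rewrite (@derive_val _ _ _ _ _ _ _ (is_derive_bigsum (index_enum 'I_q) predT D)).
rewrite big_split /=; congr (_ + _); first by rewrite [RHS]derive_dir_coord.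
have E : forall y, U y -> 'D_(G x) T y = \sum_k (G x ord0 k : R^o) * 'D_(e k) T y.
  by move=> y Uy; rewrite derive_dir_coord//; exact: smooth_differentiable sT Uy.
rewrite (eq_derive_open ('D_u F x) oU Ux E).
have D' k : is_derive (F x) ('D_u F x) (fun y => (G x ord0 k : R^o) * 'D_(e k) T y)
    (G x ord0 k * 'D_('D_u F x) ('D_(e k) T) (F x)).
  have dc := differentiable_cst (G x ord0 k : R^o) (F x).
  apply: DeriveDef; first by apply: diff_derivable; exact: differentiableM.
  by rewrite (derive_mulr ('D_u F x) dc (dDT k)) derive_cst mul0r add0r.
by rewrite (@derive_val _ _ _ _ _ _ _ (is_derive_bigsum (index_enum 'I_q) predT D')).
Qed.

Lemma derive_along_coord p1 p2 U (T : 'rV[R]_q -> 'M[R]_(p1, p2)) y v i j :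
  smooth U T -> U y -> 'D_v T y i j = 'D_v (fun z => T z i j : R^o) y.
Proof. by move=> sT Uy; rewrite derive_coord//; exact: smooth_differentiable sT Uy. Qed.

Lemma differentiable_along_mx p1 p2 U (T : 'rV[R]_q -> 'M[R]_(p1, p2)) F G x :
  open U -> smooth U T ->
  differentiable F x -> differentiable G x -> U (F x) ->
  differentiable (fun y => 'D_(G y) T (F y)) x.
Proof.
move=> oU sT dF dG Ux; apply/differentiable_mxP => i j.
have sTij := (smooth_mxP _ oU).1 sT i j.
apply: near_eq_differentiable _ (differentiable_along oU sTij dF dG Ux).
apply: filterS (near_comp_open oU dF Ux) => y Uy.
by rewrite (derive_along_coord _ _ _ sT Uy).
Qed.

(** The chain rule for the derivative of T along a vector field G at the moving
    point F: both the direction and the point vary. *)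
Lemma derive_along_mx p1 p2 U (T : 'rV[R]_q -> 'M[R]_(p1, p2)) F G x u :
  open U -> smooth U T ->
  differentiable F x -> differentiable G x -> U (F x) ->
  'D_u (fun y => 'D_(G y) T (F y)) x =
  'D_('D_u G x) T (F x) + 'D_('D_u F x) ('D_(G x) T) (F x).
Proof.
move=> oU sT dF dG Ux; apply/matrixP => i j; rewrite mxE.
have sTij := (smooth_mxP _ oU).1 sT i j.
have E0 := derive_coord u i j (differentiable_along_mx oU sT dF dG Ux).
have E1 := derive_along_coord ('D_u G x) i j sT Ux.
have E2 := derive_along_coord ('D_u F x) i j (smooth_derive (G x) sT) Ux.
apply: (etrans E0); apply: (etrans _ (esym (congr2 +%R E1 E2))).
have N : \near x, ('D_(G x) T (F x) i j = 'D_(G x) (fun z => T z i j : R^o) (F x)).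
  apply: filterS (near_comp_open oU dF Ux) => y Uy.
  exact: derive_along_coord _ _ _ sT Uy.
apply: (etrans (near_eq_derive u N)); apply: (etrans (derive_along u oU sTij dF dG Ux)).
have E3 : 'D_('D_u F x) ('D_(G x) (fun z => T z i j : R^o)) (F x) =
    'D_('D_u F x) (fun z => 'D_(G x) T z i j : R^o) (F x).
  apply: (eq_derive_open _ oU Ux) => y Uy.
  exact: esym (derive_along_coord _ _ _ sT Uy).
exact: (congr1 (fun z => _ + z) E3).
Qed.

End DeriveAlong.
(** * Immersions factored through a conformal parametrization *)

Lemma sff_identity (F : fieldType) (t A B C D p1 p2 q1 q2 : F) :
  t ^+ 3 * A = D * B - p1 * q1 - p2 * q2 -> q1 = 0 -> q2 = 0 -> t != 0 ->
  t * (t ^- 2 * C) + t * A = t^-1 * C + t ^- 2 * D * B.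
Proof.
move=> H q10 q20 t0; have -> : A = t ^- 3 * (D * B).
  by rewrite q10 q20 !mulr0 !subr0 in H; rewrite -H mulKf// expf_neq0.
by field.
Qed.

Lemma shape_identity (F : fieldType) q (G S : 'M[F]_q) (t D : F) :
  t != 0 -> G \in unitmx ->
  (t^-1 *: S + (t ^- 2 * D) *: G) *m invmx (t ^- 2 *: G) =
  t *: (S *m invmx G) + D%:M.
Proof.
move=> t0 uG; have t2 : t ^- 2 != 0 by rewrite invr_neq0// expf_neq0.
rewrite invmxZ ?unitmxZ ?unitfE// invrK mulmxDl -!scalemxAl -!scalemxAr (mulmxV uG).
by rewrite !scalerA scalemx1; congr (_ *: _ + _%:M); field.
Qed.

Section Transfer.
Context {R : realType}.
Variables (n p : nat) (M : smooth_manifold R n).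
Local Notation m := (n + p)%N.
Variable f0 : M -> 'rV[R]_m.
Hypothesis sf0 : forall a, atlas M a -> smooth (chart_codom a) (f0 \o chart_inv a).
Local Notation e i := (delta_mx ord0 i).

Lemma chart_pointP (a : chart R n M) x : atlas M a -> chart_dom a x ->
  [/\ open (chart_codom a), chart_codom a (chart_map a x) &
      chart_inv a (chart_map a x) = x].
Proof.
move=> aM ax; have [_ oc inv _ _] := atlas_chart aM.
by split => //; [exists x|exact: inv].
Qed.

(** The flat counterparts of the tangent map, the Gram matrix and the shape
    operator; the normals are those of f0 in the flat domain. *)
Definition flat_push (a : chart R n M) x (X : 'rV[R]_n) : 'rV[R]_m :=
  'D_X (f0 \o chart_inv a) (chart_map a x).

Definition flat_gram (a : chart R n M) x : 'M[R]_n :=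
  \matrix_(i, j) dot (flat_push a x (e i)) (flat_push a x (e j)).

Definition flat_sff (a : chart R n M) x (xi0 : 'rV[R]_m) : 'M[R]_n :=
  \matrix_(i, j) dot
    ('D_(e i) ('D_(e j) (f0 \o chart_inv a)) (chart_map a x)) xi0.

Definition flat_shape a x xi0 : 'M[R]_n := flat_sff a x xi0 *m invmx (flat_gram a x).

Definition flat_unit_normal x (xi0 : 'rV[R]_m) : Prop :=
  dot xi0 xi0 = 1 /\
  forall a X, atlas M a -> chart_dom a x -> dot (flat_push a x X) xi0 = 0.

Lemma flat_shapeN a x xi0 : flat_shape a x (- xi0) = - flat_shape a x xi0.
Proof.
rewrite /flat_shape -mulNmx; congr (_ *m _).
by apply/matrixP => i j; rewrite !mxE /dot wdotNr.
Qed.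

Lemma flat_unit_normalN x xi0 : flat_unit_normal x xi0 -> flat_unit_normal x (- xi0).
Proof.
move=> [u1 u2]; split; first by rewrite /dot wdotNl wdotNr opprK.
by move=> a X aM ax; rewrite /dot wdotNr -/(dot _ _) u2// oppr0.
Qed.

Lemma differentiable_flat a x : atlas M a -> chart_dom a x ->
  differentiable (f0 \o chart_inv a) (chart_map a x).
Proof.
by move=> aM ax; have [oc cx ix] := chart_pointP aM ax; exact: smooth_differentiable (sf0 aM) cx.
Qed.

Section Parametrized.
Variables (c : R) (U : set 'rV[R]_m) (h : 'rV[R]_m -> 'rV[R]_m.+1) (tau : 'rV[R]_m -> R^o).
Hypothesis cp : conformal_param c U h tau.
Hypothesis f0U : forall x, U (f0 x).
Local Notation f := (fun x => h (f0 x)).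
Local Notation om := (ambient_weight c (m := m)).
Let oU := cp_open cp.
Let sh := cp_smooth cp.

Lemma pushforward_param a x X : atlas M a -> chart_dom a x ->
  Defs.pushforward f a x X = 'D_(flat_push a x X) h (f0 x).
Proof.
move=> aM ax; have [oc cx ix] := chart_pointP aM ax.
have d0 := differentiable_flat aM ax.
have dh : differentiable h ((f0 \o chart_inv a) (chart_map a x)).
  by apply: smooth_differentiable sh _; exact: f0U.
apply: (etrans (derive_comp X d0 dh)).
by rewrite /flat_push /= ix.
Qed.

Lemma local_repr_smooth a : atlas M a -> smooth (chart_codom a) (local_repr f a).
Proof.
move=> aM; have [_ oc _ _ _] := atlas_chart aM.
by apply: (smooth_comp oc oU _ (sf0 aM) sh) => u _; exact: f0U.
Qed.

Lemma pushforward_dot a x X Y : atlas M a -> chart_dom a x ->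
  ambient_form c (Defs.pushforward f a x X) (Defs.pushforward f a x Y) =
  tau (f0 x) ^- 2 * dot (flat_push a x X) (flat_push a x Y).
Proof.
move=> aM ax; rewrite (pushforward_param X aM ax) (pushforward_param Y aM ax).
by rewrite ambient_formE; exact: (cp_dot cp _ _ (f0U x)).
Qed.

(** D_xi0 h has the length of xi0 divided by tau, so the factor makes the lift of
    normals isometric. *)
Definition normal_lift (x : M) (xi0 : 'rV[R]_m) : 'rV[R]_m.+1 := tau (f0 x) *: 'D_xi0 h (f0 x).

(** The inverse of the lift, by duality: the product of xi with D_z h is that of
    its flat counterpart with z, divided by tau. *)
Definition normal_lower (x : M) (xi : 'rV[R]_m.+1) : 'rV[R]_m :=
  \row_j (tau (f0 x) * wdot om xi ('D_(e j) h (f0 x))).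

Lemma lower_dot x xi z : dot (normal_lower x xi) z = tau (f0 x) * wdot om xi ('D_z h (f0 x)).
Proof.
have dh := smooth_differentiable sh (f0U x).
rewrite (derive_dir_coord z dh) wdot_sumr mulr_sumr /dot wdotE.
by apply: eq_bigr => j _; rewrite mxE wdotZr mul1r; ring.
Qed.

Lemma lift_dot x xi0 z :
  wdot om (normal_lift x xi0) ('D_z h (f0 x)) = (tau (f0 x))^-1 * dot xi0 z.
Proof.
rewrite wdotZl (cp_dot cp _ _ (f0U x)); have t0 := cp_tau_neq0 cp (f0U x).
by move: (dot xi0 z) => d; field.
Qed.

Lemma dot_ext q (u v : 'rV[R]_q) : (forall z, dot u z = dot v z) -> u = v.
Proof.
move=> H; apply/eqP; rewrite -subr_eq0 -dot_eq0; apply/eqP.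
by rewrite {1}/dot wdotDl wdotNl -!/(dot _ _) H subrr.
Qed.

Lemma normal_liftK x xi0 : normal_lower x (normal_lift x xi0) = xi0.
Proof.
apply: dot_ext => z; rewrite lower_dot lift_dot mulVKf//; exact: (cp_tau_neq0 cp (f0U x)).
Qed.

Lemma lift_tangent x xi0 : space_form_tangent c (f x) (normal_lift x xi0).
Proof.
by apply/space_form_tangentE; rewrite wdotZl (cp_normal cp _ (f0U x)) mulr0.
Qed.

Lemma normal_lowerK x xi : space_form_tangent c (f x) xi -> normal_lift x (normal_lower x xi) = xi.
Proof.
move=> /space_form_tangentE txi; apply/eqP; rewrite -subr_eq0; apply/eqP.
have t0 := cp_tau_neq0 cp (f0U x).
apply: (cp_nondegenerate cp (f0U x)) => [|z]; rewrite wdotDl wdotNl.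
  by rewrite (space_form_tangentE _ _ _).1 ?txi ?subrr//; exact: lift_tangent.
by rewrite lift_dot lower_dot mulKf// subrr.
Qed.

Lemma lift_norm x xi0 : wdot om (normal_lift x xi0) (normal_lift x xi0) = dot xi0 xi0.
Proof.
rewrite {2}/normal_lift wdotZr lift_dot mulVKf//; exact: (cp_tau_neq0 cp (f0U x)).
Qed.

Lemma lift_unit_normal x xi0 : flat_unit_normal x xi0 -> unit_normals c f (x, normal_lift x xi0).
Proof.
move=> [n1 nX]; split; last by rewrite /= ambient_formE lift_norm.
split; first exact: lift_tangent.
move=> a X aM ax; rewrite (pushforward_param X aM ax) ambient_formE /= wdotC lift_dot.
by rewrite /dot wdotC -/(dot _ _) nX// mulr0.
Qed.

Lemma lower_unit_normal x xi : unit_normals c f (x, xi) ->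
  flat_unit_normal x (normal_lower x xi) /\ normal_lift x (normal_lower x xi) = xi.
Proof.
move=> [[/= txi nX] n1]; have E := normal_lowerK txi; split => //; split.
  by rewrite -(lift_norm x) E -ambient_formE.
move=> a X aM ax; rewrite /dot wdotC -/(dot _ _) lower_dot wdotC -ambient_formE.
by rewrite -(pushforward_param X aM ax) nX// mulr0.
Qed.

Lemma wdot_tangential y v w : space_form_tangent c y v ->
  wdot om (tangential_part c y w) v = wdot om w v.
Proof.
move=> /space_form_tangentE; rewrite /tangential_part wdotDl wdotNl wdotZl /position_normal.
have [c0|c0] := eqVneq c 0; first by rewrite c0 !mul0r subr0.
by rewrite [wdot _ v y]wdotC => ->; rewrite mulr0 subr0.
Qed.

(** The chain rule splits a second derivative of h o f0 into the first derivative
    of h along the second derivative of f0 and the second derivative of h along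
    two tangent vectors of f0; the Koszul formula evaluates the latter against
    the lifted normal, two of its three terms vanishing by orthogonality. *)
Lemma lift_sff a x xi0 : atlas M a -> chart_dom a x -> flat_unit_normal x xi0 ->
  second_fundamental_form c f a x (normal_lift x xi0) =
  (tau (f0 x))^-1 *: flat_sff a x xi0 +
  (tau (f0 x) ^- 2 * 'D_xi0 tau (f0 x)) *: flat_gram a x.
Proof.
move=> aM ax [_ nX]; have [oc cx ix] := chart_pointP aM ax.
apply/matrixP => i j; rewrite !mxE ambient_formE (wdot_tangential _ (lift_tangent x xi0)).
have s0 := sf0 aM; have d0 := differentiable_flat aM ax.
have dD := smooth_differentiable (smooth_derive (e j) s0) cx.
have E : 'D_(e i) (fun u => 'D_(e j) (local_repr f a) u) (chart_map a x) =
    'D_(e i) (fun u => 'D_('D_(e j) (f0 \o chart_inv a) u) h ((f0 \o chart_inv a) u)) (chart_map a x).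
  apply: (eq_derive_open _ oc cx) => u cu.
  exact: derive_comp (smooth_differentiable s0 cu) (smooth_differentiable sh (f0U _)).
have U0 : U ((f0 \o chart_inv a) (chart_map a x)) by exact: f0U.
have E2 := derive_along_mx (e i) oU sh d0 dD U0.
have fx : (f0 \o chart_inv a) (chart_map a x) = f0 x by rewrite /= ix.
rewrite fx in E2.
rewrite (etrans E E2) wdotDl /normal_lift !wdotZr (cp_dot cp _ _ (f0U x)).
have K := cp_koszul cp (flat_push a x (e i)) (flat_push a x (e j)) xi0 (f0U x).
exact: (sff_identity _ K (nX a (e j) aM ax) (nX a (e i) aM ax) (cp_tau_neq0 cp (f0U x))).
Qed.

Lemma gram_pair_delta (G : 'M[R]_n) i j : gram_pair G (e i) (e j) = G i j.
Proof. by rewrite /gram_pair -rowE trmx_delta -colE !mxE. Qed.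

Lemma gram_param (g : riemannian_metric M) a x : isometric_immersion c g f ->
  atlas M a -> chart_dom a x ->
  gram g a (chart_map a x) = tau (f0 x) ^- 2 *: flat_gram a x.
Proof.
move=> [_ gf] aM ax; have [_ gX] := (gf a aM).2 x ax.
apply/matrixP => i j; rewrite -gram_pair_delta -gX (pushforward_dot _ _ aM ax).
by rewrite !mxE.
Qed.

Lemma flat_gram_unit (g : riemannian_metric M) a x : isometric_immersion c g f ->
  atlas M a -> chart_dom a x -> flat_gram a x \in unitmx.
Proof.
move=> gf aM ax; have [oc cx _] := chart_pointP aM ax.
rewrite -row_free_unit; apply/inj_row_free => X X0.
apply/eqP; apply: contraT => Xn0; have := gram_pos g aM cx Xn0.
by rewrite (gram_param gf aM ax) /gram_pair -scalemxAr X0 scaler0 mul0mx mxE ltxx.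
Qed.

(** The key to both claims: the parametrization only changes the shape operator
    by an affine map with scalar coefficients. *)
Lemma lift_shape (g : riemannian_metric M) a x xi0 : isometric_immersion c g f ->
  atlas M a -> chart_dom a x -> flat_unit_normal x xi0 ->
  shape_operator c g f a x (normal_lift x xi0) =
  tau (f0 x) *: flat_shape a x xi0 + ('D_xi0 tau (f0 x))%:M.
Proof.
move=> gf aM ax nX; have t0 := cp_tau_neq0 cp (f0U x).
have uG := flat_gram_unit gf aM ax.
rewrite /shape_operator (lift_sff aM ax nX) (gram_param gf aM ax) /flat_shape.
exact: (shape_identity _ _ t0 uG).
Qed.
Lemma affine_eigenspace (q : nat) (A : 'M[R]_q) (t s r : R) (X : 'rV[R]_q) : t != 0 ->
  (X *m (t *: A + s%:M) == (t * r + s) *: X) = (X *m A == r *: X).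
Proof.
move=> t0; rewrite mulmxDr -scalemxAr mul_mx_scalar scalerDl -scalerA.
by rewrite (inj_eq (addIr _)) (inj_eq (scalerI t0)).
Qed.

Lemma affine_eigenvalue (q : nat) (A : 'M[R]_q) (t s r : R) : t != 0 ->
  eigenvalue (t *: A + s%:M) (t * r + s) = eigenvalue A r.
Proof.
move=> t0; apply/eigenvalueP/eigenvalueP => -[X /eqP XA X0]; exists X => //; apply/eqP.
  by rewrite -(affine_eigenspace _ s _ _ t0).
by rewrite affine_eigenspace.
Qed.

Lemma lift_eigenvalue (g : riemannian_metric M) a x xi0 r : isometric_immersion c g f ->
  atlas M a -> chart_dom a x -> flat_unit_normal x xi0 ->
  eigenvalue (shape_operator c g f a x (normal_lift x xi0))
    (tau (f0 x) * r + 'D_xi0 tau (f0 x)) = eigenvalue (flat_shape a x xi0) r.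
Proof.
move=> gf aM ax nX; rewrite (lift_shape gf aM ax nX).
exact: (affine_eigenvalue _ _ _ (cp_tau_neq0 cp (f0U x))).
Qed.

(** The normals at x form the kernel of a matrix of rank n with n + 1 rows. *)
Lemma hypersurface_normal (g : riemannian_metric M) x xi0 nu0 :
  p = 1%N -> isometric_immersion c g f ->
  flat_unit_normal x xi0 -> flat_unit_normal x nu0 -> xi0 = nu0 \/ xi0 = - nu0.
Proof.
move=> p1 gf [nx xX] [nn nX]; have [a aM ax] := atlas_cover x.
pose P : 'M[R]_(n, m) := \matrix_i flat_push a x (e i).
have PG : P *m P^T = flat_gram a x.
  by apply/matrixP => i j; rewrite !mxE /dot wdotE; apply: eq_bigr => l _; rewrite !mxE mul1r.
have ker u : (forall X, dot (flat_push a x X) u = 0) -> (u <= kermx P^T)%MS.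
  move=> uX; apply/sub_kermxP/rowP => i; rewrite mxE [RHS]mxE.
  rewrite -[RHS](uX (e i)) /dot wdotE; apply: eq_bigr => l _.
  by rewrite !mxE mul1r mulrC.
have rP : (n <= \rank P^T)%N.
  have := mxrankM_maxr P P^T; rewrite PG mxrank_unit//; exact: flat_gram_unit gf aM ax.
have nu_neq0 : nu0 != 0.
  by apply: contra_eq_neq nn => ->; rewrite /dot wdot0l eq_sym oner_neq0.
have kn : (nu0 <= kermx P^T)%MS by apply: ker => X; exact: nX.
have kx : (xi0 <= kermx P^T)%MS by apply: ker => X; exact: xX.
have kk : (kermx P^T <= nu0)%MS.
  rewrite -(mxrank_leqif_sup kn) mxrank_ker rank_rV nu_neq0 /= eqn_leq.
  rewrite (leq_trans (leq_sub2l _ rP)) ?addKn ?p1// andbT.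
  by have := mxrankS kn; rewrite mxrank_ker rank_rV nu_neq0.
have /sub_rVP[s E] := submx_trans kx kk.
have : s ^+ 2 = 1.
  by have := nx; rewrite E /dot wdotZl wdotZr -/(dot _ _) nn mulr1 expr2.
move/eqP; rewrite sqrf_eq1 => /orP[] /eqP s1; rewrite E s1.
  by left; rewrite scale1r.
by right; rewrite scaleN1r.
Qed.

Section Curve.
Variables (N : set R^o) (x : R -> M).
Hypothesis oN : open N.
Hypothesis cx : forall t, N t -> {for t, continuous x}.
Hypothesis sx : forall a, atlas M a ->
  smooth (N `&` x @^-1` chart_dom a) (chart_map a \o x : R^o -> _).
Local Notation gam := (fun t : R^o => f0 (x t)).

Lemma open_curve_dom a : atlas M a -> open (N `&` x @^-1` chart_dom a : set R^o).
Proof.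
move=> aM; have [od _ _ _ _] := atlas_chart aM.
rewrite openE => t [Nt at']; apply: (@filterI _ (nbhs (t : R^o))).
  exact: open_nbhs_nbhs.
by apply: (cx Nt); exact: open_nbhs_nbhs.
Qed.

Lemma curve_in_chart a t : atlas M a -> chart_dom a (x t) ->
  gam t = (f0 \o chart_inv a) ((chart_map a \o x) t).
Proof. by move=> aM at'; have [_ _ ix] := chart_pointP aM at'; rewrite /= ix. Qed.

(** The curve is only known to be smooth in the charts, hence the localization. *)
Lemma smooth_curve : smooth N gam.
Proof.
apply: smooth_local => t Nt; have [a aM at'] := atlas_cover (x t).
exists (N `&` x @^-1` chart_dom a); split => //.
have oD := open_curve_dom aM; have [_ oc _ _ _] := atlas_chart aM.
have E u : (N `&` x @^-1` chart_dom a) u ->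
    (f0 \o chart_inv a) ((chart_map a \o x) u) = gam u.
  by move=> [_ au]; rewrite (curve_in_chart aM au).
apply: (eq_smooth oD E); apply: (smooth_comp oD oc _ (sx aM) (sf0 aM)) => u [_ au].
by have [_ cu _] := chart_pointP aM au.
Qed.

Lemma derive_curve a t : atlas M a -> N t -> chart_dom a (x t) ->
  'D_1 gam t = flat_push a (x t) ('D_1 (chart_map a \o x : R^o -> _) t).
Proof.
move=> aM Nt at'; have oD := open_curve_dom aM.
have E u : (N `&` x @^-1` chart_dom a) u ->
    gam u = (f0 \o chart_inv a) ((chart_map a \o x) u).
  by move=> [_ au]; rewrite (curve_in_chart aM au).
have dx : differentiable (chart_map a \o x : R^o -> _) t by exact: (smooth_differentiable (sx aM)).
have E1 : 'D_1 gam t = 'D_1 ((f0 \o chart_inv a) \o (chart_map a \o x : R^o -> _)) t.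
  exact: (eq_derive_open _ oD (conj Nt at') E).
rewrite E1.
exact: (derive_comp (1 : R^o) dx (differentiable_flat aM at')).
Qed.

Lemma smooth_along q (xi0 : R^o -> 'rV[R]_m) (T : 'rV[R]_m -> 'rV[R]_q) :
  smooth U T -> smooth N xi0 -> smooth N (fun t : R^o => 'D_(xi0 t) T (gam t)).
Proof.
move=> sT sxi.
have E t : N t -> \sum_j xi0 t ord0 j *: 'D_(e j) T (gam t) = 'D_(xi0 t) T (gam t).
  by move=> Nt; rewrite [RHS]derive_dir_coord//; exact: smooth_differentiable sT (f0U _).
apply: (eq_smooth oN E); apply: smooth_sum => // j.
apply: smoothZ => //; first exact: (smooth_mxP _ oN).1 sxi ord0 j.
exact: (smooth_comp oN oU (fun t _ => f0U (x t)) smooth_curve (smooth_derive (e j) sT)).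
Qed.

Lemma smooth_lift_curve (xi0 : R^o -> 'rV[R]_m) :
  smooth N xi0 -> smooth N (fun t : R^o => normal_lift (x t) (xi0 t)).
Proof.
move=> sxi; apply: smoothZ => //; last exact: smooth_along.
exact: (smooth_comp_scalar oN (fun t _ => f0U (x t)) smooth_curve (cp_tau_smooth cp)).
Qed.

Lemma smooth_lower_curve (xi : R^o -> 'rV[R]_m.+1) :
  smooth N xi -> smooth N (fun t : R^o => normal_lower (x t) (xi t)).
Proof.
move=> sxi; apply/(smooth_mxP _ oN) => i j; rewrite (ord1 i).
have sw : smooth N (fun t : R^o => tau (gam t) * wdot om (xi t) ('D_(e j) h (gam t)) : R^o).
  apply: smoothM => //.
    exact: (smooth_comp_scalar oN (fun t _ => f0U (x t)) smooth_curve (cp_tau_smooth cp)).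
  apply: smooth_wdot => //.
  exact: (smooth_comp oN oU (fun t _ => f0U (x t)) smooth_curve (smooth_derive (e j) sh)).
by apply: (eq_smooth oN _ sw) => t _; rewrite mxE.
Qed.

End Curve.

Lemma lift_velocity_identity (F : fieldType) (t t' a b s q A Dz D : F) : t != 0 ->
  t ^+ 3 * A = Dz * q - t' * a - D * s -> q = 0 ->
  t' * (t ^- 2 * a) + t * (t ^- 2 * b + A) = t^-1 * b - t ^- 2 * D * s.
Proof.
move=> t0 H q0; have -> : A = t ^- 3 * (- t' * a - D * s).
  by rewrite q0 mulr0 sub0r in H; rewrite mulNr -H mulKf// expf_neq0.
by field.
Qed.

(** The derivative of a lifted normal along a curve, tested on tangent vectors: the
    terms of the Koszul formula in D_z tau and in the derivative of tau along the
    curve disappear, the first by orthogonality and the second by the factor tau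
    of the lift. *)
Lemma lift_velocity_dot (x : R -> M) (xi0 : R^o -> 'rV[R]_m) (t : R^o) z :
  differentiable (fun t : R^o => f0 (x t)) t -> differentiable xi0 t ->
  dot ('D_1 (fun t : R^o => f0 (x t)) t) (xi0 t) = 0 ->
  wdot om ('D_1 (fun t : R^o => normal_lift (x t) (xi0 t)) t) ('D_z h (f0 (x t))) =
  (tau (f0 (x t)))^-1 * dot ('D_1 xi0 t) z
  - tau (f0 (x t)) ^- 2 * 'D_(xi0 t) tau (f0 (x t)) *
    dot ('D_1 (fun t : R^o => f0 (x t)) t) z.
Proof.
set gam := fun t : R^o => f0 (x t) => dg dxi ort.
have Ut : U (gam t) by exact: f0U.
have dtau : differentiable tau (gam t) by exact: (smooth_differentiable (cp_tau_smooth cp) Ut).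
have dtg : differentiable (tau \o gam : R^o -> R^o) t by exact: differentiable_comp.
have dDh := differentiable_along_mx oU sh dg dxi Ut.
have E1 := derive_scale (1 : R^o) dtg dDh.
have E2 := derive_along_mx (1 : R^o) oU sh dg dxi Ut.
have E3 := derive_comp (1 : R^o) dg dtau.
rewrite E2 E3 in E1.
have E4 : wdot om ('D_1 (fun t : R^o => normal_lift (x t) (xi0 t)) t) ('D_z h (f0 (x t))) =
    wdot om ('D_('D_1 gam t) tau (gam t) *: 'D_(xi0 t) h (gam t) +
     tau (gam t) *: ('D_('D_1 xi0 t) h (gam t) + 'D_('D_1 gam t) ('D_(xi0 t) h) (gam t)))
    ('D_z h (gam t)) by rewrite -E1.
rewrite E4 wdotDl wdotZl wdotZl wdotDl (cp_dot cp (xi0 t) z Ut) (cp_dot cp ('D_1 xi0 t) z Ut).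
exact: (lift_velocity_identity _ (cp_tau_neq0 cp Ut)
  (cp_koszul cp ('D_1 gam t) (xi0 t) z Ut) ort).
Qed.

Lemma tangential_tangent (y w : 'rV[R]_m.+1) : space_form c y -> (c = 0 -> w ord0 ord0 = 0) ->
  space_form_tangent c y (tangential_part c y w).
Proof.
rewrite /space_form /space_form_tangent /tangential_part /=.
have [c0|c0] := eqVneq c 0; first by move=> _ /(_ c0) w0; rewrite c0 mul0r scale0r subr0.
move=> [yy _] _; rewrite !ambient_formE wdotDl wdotNl wdotZl.
by rewrite -!ambient_formE yy mulrAC mulfV// mul1r subrr.
Qed.

Lemma velocity_identity (F : fieldType) (t b s k D : F) : t != 0 ->
  (t^-1 * b - t ^- 2 * D * s == - (t * k + D) * (t ^- 2 * s)) = (b == - k * s).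
Proof.
move=> t0; rewrite -subr_eq0 -[RHS]subr_eq0.
have -> : t^-1 * b - t ^- 2 * D * s - - (t * k + D) * (t ^- 2 * s) = t^-1 * (b - - k * s).
  by field.
by rewrite mulf_eq0 invr_eq0 (negPf t0).
Qed.

Lemma tangent_ext (y : 'rV[R]_m) (v w : 'rV[R]_m.+1) : U y ->
  space_form_tangent c (h y) v -> space_form_tangent c (h y) w ->
  (forall z, wdot om v ('D_z h y) = wdot om w ('D_z h y)) -> v = w.
Proof.
move=> Uy /space_form_tangentE tv /space_form_tangentE tw H.
apply/eqP; rewrite -subr_eq0; apply/eqP.
apply: (cp_nondegenerate cp Uy) => [|z]; rewrite wdotDl wdotNl; last by rewrite H subrr.
by rewrite tv tw subrr.
Qed.

Lemma conj_iff (P P' Q Q' : Prop) : (P <-> P') -> (P' -> (Q <-> Q')) ->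
  (P /\ Q <-> P' /\ Q').
Proof. by tauto. Qed.

(** Tested on the vectors D_z h, the equation that says that the velocity lies in
    T_i loses its dependence on h: in the flat picture, the normal moves by minus
    the principal curvature times the velocity of the base point. *)
Lemma velocity_param (g : riemannian_metric M) a (x : R -> M) (xi : R -> 'rV[R]_m.+1)
    (xi0 : R^o -> 'rV[R]_m) (N : set R^o) k0 :
  isometric_immersion c g f -> atlas M a -> chart_dom a (x 0) ->
  open N -> N 0 -> (forall t, N t -> xi t = normal_lift (x t) (xi0 t)) ->
  flat_unit_normal (x 0) (xi0 0) ->
  differentiable (fun t : R^o => f0 (x t)) (0 : R^o) -> differentiable xi0 (0 : R^o) ->
  'D_1 (fun t : R^o => f0 (x t)) (0 : R^o) = flat_push a (x 0) (curve_velocity a x) ->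
  velocity_in_T c g f a x xi
    (tau (f0 (x 0)) * k0 + 'D_(xi0 0) tau (f0 (x 0))) <->
  curve_velocity a x *m flat_shape a (x 0) (xi0 0) = k0 *: curve_velocity a x /\
  'D_1 xi0 (0 : R^o) = - k0 *: 'D_1 (fun t : R^o => f0 (x t)) (0 : R^o).
Proof.
move=> gf aM ax oN N0 xiE nX dg dxi EX.
set X := curve_velocity a x in EX *; set X0 := 'D_1 (fun t : R^o => f0 (x t)) (0 : R^o) in EX *.
have t0 := cp_tau_neq0 cp (f0U (x 0)).
have ort : dot X0 (xi0 0) = 0 by rewrite EX (nX.2 a X aM ax).
have wE : derive1 xi 0 = 'D_1 (fun t : R^o => normal_lift (x t) (xi0 t)) (0 : R^o).
  by apply: (etrans (derive1E xi 0)); apply: (eq_derive_open (1 : R^o) oN N0).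
have dlift : differentiable (fun t : R^o => normal_lift (x t) (xi0 t)) (0 : R^o).
  apply: differentiable_scale; last exact: (differentiable_along_mx oU sh dg dxi (f0U (x 0))).
  have dtau := smooth_differentiable (cp_tau_smooth cp) (f0U (x 0)).
  have dtg : differentiable (tau \o (fun t : R^o => f0 (x t)) : R^o -> R^o) (0 : R^o).
    exact: (differentiable_comp dg dtau).
  exact: dtg.
have vel := lift_velocity_dot _ dg dxi ort.
rewrite /velocity_in_T (xiE 0 N0) (lift_shape gf aM ax nX) wE.
set D := 'D_(xi0 0) tau (f0 (x 0)) in vel *.
set w := 'D_1 (fun t : R^o => normal_lift (x t) (xi0 t)) (0 : R^o) in vel wE *.
set S := flat_shape _ _ _; set t := tau (f0 (x 0)) in t0 vel *.
have eigE : (X <= eigenspace (t *: S + D%:M) (t * k0 + D))%MS <-> X *m S = k0 *: X.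
  split=> [/eigenspaceP/eqP|/eqP XS].
    by rewrite (affine_eigenspace _ _ _ _ t0) => /eqP.
  by apply/eigenspaceP/eqP; rewrite (affine_eigenspace _ _ _ _ t0).
apply: (conj_iff eigE) => XS.
have -> : X *m (t *: S + D%:M) = (t * k0 + D) *: X.
  by apply/eqP; rewrite (affine_eigenspace _ _ _ _ t0) XS.
set r := t * k0 + D.
have pE : - Defs.pushforward f a (x 0) (r *: X) = 'D_(- r *: X0) h (f0 (x 0)).
  rewrite (pushforward_param _ aM ax) EX.
  have dh := smooth_differentiable sh (f0U (x 0)).
  rewrite /flat_push (derive_dirZ _ _ (differentiable_flat aM ax)).
  by rewrite (derive_dirZ _ _ dh) (derive_dirZ _ _ dh) scaleNr.
rewrite pE.
have key z : (wdot om w ('D_z h (f0 (x 0))) ==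
    wdot om ('D_(- r *: X0) h (f0 (x 0))) ('D_z h (f0 (x 0)))) =
    (dot ('D_1 xi0 (0 : R^o)) z == - k0 * dot X0 z).
  rewrite vel (cp_dot cp _ _ (f0U (x 0))).
  have -> : dot (- r *: X0) z = - r * dot X0 z by rewrite /dot wdotZl.
  rewrite [_ ^- 2 * (- r * _)]mulrCA.
  exact: velocity_identity.
have tz z : space_form_tangent c (h (f0 (x 0))) ('D_z h (f0 (x 0))).
  by apply/space_form_tangentE; exact: (cp_normal cp z (f0U (x 0))).
split=> [H|H].
  apply: dot_ext => z; apply/eqP.
  have -> : dot (- k0 *: X0) z = - k0 * dot X0 z by rewrite /dot wdotZl.
  by rewrite -key -H (wdot_tangential _ (tz z)).
apply: (tangent_ext (f0U (x 0))) => [||z]; last 1 first.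
- rewrite (wdot_tangential _ (tz z)); apply/eqP; rewrite key H.
  by rewrite /dot wdotZl.
- apply: tangential_tangent; first exact: (cp_space_form cp (f0U (x 0))).
  move=> c0; rewrite /w (derive_coord _ _ _ dlift).
  have E : (fun t : R^o => normal_lift (x t) (xi0 t) ord0 ord0 : R^o) = cst 0.
    apply/funext => s; have := lift_tangent (x s) (xi0 s).
    by rewrite /space_form_tangent /= c0 eqxx.
  by rewrite E derive_cst.
- exact: tz.
Qed.

End Parametrized.
End Transfer.

Section CurvatureAlongCurve.
Context {R : realType}.
Variables (q : nat) (U : set 'rV[R]_q) (T : 'rV[R]_q -> R^o) (gam xi0 : R^o -> 'rV[R]_q).
Hypotheses (oU : open U) (sT : smooth U T) (T0 : forall y, U y -> T y != 0).
Hypotheses (gU : forall t, U (gam t)) (dg : differentiable gam (0 : R^o))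
  (dxi : differentiable xi0 (0 : R^o)).
Variable k : R^o -> R^o.
Hypothesis vel : 'D_1 xi0 (0 : R^o) = - k 0 *: 'D_1 gam (0 : R^o).
Hypothesis hess : 'D_('D_1 gam (0 : R^o)) ('D_(xi0 0) T) (gam 0) = 0.
Local Notation Tg := (fun t : R^o => T (gam t) : R^o).
Local Notation DT := (fun t : R^o => 'D_(xi0 t) T (gam t) : R^o).
Local Notation X0 := ('D_1 gam (0 : R^o)).

Let dT : differentiable T (gam 0).
Proof. exact: smooth_differentiable sT (gU 0). Qed.

Let dTg : differentiable Tg (0 : R^o).
Proof. exact: (differentiable_comp dg dT). Qed.

Let dDT : differentiable DT (0 : R^o).
Proof. exact: (differentiable_along oU sT dg dxi (gU 0)). Qed.

Let DTg : 'D_1 Tg (0 : R^o) = 'D_X0 T (gam 0).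
Proof. exact: (derive_comp (1 : R^o) dg dT). Qed.

Let DDT : 'D_1 DT (0 : R^o) = - k 0 * 'D_X0 T (gam 0).
Proof.
apply: (etrans (derive_along (1 : R^o) oU sT dg dxi (gU 0))).
by rewrite vel hess addr0 (derive_dirZ _ _ dT).
Qed.

Lemma is_derive_differentiable (f : R^o -> R^o) (d : R^o) :
  is_derive (0 : R^o) (1 : R^o) f d <-> differentiable f (0 : R^o) /\ 'D_1 f (0 : R^o) = d.
Proof.
split=> [[D <-]|[D <-]]; first by split=> //; exact/derivable1_diffP.
by split=> //; exact: diff_derivable.
Qed.

(** Writing T k + D_xi0 T for the principal curvature in the metric T^-2 |dx|^2,
    its derivative is T k' + k D_X0 T + D_xi0' T + Hess T (X0, xi0); the middle
    terms cancel since xi0' = - k X0. *)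
Lemma curvature_derive_lift : is_derive (0 : R^o) (1 : R^o) k (0 : R^o) ->
  is_derive (0 : R^o) (1 : R^o) (fun t => T (gam t) * k t + 'D_(xi0 t) T (gam t) : R^o)
    (0 : R^o).
Proof.
move=> /is_derive_differentiable[dk Dk]; apply/is_derive_differentiable.
have dP : differentiable (fun t : R^o => Tg t * k t : R^o) (0 : R^o) by exact: differentiableM.
split; first exact: differentiableD.
apply: (etrans (derive_add (1 : R^o) dP dDT)).
have E := derive_mulr (1 : R^o) dTg dk.
rewrite Dk DTg mulr0 addr0 in E.
by rewrite E DDT mulrC mulNr subrr.
Qed.

Lemma curvature_derive_lower :
  is_derive (0 : R^o) (1 : R^o) (fun t => T (gam t) * k t + 'D_(xi0 t) T (gam t) : R^o)
    (0 : R^o) -> is_derive (0 : R^o) (1 : R^o) k (0 : R^o).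
Proof.
set A := fun t : R^o => _.
move=> /is_derive_differentiable[dA DA]; apply/is_derive_differentiable.
pose B : R^o -> R^o := fun t => A t + - 1 * DT t.
have dN : differentiable (fun t : R^o => - 1 * DT t : R^o) (0 : R^o).
  by apply: differentiableM => //; exact: differentiable_cst.
have dB : differentiable B (0 : R^o) by exact: differentiableD.
have dV : differentiable (fun t : R^o => (Tg t)^-1 : R^o) (0 : R^o).
  by apply: differentiableV => //; exact: T0.
have kE : k = (fun t : R^o => B t * (Tg t)^-1 : R^o).
  apply/funext => t; rewrite /B /A mulN1r addrK mulrAC mulfV ?mul1r//; exact: T0.
have B0 : B 0 = Tg 0 * k 0 by rewrite /B /A mulN1r addrK.
have EB : 'D_1 B (0 : R^o) = k 0 * 'D_X0 T (gam 0).
  apply: (etrans (derive_add (1 : R^o) dA dN)).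
  have dc : differentiable (fun=> - 1 : R^o) (0 : R^o) by exact: differentiable_cst.
  have E := derive_mulr (1 : R^o) dc dDT.
  rewrite derive_cst mul0r add0r DDT in E.
  by rewrite DA add0r E mulN1r mulNr opprK.
have EV := derive_inv (1 : R^o) dTg (T0 (gU 0)).
have EP := derive_mulr (1 : R^o) dB dV.
have dP : differentiable (fun t : R^o => B t * (Tg t)^-1 : R^o) (0 : R^o) by exact: differentiableM.
rewrite -kE in EP dP; split=> //; rewrite EP EV EB B0 DTg.
move: (T0 (gU 0)) ('D_X0 T (gam 0)) (k 0); move: (T (gam 0)) => t t0 D k0.
by field.
Qed.

End CurvatureAlongCurve.

(** * Principal curvatures up to sign *)

Section Signs.
Context {R : realType}.
Variables (n p : nat) (M : smooth_manifold R n).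
Local Notation m := (n + p)%N.
Variable f0 : M -> 'rV[R]_m.
Hypothesis sf0 : forall a, atlas M a -> smooth (chart_codom a) (f0 \o chart_inv a).

Definition flat_curvatures k x (xi0 : 'rV[R]_m) (K : 'I_k -> R) : Prop :=
  (forall i j : 'I_k, (i < j)%N -> K i < K j) /\
  (forall a, atlas M a -> chart_dom a x ->
    forall r, eigenvalue (flat_shape f0 a x xi0) r <-> exists i, r = K i).

Lemma flat_shape_sign (b : bool) a x xi0 :
  flat_shape f0 a x ((-1) ^+ b *: xi0) = (-1) ^+ b *: flat_shape f0 a x xi0.
Proof. by case: b; rewrite ?expr1 ?scaleN1r ?flat_shapeN// expr0 !scale1r. Qed.

Lemma flat_unit_normal_sign (b : bool) x xi0 : flat_unit_normal f0 x xi0 ->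
  flat_unit_normal f0 x ((-1) ^+ b *: xi0).
Proof.
by case: b; rewrite ?expr1 ?scaleN1r ?expr0 ?scale1r// => /flat_unit_normalN.
Qed.

Lemma sign_neq0 (b : bool) : (-1) ^+ b != 0 :> R.
Proof. by rewrite signr_eq0. Qed.

Lemma signZK (b : bool) q (v : 'rV[R]_q) : (-1) ^+ b *: ((-1) ^+ b *: v) = v.
Proof. by rewrite scalerA -expr2 sqrr_sign scale1r. Qed.

Lemma sign_eigenvalue q (A : 'M[R]_q) (b : bool) r :
  eigenvalue ((-1) ^+ b *: A) r = eigenvalue A ((-1) ^+ b * r).
Proof.
rewrite -(affine_eigenvalue A 0 ((-1) ^+ b * r) (sign_neq0 b)).
by rewrite addr0 signrMK raddf0 addr0.
Qed.

(** Reversing the normal changes the signs of the principal curvatures, hence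
    their order. *)
Definition sign_ord k (b : bool) (i : 'I_k) := if b then rev_ord i else i.

Lemma sign_ordK k b : involutive (@sign_ord k b).
Proof. by case: b => // i; exact: rev_ordK. Qed.

Lemma flat_curvatures_sign k (b : bool) x xi0 (K : 'I_k -> R) : flat_curvatures x xi0 K ->
  flat_curvatures x ((-1) ^+ b *: xi0) (fun i => (-1) ^+ b * K (sign_ord b i)).
Proof.
move=> [Kmono Kspec]; split=> [i j ij|a aM ax r].
  case: b => /=; last by rewrite !expr0 !mul1r; exact: Kmono.
  rewrite expr1 !mulN1r ltrN2; apply: Kmono => /=.
  by apply: ltn_sub2l => //; exact: leq_ltn_trans ij (ltn_ord j).
rewrite flat_shape_sign sign_eigenvalue; apply: (iff_trans (Kspec a aM ax _)).
split=> -[i]; last by move=> ->; exists (sign_ord b i); rewrite signrMK.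
by move=> E; exists (sign_ord b i); rewrite sign_ordK -E signrMK.
Qed.

Section Parametrized.
Variables (c : R) (U : set 'rV[R]_m) (h : 'rV[R]_m -> 'rV[R]_m.+1) (tau : 'rV[R]_m -> R^o).
Hypothesis cp : conformal_param c U h tau.
Hypothesis f0U : forall x, U (f0 x).
Local Notation f := (fun x => h (f0 x)).
Local Notation normal_lift := (normal_lift f0 h tau).
Local Notation normal_lower := (normal_lower f0 c h tau).
Variables (g : riemannian_metric M).
Hypothesis gf : isometric_immersion c g f.

Lemma lift_sign (b : bool) x xi0 : normal_lift x ((-1) ^+ b *: xi0) = (-1) ^+ b *: normal_lift x xi0.
Proof.
rewrite /normal_lift derive_dirZ; first by rewrite !scalerA mulrC.
exact: (smooth_differentiable (cp_smooth cp) (f0U x)).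
Qed.

Lemma lift_eigenvalue_iff a x xi0 r : atlas M a -> chart_dom a x ->
  flat_unit_normal f0 x xi0 -> eigenvalue (shape_operator c g f a x (normal_lift x xi0)) r =
  eigenvalue (flat_shape f0 a x xi0) ((r - 'D_xi0 tau (f0 x)) / tau (f0 x)).
Proof.
move=> aM ax nX; rewrite -(lift_eigenvalue sf0 cp f0U _ gf aM ax nX).
by rewrite mulrC divfK ?subrK//; exact: (cp_tau_neq0 cp (f0U x)).
Qed.

Lemma lift_curvatures k x xi0 (K : 'I_k -> R) : flat_unit_normal f0 x xi0 ->
  flat_curvatures x xi0 K ->
  (forall i j : 'I_k, (i < j)%N -> tau (f0 x) * K i + 'D_xi0 tau (f0 x) <
     tau (f0 x) * K j + 'D_xi0 tau (f0 x)) /\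
  (forall a, atlas M a -> chart_dom a x -> forall r,
    eigenvalue (shape_operator c g f a x (normal_lift x xi0)) r <->
    exists i, r = tau (f0 x) * K i + 'D_xi0 tau (f0 x)).
Proof.
move=> nX [Kmono Kspec]; split=> [i j ij|a aM ax r].
  by rewrite ltrD2r ltr_pM2l ?Kmono//; exact: (cp_tau_gt0 cp (f0U x)).
rewrite (lift_eigenvalue_iff _ aM ax nX); apply: (iff_trans (Kspec a aM ax _)).
have t0 := cp_tau_neq0 cp (f0U x).
split=> -[i E]; exists i; first by rewrite -E mulrC divfK ?subrK.
by rewrite E addrK mulrC mulKf.
Qed.

Lemma lower_curvatures k x xi0 (kap : 'I_k -> R) : flat_unit_normal f0 x xi0 ->
  (forall i j : 'I_k, (i < j)%N -> kap i < kap j) ->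
  (forall a, atlas M a -> chart_dom a x -> forall r,
    eigenvalue (shape_operator c g f a x (normal_lift x xi0)) r <-> exists i, r = kap i) ->
  flat_curvatures x xi0 (fun i => (kap i - 'D_xi0 tau (f0 x)) / tau (f0 x)).
Proof.
move=> nX mono spec; split=> [i j ij|a aM ax r].
  by rewrite ltr_pM2r ?invr_gt0 ?ltrD2r ?mono//; exact: (cp_tau_gt0 cp (f0U x)).
rewrite -(lift_eigenvalue sf0 cp f0U _ gf aM ax nX); apply: (iff_trans (spec a aM ax _)).
have t0 := cp_tau_neq0 cp (f0U x).
split=> -[i E]; exists i; first by rewrite -E addrK mulrC mulKf.
by rewrite E mulrC divfK ?subrK.
Qed.

Lemma lift_spectrum_card a x xi0 : atlas M a -> chart_dom a x -> flat_unit_normal f0 x xi0 ->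
  ([set r | eigenvalue (shape_operator c g f a x (normal_lift x xi0)) r] #=
   [set r | eigenvalue (flat_shape f0 a x xi0) r])%card.
Proof.
move=> aM ax nX; have t0 := cp_tau_neq0 cp (f0U x).
pose F r := tau (f0 x) * r + 'D_xi0 tau (f0 x).
suff -> : [set r | eigenvalue (shape_operator c g f a x (normal_lift x xi0)) r] =
    F @` [set r | eigenvalue (flat_shape f0 a x xi0) r].
  by apply: inj_card_eq => r s _ _; rewrite /F => /addIr /(mulfI t0).
apply/seteqP; split=> [r /= H|_ [r H <-]] /=; last by rewrite (lift_eigenvalue sf0 cp f0U _ gf aM ax nX).
rewrite (lift_eigenvalue_iff _ aM ax nX) in H.
by exists ((r - 'D_xi0 tau (f0 x)) / tau (f0 x)) => //; rewrite /F mulrC divfK ?subrK.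
Qed.

Lemma sign_spectrum_card a x xi0 (b : bool) :
  ([set r | eigenvalue (flat_shape f0 a x ((-1) ^+ b *: xi0)) r] #=
   [set r | eigenvalue (flat_shape f0 a x xi0) r])%card.
Proof.
suff -> : [set r | eigenvalue (flat_shape f0 a x ((-1) ^+ b *: xi0)) r] =
    ( *%R ((-1) ^+ b)) @` [set r | eigenvalue (flat_shape f0 a x xi0) r].
  by apply: inj_card_eq => r s _ _; apply: mulfI; exact: sign_neq0.
apply/seteqP; split=> [r /=|_ [r H <-]] /=; rewrite flat_shape_sign sign_eigenvalue.
  by move=> H; exists ((-1) ^+ b * r); rewrite ?signrMK.
by rewrite signrMK.
Qed.

Lemma unit_bundle_sub UN : unit_normal_bundle c f UN -> UN `<=` unit_normals c f.
Proof. by case=> [->//|[_ [nu [_ nN ->]]]] _ [x _ <-]; exact: nN. Qed.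

Lemma unit_bundle_nu nu x xi0 : p = 1%N -> unit_normals c f (x, nu x) ->
  flat_unit_normal f0 x xi0 ->
  exists b : bool, nu x = normal_lift x ((-1) ^+ b *: xi0).
Proof.
move=> p1 nN nX; have [nl ll] := lower_unit_normal sf0 cp f0U nN.
have [E|E] := hypersurface_normal sf0 cp f0U p1 gf nl nX.
  by exists false; rewrite expr0 scale1r -E.
by exists true; rewrite expr1 scaleN1r -E.
Qed.

Lemma unit_bundle_sign UN x xi0 : unit_normal_bundle c f UN -> flat_unit_normal f0 x xi0 ->
  exists b : bool, UN (x, normal_lift x ((-1) ^+ b *: xi0)).
Proof.
case=> [->|[p1 [nu [_ nN UNE]]]] nX.
  by exists false; rewrite expr0 scale1r; exact: (lift_unit_normal sf0 cp f0U).
have [b E] := unit_bundle_nu p1 (nN x) nX.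
by exists b; rewrite -E UNE; exists x.
Qed.

Lemma continuous_wdot (T : topologicalType) q (w : 'I_q -> R) (u v : T -> 'rV[R]_q) t :
  {for t, continuous u} -> {for t, continuous v} ->
  {for t, continuous (fun s => wdot w (u s) (v s) : R^o)}.
Proof.
move=> cu cv; have E s : wdot w (u s) (v s) = \sum_j w j * u s ord0 j * v s ord0 j.
  by rewrite wdotE.
rewrite /prop_for /continuous_at (funext E).
apply: cvg_big => [|j _]; first exact: (@add_continuous R^o).
apply: cvgM; last exact: ((continuous_mxP _ _).1 cv ord0 j).
by apply: cvgM; [exact: cvg_cst|exact: ((continuous_mxP _ _).1 cu ord0 j)].
Qed.

(** The product of the lifted normal with the chosen unit normal field is
    continuous and takes the values 1 and -1, hence is constant near 0. *)
Lemma unit_bundle_sign_near UN (N : set R^o) (x : R -> M) (xi0 : R^o -> 'rV[R]_m) :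
  unit_normal_bundle c f UN -> open N -> N 0 -> {for (0 : R), continuous x} ->
  {for (0 : R^o), continuous (fun t : R^o => normal_lift (x t) (xi0 t))} ->
  (forall t, N t -> flat_unit_normal f0 (x t) (xi0 t)) ->
  exists (b : bool) (V : set R^o), [/\ open V, V 0, V `<=` N &
    forall t, V t -> UN (x t, normal_lift (x t) ((-1) ^+ b *: xi0 t))].
Proof.
case=> [->|[p1 [nu [cnu nN UNE]]]] oN N0 cx cl nX.
  exists false, N; split=> // t Nt; rewrite expr0 scale1r.
  exact/(lift_unit_normal sf0 cp f0U)/nX.
pose phi (t : R^o) : R^o := wdot (ambient_weight c (m := m)) (normal_lift (x t) (xi0 t)) (nu (x t)).
have cphi : {for (0 : R^o), continuous phi}.
  apply: continuous_wdot cl _.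
  exact: (@continuous_comp R^o M _ x nu (0 : R^o) cx (cnu (x 0))).
have sgn t : N t -> exists2 b : bool, phi t = (-1) ^+ b &
    nu (x t) = normal_lift (x t) ((-1) ^+ b *: xi0 t).
  move=> Nt; have [b E] := unit_bundle_nu p1 (nN (x t)) (nX t Nt).
  exists b => //; rewrite /phi E lift_sign wdotZr (lift_norm cp f0U).
  by rewrite (nX t Nt).1 mulr1.
have [b0 phi0 _] := sgn 0 N0; exists b0.
have nV : nbhs (0 : R^o) [set t | N t /\ `|phi 0 - phi t| < 1].
  apply: (@filterI _ _ (nbhs_filter (0 : R^o))); first exact: open_nbhs_nbhs.
  exact: (cvgrPdist_lt _ _).1 cphi _ ltr01.
exists (interior [set t | N t /\ `|phi 0 - phi t| < 1]); split => //.
- exact: open_interior.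
- by move=> t /interior_subset[].
move=> t /interior_subset[/= Nt]; have [b phit nut] := sgn t Nt.
rewrite phi0 phit; have [<- _|bb] := eqVneq b b0.
  by rewrite UNE; exists (x t) => //; rewrite nut.
have -> : b0 = ~~ b by case: (b) (b0) bb => -[].
rewrite signrN -opprD normrN -mulr2n normrMn normrX normrN1 expr1n.
by rewrite ltNge ler1n.
Qed.

End Parametrized.
End Signs.
(** * Two parametrizations of the same flat immersion *)

Lemma neq_negb (b b' : bool) : b' != b -> b' = ~~ b.
Proof. by case: b b' => -[]. Qed.

Section TwoParametrizations.
Context {R : realType}.
Variables (n p k : nat) (M : smooth_manifold R n).
Local Notation m := (n + p)%N.
Variable f0 : M -> 'rV[R]_m.
Hypothesis sf0 : forall a, atlas M a -> smooth (chart_codom a) (f0 \o chart_inv a).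
Variables (c1 c2 : R) (U : set 'rV[R]_m) (h1 h2 : 'rV[R]_m -> 'rV[R]_m.+1).
Variables (tau1 tau2 : 'rV[R]_m -> R^o).
Hypotheses (cp1 : conformal_param c1 U h1 tau1) (cp2 : conformal_param c2 U h2 tau2).
Hypothesis f0U : forall x, U (f0 x).
Local Notation f1 := (fun x => h1 (f0 x)).
Local Notation f2 := (fun x => h2 (f0 x)).
Local Notation lift1 := (normal_lift f0 h1 tau1).
Local Notation lift2 := (normal_lift f0 h2 tau2).
Local Notation lower1 := (normal_lower f0 c1 h1 tau1).
Local Notation lower2 := (normal_lower f0 c2 h2 tau2).
Variables (g1 g2 : riemannian_metric M) (UN1 UN2 : set (M * 'rV[R]_m.+1)).
Hypotheses (gf1 : isometric_immersion c1 g1 f1) (gf2 : isometric_immersion c2 g2 f2).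
Hypotheses (B1 : unit_normal_bundle c1 f1 UN1) (B2 : unit_normal_bundle c2 f2 UN2).

Lemma bundle_lower x xi : UN2 (x, xi) ->
  flat_unit_normal f0 x (lower2 x xi) /\ lift2 x (lower2 x xi) = xi.
Proof. by move=> /(unit_bundle_sub B2)/(lower_unit_normal sf0 cp2 f0U). Qed.

(** The spectra for the two parametrizations are images of the same flat spectrum
    by injective affine maps, up to a reflection when the chosen normals are
    opposite. *)
Lemma k_umbilical_transfer : k_umbilical c1 g1 f1 UN1 k -> k_umbilical c2 g2 f2 UN2 k.
Proof.
move=> ku [x xi] /bundle_lower[nX E] a aM ax; rewrite /= in nX E ax *.
have [b bUN] := unit_bundle_sign sf0 cp1 f0U gf1 B1 nX.
rewrite -E; apply: card_eq_trans (ku _ bUN a aM ax).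
apply: (card_eq_trans (lift_spectrum_card sf0 cp2 f0U gf2 aM ax nX)).
rewrite card_eq_sym.
apply: (card_eq_trans (lift_spectrum_card sf0 cp1 f0U gf1 aM ax (flat_unit_normal_sign b nX))).
exact: sign_spectrum_card.
Qed.

Section Pullback.
Variable kap2 : 'I_k -> M * 'rV[R]_m.+1 -> R.
Hypothesis pc2 : principal_curvatures c2 g2 f2 UN2 kap2.

Definition flat_kap (i : 'I_k) x xi0 : R :=
  (kap2 i (x, lift2 x xi0) - 'D_xi0 tau2 (f0 x)) / tau2 (f0 x).

Lemma flat_kap_curvatures x xi0 : flat_unit_normal f0 x xi0 -> UN2 (x, lift2 x xi0) ->
  flat_curvatures f0 x xi0 (fun i => flat_kap i x xi0).
Proof.
move=> nX /pc2[mono spec].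
exact: (lower_curvatures sf0 cp2 f0U gf2 nX mono spec).
Qed.

Variable b : bool.
Local Notation s := ((-1) ^+ b : R).

(** The sign relating the normals in UN1 to those in UN2 depends on the point; it
    is chosen equal to b whenever possible, so that near a curve with sign b the
    curvature functions defined from it follow those of UN2. *)
Definition bundle_sign (z : M * 'rV[R]_m.+1) : bool :=
  if `[< UN2 (z.1, lift2 z.1 (s *: lower1 z.1 z.2)) >] then b else ~~ b.

(** An enumeration of the principal curvatures for UN1 obtained from one for UN2.
    The Dupin condition quantifies over all enumerations: the condition for UN2
    will be deduced from that for UN1 by applying the latter to this one. *)
Definition kap1 (i : 'I_k) (z : M * 'rV[R]_m.+1) : R :=
  let b' := bundle_sign z in let e := lower1 z.1 z.2 in
  tau1 (f0 z.1) * ((-1) ^+ b' * flat_kap (sign_ord b' i) z.1 ((-1) ^+ b' *: e))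
  + 'D_e tau1 (f0 z.1).

Lemma bundle_signP x xi0 : flat_unit_normal f0 x xi0 ->
  UN2 (x, lift2 x ((-1) ^+ bundle_sign (x, lift1 x xi0) *: xi0)).
Proof.
move=> nX; rewrite /bundle_sign /= (normal_liftK cp1 f0U); case: asboolP => // nUN.
have [b' H] := unit_bundle_sign sf0 cp2 f0U gf2 B2 nX.
have E : b' = ~~ b.
  by apply: neq_negb; apply: contra_notN nUN => /eqP <-.
rewrite -E; exact: H.
Qed.

Lemma kap1_curvatures : principal_curvatures c1 g1 f1 UN1 kap1.
Proof.
move=> [x xi] /(unit_bundle_sub B1)/(lower_unit_normal sf0 cp1 f0U)[nX E].
have H := bundle_signP nX; rewrite E in H.
have fl := flat_curvatures_sign (bundle_sign (x, xi))
  (flat_kap_curvatures (flat_unit_normal_sign _ nX) H).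
rewrite signZK in fl.
have [mono spec] := lift_curvatures sf0 cp1 f0U gf1 nX fl.
by rewrite E in spec.
Qed.

Lemma kap1_lift (i : 'I_k) x xi0 : UN2 (x, lift2 x xi0) ->
  kap1 (sign_ord b i) (x, lift1 x (s *: xi0)) =
  tau1 (f0 x) * (s * flat_kap i x xi0) + 'D_(s *: xi0) tau1 (f0 x).
Proof.
move=> H; have E : bundle_sign (x, lift1 x (s *: xi0)) = b.
  by rewrite /bundle_sign /= (normal_liftK cp1 f0U) signZK asboolT.
by rewrite /kap1 E /= (normal_liftK cp1 f0U) signZK sign_ordK.
Qed.

End Pullback.

Hypotheses (hess1 : forall y v w, U y -> dot v w = 0 -> 'D_w ('D_v tau1) y = 0)
  (hess2 : forall y v w, U y -> dot v w = 0 -> 'D_w ('D_v tau2) y = 0).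

Lemma is_derive_signM (b : bool) (f : R^o -> R^o) :
  is_derive (0 : R^o) (1 : R^o) (fun t => (-1) ^+ b * f t : R^o) (0 : R^o) ->
  is_derive (0 : R^o) (1 : R^o) f (0 : R^o).
Proof.
move=> D; have -> : f = (fun t : R^o => (-1) ^+ b *: ((-1) ^+ b * f t : R^o) : R^o).
  by apply/funext => t; rewrite /GRing.scale /= signrMK.
by apply: is_derive_eq; rewrite scaler0.
Qed.

Lemma eq_is_derive_open (V : set R^o) (f f' : R^o -> R^o) : open V -> V 0 ->
  (forall t, V t -> f t = f' t) ->
  is_derive (0 : R^o) (1 : R^o) f (0 : R^o) -> is_derive (0 : R^o) (1 : R^o) f' (0 : R^o).
Proof.
move=> oV V0 E /is_derive_differentiable[df Df]; apply/is_derive_differentiable; split.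
  apply: near_eq_differentiable df.
  apply: (@filterS _ _ (nbhs_filter (0 : R^o)) _ _ E); exact: open_nbhs_nbhs.
exact: (etrans (esym (eq_derive_open _ oV V0 E)) Df).
Qed.

(** A curve tangent to T_i in UN2 is lowered to a flat curve of normals and lifted
    to UN1, with the right sign, where it is tangent to T_i again.  The principal
    curvature being constant to first order there, so is the flat one by
    curvature_derive_lower, and then the one in UN2 by curvature_derive_lift. *)
Theorem k_dupin_transfer : k_dupin c1 g1 f1 UN1 k -> k_dupin c2 g2 f2 UN2 k.
Proof.
move=> [ku dup]; split; first exact: k_umbilical_transfer.
move=> kap2 pc2 i x xi a [N [oN N0 cN sxi sx]] aM ax vel.
have cx t : N t -> {for t, continuous x} by move=> /cN[].
pose e (t : R^o) := lower2 (x t) (xi t).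
have eP t : N t -> flat_unit_normal f0 (x t) (e t) /\ lift2 (x t) (e t) = xi t.
  by move=> /cN[/bundle_lower].
have se : smooth N e := smooth_lower_curve sf0 cp2 f0U oN cx sx sxi.
have sg : smooth N (fun t : R^o => f0 (x t)) := smooth_curve sf0 oN cx sx.
have dg := smooth_differentiable sg N0.
have de := smooth_differentiable se N0.
have sl1 : smooth N (fun t : R^o => lift1 (x t) (e t)).
  exact: (smooth_lift_curve sf0 cp1 f0U oN cx sx se).
have [b [V [oV V0 VN bUN]]] := unit_bundle_sign_near sf0 cp1 f0U gf1 B1 oN N0 (cx 0 N0)
  (smooth_continuous sl1 N0) (fun t Nt => (eP t Nt).1).
pose s : R := (-1) ^+ b.
pose kk (t : R^o) : R^o := flat_kap kap2 i (x t) (e t).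
have k2E t : N t -> tau2 (f0 (x t)) * kk t + 'D_(e t) tau2 (f0 (x t)) = kap2 i (x t, xi t).
  move=> Nt; rewrite /kk /flat_kap (eP t Nt).2 mulrC divfK ?subrK//.
  exact: (cp_tau_neq0 cp2 (f0U (x t))).
have k1E t : V t -> kap1 kap2 b (sign_ord b i) (x t, lift1 (x t) (s *: e t)) =
    tau1 (f0 (x t)) * (s * kk t) + 'D_(s *: e t) tau1 (f0 (x t)).
  move=> Vt; apply: kap1_lift; rewrite (eP t (VN t Vt)).2.
  exact: (cN t (VN t Vt)).1.
have EX : 'D_1 (fun t : R^o => f0 (x t)) (0 : R^o) = flat_push f0 a (x 0) (curve_velocity a x).
  rewrite (derive_curve sf0 oN cx sx aM N0 ax) /curve_velocity.
  by rewrite (derive1E (chart_map a \o x)).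
have [v1 v2] : curve_velocity a x *m flat_shape f0 a (x 0) (e 0) = kk 0 *: curve_velocity a x /\
    'D_1 e (0 : R^o) = - kk 0 *: 'D_1 (fun t : R^o => f0 (x t)) (0 : R^o).
  apply/(velocity_param sf0 cp2 f0U _ gf2 aM ax oN N0 _ (eP 0 N0).1 dg de EX).
    by move=> t Nt; rewrite (eP t Nt).2.
  by rewrite k2E.
pose se1 (t : R^o) := s *: e t.
have nX1 t : N t -> flat_unit_normal f0 (x t) (se1 t).
  by move=> Nt; exact: (flat_unit_normal_sign b (eP t Nt).1).
have sse1 : smooth N se1 by apply: smoothZ => //; exact: smooth_cst.
have dse1 := smooth_differentiable sse1 N0.
have v1s : curve_velocity a x *m flat_shape f0 a (x 0) (se1 0) =
    (s * kk 0) *: curve_velocity a x.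
  by rewrite flat_shape_sign -scalemxAr v1 scalerA.
have v2s : 'D_1 se1 (0 : R^o) = - (s * kk 0) *: 'D_1 (fun t : R^o => f0 (x t)) (0 : R^o).
  have dd : derivable e (0 : R^o) (1 : R^o) by exact: diff_derivable.
  by rewrite (deriveZ s dd) v2 scalerA mulrN.
have vel1 : velocity_in_T c1 g1 f1 a x (fun t => lift1 (x t) (se1 t))
    (kap1 kap2 b (sign_ord b i) (x 0, lift1 (x 0) (se1 0))).
  rewrite (k1E 0 V0).
  by apply/(velocity_param sf0 cp1 f0U _ gf1 aM ax oN N0 _ (nX1 0 N0) dg dse1 EX).
have bc : bundle_curve UN1 x (fun t => lift1 (x t) (se1 t)).
  exists V; split; [exact: oV|exact: V0|..].
  - by move=> t Vt; split; [exact: bUN|exact/cx/VN].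
  - exact: sub_smooth VN (smooth_lift_curve sf0 cp1 f0U oN cx sx sse1).
  - move=> d dM; apply: (sub_smooth _ (sx d dM)) => t [Vt dt]; split=> //; exact: VN.
have d1 := dup _ (kap1_curvatures pc2 b) (sign_ord b i) x _ a bc aM ax vel1.
have d2 := eq_is_derive_open oV V0 k1E d1.
have ort w : flat_unit_normal f0 (x 0) w -> dot w ('D_1 (fun t : R^o => f0 (x t)) (0 : R^o)) = 0.
  by move=> [_ nX]; rewrite EX /dot wdotC; exact: nX.
have H1 : 'D_('D_1 (fun t : R^o => f0 (x t)) (0 : R^o)) ('D_(se1 0) tau1) (f0 (x 0)) = 0.
  exact: hess1 (f0U _) (ort _ (nX1 0 N0)).
have H2 : 'D_('D_1 (fun t : R^o => f0 (x t)) (0 : R^o)) ('D_(e 0) tau2) (f0 (x 0)) = 0.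
  exact: hess2 (f0U _) (ort _ (eP 0 N0).1).
have d3 := curvature_derive_lower (cp_open cp1) (cp_tau_smooth cp1) (fun y => cp_tau_neq0 cp1 (x := y))
  (fun t => f0U (x t)) dg dse1 v2s H1 d2.
have d4 := is_derive_signM d3.
have d5 := curvature_derive_lift (cp_open cp2) (cp_tau_smooth cp2)
  (fun t => f0U (x t)) dg de v2 H2 d4.
exact: (eq_is_derive_open oN N0 k2E d5).
Qed.

End TwoParametrizations.

(** * Conformal diffeomorphisms in stereographic coordinates *)

(** Smoothness on a subset only provides local extensions, but composing with a
    smooth map into the subset gives a function that does not depend on them. *)
Lemma smooth_on_subset_comp (R : realType) (V : normedModType R) q1 q2
    (U : set V) (s : V -> 'rV[R]_q1) (A : set 'rV[R]_q1) (phi : 'rV[R]_q1 -> 'rV[R]_q2) :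
  open U -> smooth U s -> (forall x, U x -> A (s x)) -> smooth_on_subset A phi ->
  smooth U (fun x => phi (s x)).
Proof.
move=> oU ss sA sphi; apply: smooth_local => x Ux.
have [Phi [W [oW Wx sPhi E]]] := sphi _ (sA x Ux).
have oUW : open (U `&` s @^-1` W).
  rewrite openE => y [Uy Wy]; apply: (@filterI _ _ (nbhs_filter y)).
    exact: open_nbhs_nbhs.
  by apply: (smooth_continuous ss Uy); exact: open_nbhs_nbhs.
exists (U `&` s @^-1` W); split=> //.
have sUW : smooth (U `&` s @^-1` W) s by apply: sub_smooth ss => y [].
apply: (eq_smooth oUW _ (smooth_comp oUW oW _ sUW sPhi)) => [y [Uy Wy]|y []//].
exact: E (Wy) (sA y Uy).
Qed.

Section ConformalDiffeo.
Context {R : realType}.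
Variables (m : nat) (c c' : R) (phi psi : 'rV[R]_m.+1 -> 'rV[R]_m.+1).
Hypothesis phiK : forall x, bar_space_form c x -> bar_space_form c' (phi x) /\ psi (phi x) = x.
Hypothesis psiK : forall y, bar_space_form c' y -> bar_space_form c (psi y) /\ phi (psi y) = y.
Hypotheses (sphi : smooth_on_subset (bar_space_form c) phi)
  (spsi : smooth_on_subset (bar_space_form c') psi).
Variable lambda : 'rV[R]_m.+1 -> R.
Hypothesis conf : forall x, bar_space_form c x -> 0 < lambda x /\
  forall (Phi : 'rV[R]_m.+1 -> 'rV[R]_m.+1) (v w : 'rV[R]_m.+1),
    local_extension (bar_space_form c) phi x Phi ->
    space_form_tangent c x v -> space_form_tangent c x w ->
    ambient_form c' ('D_v Phi x) ('D_w Phi x) = lambda x ^+ 2 * ambient_form c v w.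

Local Notation U := (stereo_dom (m := m) c).
Local Notation U' := (stereo_dom (m := m) c').
Local Notation h := (fun x : 'rV[R]_m => phi (stereo c x)).
Local Notation cps := (stereo_cp m c).
Local Notation cps' := (stereo_cp m c').
Let oU : open U := cp_open cps.
Let oU' : open U' := cp_open cps'.

Definition composed_tau (x : 'rV[R]_m) : R^o := stereo_tau c x / lambda (stereo c x).
Local Notation tau := composed_tau.

Lemma composed_smooth : smooth U h.
Proof. exact: (smooth_on_subset_comp oU (cp_smooth cps) (@stereo_bar _ _ _) sphi). Qed.

Lemma composed_tau_gt0 x : U x -> 0 < tau x.
Proof. by move=> Ux; rewrite divr_gt0//; exact: (conf (stereo_bar Ux)).1. Qed.

Lemma composed_conformal x v w : U x ->
  tau x ^+ 2 * wdot (ambient_weight c' (m := m)) ('D_v h x) ('D_w h x) = dot v w.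
Proof.
move=> Ux; have bx := stereo_bar Ux; have [l0 cf] := conf bx.
have [Phi ext] := sphi bx; have [W [oW Wx sPhi E]] := ext.
have ds := smooth_differentiable (cp_smooth cps) Ux.
have dPhi := smooth_differentiable sPhi Wx.
have N : \near x, h x = (Phi \o stereo c) x.
  apply: (@filterS2 _ _ (nbhs_filter x) (stereo c @^-1` W) U).
  - by move=> y Wy Uy; rewrite /= E//; exact: stereo_bar.
  - by apply: (smooth_continuous (cp_smooth cps) Ux); exact: open_nbhs_nbhs.
  - exact: open_nbhs_nbhs.
have D u : 'D_u h x = 'D_('D_u (stereo c) x) Phi (stereo c x).
  exact: (etrans (near_eq_derive u N) (derive_comp u ds dPhi)).
have tg u : space_form_tangent c (stereo c x) ('D_u (stereo c) x).
  by apply/space_form_tangentE; exact: (cp_normal cps u Ux).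
rewrite (D v) (D w) -ambient_formE (cf Phi _ _ ext (tg v) (tg w)) ambient_formE.
rewrite (cp_dot cps v w Ux) /tau.
have t0 := cp_tau_neq0 cps Ux; move: (gt_eqF l0) t0.
move: (stereo_tau c x) (lambda _) (dot v w) => t l d l0' t0.
by field; rewrite l0' t0.
Qed.

(** The function lambda is not assumed to be smooth, but the factor can be
    recovered from the length of a derivative of h; in dimension 0, where there
    is no direction, the factor is constant. *)
Lemma composed_tau_smooth : smooth U tau.
Proof.
case: (posnP m) => [m0|m_gt0].
  have x0 (x : 'rV[R]_m) : x = 0 by apply/rowP => -[j jm]; exfalso; rewrite m0 in jm.
  by apply: (eq_smooth oU _ (smooth_cst U (tau 0))) => x _; rewrite [x]x0.
pose e : 'rV[R]_m := delta_mx ord0 (Ordinal m_gt0).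
pose q x : R^o := wdot (ambient_weight c' (m := m)) ('D_e h x) ('D_e h x).
have e1 : dot e e = 1 by rewrite /dot wdot_delta mul1r mxE !eqxx.
have tq x : U x -> tau x ^+ 2 * q x = 1 by move=> Ux; rewrite composed_conformal.
have tn0 x : U x -> tau x != 0 by move=> Ux; rewrite gt_eqF// composed_tau_gt0.
have qE x : U x -> q x = tau x ^- 2.
  move=> Ux; apply: (mulfI (expf_neq0 2 (tn0 x Ux))).
  by rewrite (tq x Ux) mulfV// expf_neq0// tn0.
have sq : smooth U q by apply: smooth_wdot => //; exact: (smooth_derive e composed_smooth).
have q0 x : U x -> 0 < q x.
  by move=> Ux; rewrite qE// invr_gt0 exprn_gt0// composed_tau_gt0.
apply: (eq_smooth oU _ (smooth_invsqrt oU sq q0)) => x Ux.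
rewrite qE// sqrtrV ?exprn_ge0//; last exact: ltW (composed_tau_gt0 Ux).
by rewrite invrK sqrtr_sqr gtr0_norm// composed_tau_gt0.
Qed.

Lemma composed_cp : conformal_param c' U h tau.
Proof.
split.
- exact: oU.
- exact: composed_smooth.
- exact: composed_tau_smooth.
- exact: composed_tau_gt0.
- by move=> x Ux; exact: (phiK (stereo_bar Ux)).1.1.
- exact: composed_conformal.
Qed.

Local Notation H := (fun x : 'rV[R]_m => stereo_inv c' (phi (stereo c x))).
Local Notation K := (fun y : 'rV[R]_m => stereo_inv c (psi (stereo c' y))).

Lemma flat_diffeo_dom x : U x -> U' (H x).
Proof. by move=> Ux; apply: stereo_inv_dom; exact: (phiK (stereo_bar Ux)).1. Qed.

Lemma flat_diffeo_inv_dom y : U' y -> U (K y).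
Proof. by move=> Uy; apply: stereo_inv_dom; exact: (psiK (stereo_bar Uy)).1. Qed.

Lemma flat_diffeoK x : U x -> K (H x) = x.
Proof.
move=> Ux; have [b E] := phiK (stereo_bar Ux).
by rewrite (stereo_invK b) E (stereoK Ux).
Qed.

Lemma flat_diffeo_invK y : U' y -> H (K y) = y.
Proof.
move=> Uy; have [b E] := psiK (stereo_bar Uy).
by rewrite (stereo_invK b) E (stereoK Uy).
Qed.

Lemma smooth_flat_diffeo : smooth U H.
Proof.
apply: (smooth_comp oU (open_stereo_halfspace (c := c')) _ composed_smooth (@smooth_stereo_inv R m c')).
by move=> x Ux; apply: stereo_denom_gt0; exact: (phiK (stereo_bar Ux)).1.
Qed.

Lemma smooth_flat_diffeo_inv : smooth U' K.
Proof.
have ss := smooth_on_subset_comp oU' (cp_smooth cps') (@stereo_bar _ _ _) spsi.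
apply: (smooth_comp oU' (open_stereo_halfspace (c := c)) _ ss (@smooth_stereo_inv R m c)).
by move=> y Uy; apply: stereo_denom_gt0; exact: (psiK (stereo_bar Uy)).1.
Qed.

Definition flat_tau (x : 'rV[R]_m) : R^o := tau x * (stereo_tau c' (H x))^-1.

Lemma flat_tau_gt0 x : U x -> 0 < flat_tau x.
Proof.
move=> Ux; apply: mulr_gt0; first exact: composed_tau_gt0.
rewrite invr_gt0; exact: (cp_tau_gt0 cps' (flat_diffeo_dom Ux)).
Qed.

Lemma smooth_flat_tau : smooth U flat_tau.
Proof.
apply: smoothM => //; first exact: composed_tau_smooth.
apply: smoothV => //; last by move=> x Ux; exact: (cp_tau_gt0 cps' (flat_diffeo_dom Ux)).
exact: (smooth_comp_scalar oU flat_diffeo_dom smooth_flat_diffeo (cp_tau_smooth cps')).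
Qed.

Lemma flat_diffeo_conformal x v w : U x ->
  flat_tau x ^+ 2 * dot ('D_v H x) ('D_w H x) = dot v w.
Proof.
move=> Ux; have Hx := flat_diffeo_dom Ux.
have dH := smooth_differentiable smooth_flat_diffeo Ux.
have ds := smooth_differentiable (cp_smooth cps') Hx.
have D u : 'D_u h x = 'D_('D_u H x) (stereo c') (H x).
  rewrite -(derive_comp u dH ds); apply: (eq_derive_open u oU Ux) => y Uy /=.
  by rewrite (stereo_invK (phiK (stereo_bar Uy)).1).
rewrite -(composed_conformal v w Ux) (D v) (D w) (cp_dot cps' _ _ Hx) /flat_tau.
by rewrite exprMn exprVn mulrA.
Qed.

Lemma flat_diffeo_cp : conformal_param 0 U (fun x => embed_tail (H x)) flat_tau.
Proof.
have dH x (Ux : U x) := smooth_differentiable smooth_flat_diffeo Ux.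
split.
- exact: oU.
- exact: (smooth_comp oU openT (fun _ _ => I) smooth_flat_diffeo (smooth_embed_tail openT)).
- exact: smooth_flat_tau.
- exact: flat_tau_gt0.
- by move=> x Ux; rewrite /space_form /= eqxx embed_tail0.
- move=> x v w Ux; rewrite (derive_embed_comp v (dH x Ux)) (derive_embed_comp w (dH x Ux)).
  by rewrite wdot_embed flat_diffeo_conformal.
Qed.

Lemma inverse_factor (t a b : R) : t != 0 -> t ^+ 2 * a = b -> t^-1 ^+ 2 * b = a.
Proof. by move=> t0 <-; rewrite exprVn mulKf// expf_neq0. Qed.

(** The inverse of a conformal map is conformal; its smoothness being part of the
    data, the chain rule suffices. *)
Lemma flat_diffeo_inv_cp :
  conformal_param 0 U' (fun y => embed_tail (K y)) (fun y => (flat_tau (K y))^-1).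
Proof.
have dH x (Ux : U x) := smooth_differentiable smooth_flat_diffeo Ux.
have dK y (Uy : U' y) := smooth_differentiable smooth_flat_diffeo_inv Uy.
have t0 y : U' y -> 0 < flat_tau (K y) by move=> Uy; apply/flat_tau_gt0/flat_diffeo_inv_dom.
split.
- exact: oU'.
- exact: (smooth_comp oU' openT (fun _ _ => I) smooth_flat_diffeo_inv (smooth_embed_tail openT)).
- apply: smoothV => //.
  exact: (smooth_comp_scalar oU' flat_diffeo_inv_dom smooth_flat_diffeo_inv smooth_flat_tau).
- by move=> y Uy; rewrite invr_gt0; exact: t0.
- by move=> y Uy; rewrite /space_form /= eqxx embed_tail0.
- move=> y v w Uy; rewrite (derive_embed_comp v (dK y Uy)) (derive_embed_comp w (dK y Uy)).
  have Ky := flat_diffeo_inv_dom Uy.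
  have D u : 'D_('D_u K y) H (K y) = u.
    rewrite -(derive_comp u (dK y Uy) (dH _ Ky)).
    have E z : U' z -> (H \o K) z = id z by move=> Uz; exact: flat_diffeo_invK.
    by rewrite (eq_derive_open u oU' Uy E) derive_id.
  have F := flat_diffeo_conformal ('D_v K y) ('D_w K y) Ky.
  have DD : dot v w = dot ('D_('D_v K y) H (K y)) ('D_('D_w K y) H (K y)).
    exact: (esym (f_equal2 (fun a b : 'rV[R]_m => dot a b) (D v) (D w))).
  have F' := etrans (congr1 (fun z => flat_tau (K y) ^+ 2 * z) DD) F.
  apply: (etrans (congr1 (fun z => _ * z) (wdot_embed 0 _ _))).
  exact: (inverse_factor (lt0r_neq0 (t0 y Uy)) F').
Qed.

Lemma composed_tau_split x : U x -> stereo_tau c' (H x) * flat_tau x = tau x.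
Proof.
move=> Ux; rewrite /flat_tau mulrC divfK//.
exact: (cp_tau_neq0 cps' (flat_diffeo_dom Ux)).
Qed.

End ConformalDiffeo.

Lemma derive_dir0 (R : realType) (V W : normedModType R) (f : V -> W) x :
  differentiable f x -> 'D_0 f x = 0.
Proof. by move=> df; rewrite -(scale0r (0 : V)) (derive_dirZ _ _ df) scale0r. Qed.

(** In dimension at least 3 this is a local fact, in dimension 2 a global one, and
    in lower dimensions one of two orthogonal vectors is 0. *)
Lemma composed_tau_hessian (R : realType) m (c c' : R) (phi psi : 'rV[R]_m.+1 -> 'rV[R]_m.+1)
    (lambda : 'rV[R]_m.+1 -> R) :
  (forall x, bar_space_form c x -> bar_space_form c' (phi x) /\ psi (phi x) = x) ->
  (forall y, bar_space_form c' y -> bar_space_form c (psi y) /\ phi (psi y) = y) ->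
  smooth_on_subset (bar_space_form c) phi -> smooth_on_subset (bar_space_form c') psi ->
  (forall x, bar_space_form c x -> 0 < lambda x /\
    forall (Phi : 'rV[R]_m.+1 -> 'rV[R]_m.+1) (v w : 'rV[R]_m.+1),
      local_extension (bar_space_form c) phi x Phi ->
      space_form_tangent c x v -> space_form_tangent c x w ->
      ambient_form c' ('D_v Phi x) ('D_w Phi x) = lambda x ^+ 2 * ambient_form c v w) ->
  forall x v w, stereo_dom c x -> dot v w = 0 -> 'D_w ('D_v (composed_tau c lambda)) x = 0.
Proof.
move=> phiK psiK sphi spsi conf x v w Ux vw.
have cp := composed_cp phiK sphi conf; have oU := cp_open cp.
have st := cp_tau_smooth cp.
have v0 : v = 0 -> 'D_w ('D_v (composed_tau c lambda)) x = 0.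
  move=> v0; apply: (derive_zero_open w oU Ux) => y Uy.
  by rewrite v0; exact: (derive_dir0 (smooth_differentiable st Uy)).
have w0 : w = 0 -> 'D_w ('D_v (composed_tau c lambda)) x = 0.
  by move=> ->; exact: (derive_dir0 (smooth_differentiable (smooth_derive v st) Ux)).
case: m => [|[|[|m]]] in phi psi lambda phiK psiK sphi spsi conf x v w Ux vw cp oU st v0 w0 *.
- by apply: v0; apply/rowP => -[].
- have := vw; rewrite /dot wdotE big_ord_recl big_ord0 mul1r addr0 => /eqP.
  rewrite mulf_eq0 => /orP[] /eqP z0; [apply: v0|apply: w0]; apply/rowP => j; rewrite mxE.
    by have -> : j = ord0 by exact: ord1.
  by have -> : j = ord0 by exact: ord1.
- have Hs := planar_hessian (flat_diffeo_cp phiK sphi conf)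
    (flat_diffeo_inv_cp phiK psiK sphi spsi conf) (flat_diffeo_dom phiK)
    (flat_diffeo_inv_dom psiK) (flat_diffeoK phiK) (flat_diffeo_invK psiK) Ux vw.
  apply: (etrans _ Hs); apply: (eq_derive_open w oU Ux) => y Uy.
  apply: (eq_derive_open v oU Uy) => z Uz.
  by rewrite (composed_tau_split phiK).
- exact: (cp_liouville cp).
Qed.

(** * Conformal changes of the metric *)

Lemma conformal_metric (R : realType) n (M : smooth_manifold R n) (g : riemannian_metric M)
    (s : M -> R^o) :
  (forall a, atlas M a -> smooth (chart_codom a) (s \o chart_inv a)) ->
  (forall x, 0 < s x) ->
  exists g' : riemannian_metric M,
    forall a u, gram g' a u = s (chart_inv a u) *: gram g a u.
Proof.
move=> ss s0; pose G (a : chart R n M) u : 'M[R]_n := s (chart_inv a u) *: gram g a u.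
have GE a u X Y : gram_pair (G a u) X Y = s (chart_inv a u) * gram_pair (gram g a u) X Y.
  by rewrite /gram_pair -scalemxAr -scalemxAl mxE.
have G1 a : atlas M a -> smooth (chart_codom a) (G a).
  move=> aM; have [_ oc _ _ _] := atlas_chart aM.
  exact: (smoothZ oc (ss a aM) (gram_smooth g aM)).
have G2 a u : atlas M a -> chart_codom a u -> (G a u)^T = G a u.
  by move=> aM cu; rewrite /G linearZ /= (gram_sym g aM cu).
have G3 a u (X : 'rV[R]_n) : atlas M a -> chart_codom a u ->
    X != 0 -> 0 < gram_pair (G a u) X X.
  by move=> aM cu X0; rewrite GE mulr_gt0//; exact: (gram_pos g aM cu X0).
have G4 a b u (X Y : 'rV[R]_n) : atlas M a -> atlas M b -> overlap a b u ->
    gram_pair (G a u) X Y = gram_pair (G b (transition a b u))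
      ('D_X (transition a b) u) ('D_Y (transition a b) u).
  move=> aM bM ou; rewrite !GE (gram_compat g X Y aM bM ou); congr (s _ * _).
  have [x [ax bx] <-] := ou; have [_ _ ia] := chart_pointP aM ax.
  by have [_ _ ib] := chart_pointP bM bx; rewrite /transition /= ia ib.
by exists (RiemannianMetric G1 G2 G3 G4).
Qed.

Section CommonSource.
Context {R : realType}.
Variables (n p : nat) (M : smooth_manifold R n).
Local Notation m := (n + p)%N.
Variable f0 : M -> 'rV[R]_m.
Hypothesis sf0 : forall a, atlas M a -> smooth (chart_codom a) (f0 \o chart_inv a).
Variables (c1 c2 : R) (U : set 'rV[R]_m) (h1 h2 : 'rV[R]_m -> 'rV[R]_m.+1).
Variables (tau1 tau2 : 'rV[R]_m -> R^o).
Hypotheses (cp1 : conformal_param c1 U h1 tau1) (cp2 : conformal_param c2 U h2 tau2).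
Hypothesis f0U : forall x, U (f0 x).

(** The metrics induced by the two parametrizations of the same flat immersion are
    conformal to each other. *)
Lemma immersion_transfer (g : riemannian_metric M) :
  isometric_immersion c1 g (fun x => h1 (f0 x)) ->
  (forall x, bar_space_form c2 (h2 (f0 x))) ->
  exists g' : riemannian_metric M, isometric_immersion c2 g' (fun x => h2 (f0 x)).
Proof.
move=> gf bar2.
pose s x : R^o := (tau1 (f0 x) / tau2 (f0 x)) ^+ 2.
have t1 x := cp_tau_gt0 cp1 (f0U x); have t2 x := cp_tau_gt0 cp2 (f0U x).
have s0 x : 0 < s x by rewrite exprn_gt0// divr_gt0.
have ss a : atlas M a -> smooth (chart_codom a) (s \o chart_inv a).
  move=> aM; have [_ oc _ _ _] := atlas_chart aM.
  have sq : smooth U (fun y => (tau1 y * (tau2 y)^-1) ^+ 2 : R^o).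
    apply: smoothX; first exact: cp_open cp1.
    apply: smoothM; [exact: cp_open cp1|exact: cp_tau_smooth cp1|].
    by apply: smoothV; [exact: cp_open cp1|exact: cp_tau_smooth cp2|exact: cp_tau_gt0 cp2].
  exact: (smooth_comp_scalar oc (fun u _ => f0U (chart_inv a u)) (sf0 aM) sq).
have [g' g'E] := conformal_metric g ss s0; exists g'; split; first exact: bar2.
move=> a aM; split; first exact: (local_repr_smooth sf0 cp2 f0U aM).
move=> x ax; have [_ cx ix] := chart_pointP aM ax.
have flatE X Y : dot (flat_push f0 a x X) (flat_push f0 a x Y) =
    tau1 (f0 x) ^+ 2 * gram_pair (gram g a (chart_map a x)) X Y.
  rewrite -((gf.2 a aM).2 x ax).2 (pushforward_dot sf0 cp1 f0U X Y aM ax).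
  by rewrite mulVKf// expf_neq0// gt_eqF.
have metric X Y : ambient_form c2 (Defs.pushforward (fun x => h2 (f0 x)) a x X)
    (Defs.pushforward (fun x => h2 (f0 x)) a x Y) =
    gram_pair (gram g' a (chart_map a x)) X Y.
  rewrite (pushforward_dot sf0 cp2 f0U X Y aM ax) flatE g'E ix.
  rewrite /gram_pair -scalemxAr -scalemxAl [RHS]mxE /s exprMn exprVn.
  by rewrite mulrA [_ ^- 2 * _]mulrC.
split=> // X X0; apply/eqP; apply: contraT => Xn0.
have := gram_pos g' aM cx Xn0; rewrite -metric X0 ambient_formE wdot0l ltxx.
by [].
Qed.

End CommonSource.

(** * Conformal invariance *)

Theorem corollary2 (R : realType) (n p k : nat) (M : smooth_manifold R n)
    (c c' : R) (g : riemannian_metric M) (f : M -> 'rV[R]_(n + p).+1)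
    (UN : set (M * 'rV[R]_(n + p).+1))
    (phi : 'rV[R]_(n + p).+1 -> 'rV[R]_(n + p).+1)
    (hf : isometric_immersion c g f)
    (hUN : unit_normal_bundle c f UN)
    (hk : k_umbilical c g f UN k)
    (hphi : conformal_diffeo c c' phi) :
  exists g' : riemannian_metric M,
    isometric_immersion c' g' (phi \o f) /\
    forall UN' : set (M * 'rV[R]_(n + p).+1),
      unit_normal_bundle c' (phi \o f) UN' ->
      k_umbilical c' g' (phi \o f) UN' k /\
      (k_dupin c g f UN k -> k_dupin c' g' (phi \o f) UN' k).
Proof.
have [[psi [phiK psiK sphi spsi]] [lambda conf]] := hphi.
pose f0 x : 'rV[R]_(n + p) := stereo_inv c (f x).
have barf := hf.1.
have fE : f = fun x => stereo c (f0 x).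
  by apply/funext => x; rewrite /f0 stereo_invK.
have f0U x : stereo_dom c (f0 x) by exact: stereo_inv_dom.
have sf0 a : atlas M a -> smooth (chart_codom a) (f0 \o chart_inv a).
  move=> aM; have [_ oc _ _ _] := atlas_chart aM.
  apply: (smooth_comp oc (open_stereo_halfspace (c := c)) _ (hf.2 a aM).1
    (@smooth_stereo_inv R (n + p) c)) => u _.
  by apply: stereo_denom_gt0; exact: barf.
move: f0 fE f0U sf0 => f0 fE f0U sf0; subst f.
have cp1 := stereo_cp (n + p) c.
have cp2 := composed_cp phiK sphi conf.
have hess2 := composed_tau_hessian phiK psiK sphi spsi conf.
have [g' gf'] := immersion_transfer sf0 cp1 cp2 f0U hf (fun x => (phiK _ (barf x)).1).
exists g'; split=> // UN' hUN'; split.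
  exact: (k_umbilical_transfer sf0 cp1 cp2 f0U hf gf' hUN hUN' hk).
apply: (k_dupin_transfer sf0 cp1 cp2 f0U hf gf' hUN hUN') => y v w Uy vw.
  by rewrite derive2_stereo_tau vw mulr0.
exact: hess2 Uy vw.
Qed.
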